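(* All Gushel--Mukai varieties of dimension $n\in\{5,6\}$ are rational.
   Context: Everything is over $\mathbf{C}$. Let $V_5$ be a $5$-dimensional vector space and let $\mathrm{Gr}(2,V_5)\subset\mathbf{P}(\bigwedge^2V_5)$ be in its Plücker embedding. Gushel--Mukai varieties of dimension $5$ or $6$ are the following smooth varieties. Ordinary (only in dimension $5$): smooth intersections $X=\mathrm{Gr}(2,V_5)\cap Q$ of dimension $5$ with $Q\subset\mathbf{P}(\bigwedge^2V_5)$ a quadric. Special of dimension $n\in\{5,6\}$: smooth double covers $X\to\mathrm{Gr}(2,V_5)\cap\mathbf{P}(W_{n+4})$ of an $n$-dimensional linear section (with $W_{n+4}\subset\bigwedge^2V_5$ a vector subspace of dimension $n+4$), branched along an ordinary Gushel--Mukai variety $X'=\mathrm{Gr}(2,V_5)\cap\mathbf{P}(W_{n+4})\cap Q$ of dimension $n-1$, where $Q$ is a quadric. Equivalently, they are the smooth Fano varieties of dimension $n$, Picard number $1$, index $n-2$, and degree $10$. *)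

(* Defs.v *)
From mathcomp Require Import all_boot all_order all_algebra.
From mathcomp Require Import ring reals.
From mathcomp Require Import complex.
From mathcomp Require Import mpoly.

Set Implicit Arguments.
Unset Strict Implicit.
Unset Printing Implicit Defensive.

Import GRing.Theory.
Local Open Scope ring_scope.

(* Classical projective geometry over K, used below for K algebraically closed.
   A point of the projective space with n homogeneous coordinates is a nonzero
   row vector, taken up to [peq]; the sets of points that occur are invariant
   under nonzero scalars. *)

Section ProjectiveGeometry.
Variable K : fieldType.

Definition pset n := 'rV[K]_n -> Prop.

Definition peval n (p : {mpoly K[n]}) (x : 'rV[K]_n) : K :=
  p.@[fun i => x 0 i].

Definition peq n (x y : 'rV[K]_n) : Prop := exists2 c : K, c != 0 & y = c *: x.

Definition psubset n (A B : pset n) : Prop := forall x, A x -> B x.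
Definition pinter n (A B : pset n) : pset n := fun x => A x /\ B x.

Definition homogeneous n (S : seq {mpoly K[n]}) : Prop :=
  forall p, p \in S -> exists d, p \is d.-homog.

Definition pzeros n (S : seq {mpoly K[n]}) : pset n :=
  fun x => x != 0 /\ forall p, p \in S -> peval p x = 0.

Definition pclosed n (Z : pset n) : Prop :=
  exists2 S, homogeneous S & forall x, Z x <-> pzeros S x.

Definition popen n (O : pset n) : Prop :=
  exists2 S, homogeneous S & forall x, O x <-> x != 0 /\ ~ pzeros S x.

Definition pirreducible n (Z : pset n) : Prop :=
  (exists x, Z x) /\
  forall A B : pset n, pclosed A -> pclosed B ->
    (forall x, Z x -> A x \/ B x) -> psubset Z A \/ psubset Z B.

Definition irreducible_chain n (Z : pset n) (m : nat) : Prop :=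
  exists c : nat -> pset n,
    (forall i, (i <= m)%N ->
       [/\ pclosed (c i), pirreducible (c i) & psubset (c i) Z]) /\
    (forall i, (i < m)%N ->
       psubset (c i) (c i.+1) /\ ~ psubset (c i.+1) (c i)).

Definition krull_dim n (Z : pset n) (m : nat) : Prop :=
  irreducible_chain Z m /\ ~ irreducible_chain Z m.+1.

(* A map given by representatives of points, locally by homogeneous polynomials
   of one common degree without common zero. *)
Definition regular_on n m (U : pset n) (f : 'rV[K]_n -> 'rV[K]_m) : Prop :=
  forall x, U x ->
    exists (O : pset n) (d : nat) (F : 'I_m -> {mpoly K[n]}),
      [/\ popen O, O x, (forall i, F i \is d.-homog) &
          forall y, U y -> O y ->
            let Fy := \row_i peval (F i) y in Fy != 0 /\ peq (f y) Fy].

Definition isomorphism_on n m (U : pset n) (V : pset m)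
    (f : 'rV[K]_n -> 'rV[K]_m) (g : 'rV[K]_m -> 'rV[K]_n) : Prop :=
  [/\ regular_on U f, regular_on V g,
      (forall x, U x -> V (f x) /\ peq (g (f x)) x) &
      (forall y, V y -> U (g y) /\ peq (f (g y)) y)].

(* Z is birational to the projective space of dimension d. *)
Definition rational_variety n (Z : pset n) (d : nat) : Prop :=
  pirreducible Z /\
  exists (O : pset n) (O' : pset d.+1),
    [/\ popen O, popen O', (exists x, pinter Z O x), (exists y, O' y) &
        exists f g, isomorphism_on (pinter Z O) O' f g].

(* The projective scheme defined by the equations [eqns]. *)
Record projScheme := ProjScheme {
  ncoord : nat;
  eqns : seq {mpoly K[ncoord]} }.

Definition points (X : projScheme) : pset (ncoord X) := pzeros (eqns X).
Arguments points : clear implicits.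

Definition jacobian (X : projScheme) (x : 'rV[K]_(ncoord X)) :
    'M[K]_(size (eqns X), ncoord X) :=
  \matrix_(i, j) peval (mderiv j (eqns X)`_i) x.

(* The Zariski tangent space at x has dimension ncoord X - 1 - rank; requiring
   this to be n makes the irreducible n-dimensional scheme X smooth, hence also
   reduced. *)
Definition smooth_variety (X : projScheme) (n : nat) : Prop :=
  [/\ homogeneous (eqns X), pirreducible (points X), krull_dim (points X) n &
      forall x, points X x -> (\rank (jacobian x) + n).+1 = ncoord X].

(* The points (w, t) with w in Y and t^2 = q(w): for a quadratic form q these
   are the points of the relative spectrum over Y of O + O(-1), with
   multiplication O(-1) * O(-1) -> O given by q. *)
Definition standard_double_cover (Y : projScheme) (q : {mpoly K[ncoord Y]}) :
    pset (ncoord Y + 1) :=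
  fun y => points Y (lsubmx y) /\ rsubmx y 0 0 ^+ 2 = peval q (lsubmx y).

Definition double_cover (X Y : projScheme) (q : {mpoly K[ncoord Y]})
    (pi : 'rV[K]_(ncoord X) -> 'rV[K]_(ncoord Y)) : Prop :=
  exists f g, isomorphism_on (points X) (standard_double_cover q) f g /\
    forall x, points X x -> peq (pi x) (lsubmx (f x)).

End ProjectiveGeometry.

Arguments points {K} X _.

Section GushelMukai.
Variable K : fieldType.

(* Coordinates p_ij, i < j, of the second exterior power of K^5, in
   lexicographic order. *)
Definition plucker_pairs : seq (nat * nat) :=
  [:: (0, 1); (0, 2); (0, 3); (0, 4); (1, 2); (1, 3); (1, 4); (2, 3); (2, 4);
      (3, 4)]%N.

Definition plucker_index (i j : nat) : 'I_10 :=
  inord (index (i, j) plucker_pairs).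

Definition wedge (u v : 'rV[K]_5) : 'rV[K]_10 :=
  \row_k let ij := nth (0, 0)%N plucker_pairs k in
    u 0 (inord ij.1) * v 0 (inord ij.2) - u 0 (inord ij.2) * v 0 (inord ij.1).

(* The relation p_ab p_cd - p_ac p_bd + p_ad p_bc = 0, where a < b < c < d are
   the elements of 'I_5 other than m. *)
Definition plucker_relation (m : 'I_5) : {mpoly K[10]} :=
  let P i j := 'X_(plucker_index (bump m i) (bump m j)) in
  P 0%N 1%N * P 2%N 3%N - P 0%N 2%N * P 1%N 3%N + P 0%N 3%N * P 1%N 2%N.

Definition gr25_eqns : seq {mpoly K[10]} :=
  [seq plucker_relation m | m <- enum 'I_5].

(* Linear subspaces of the exterior square are row spaces; these linear forms
   are equations of the row space of W. *)
Definition linear_eqns (W : 'M[K]_10) : seq {mpoly K[10]} :=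
  [seq \sum_(i < 10) cokermx W i j *: 'X_i | j <- enum 'I_10].

Definition gr_linear_section (W : 'M[K]_10) : projScheme K :=
  ProjScheme (gr25_eqns ++ linear_eqns W).

Definition gr_quadric_section (W : 'M[K]_10) (q : {mpoly K[10]}) :
    projScheme K :=
  ProjScheme (gr25_eqns ++ linear_eqns W ++ [:: q]).

Definition ordinary_GM_data (n : nat) (W : 'M[K]_10) (q : {mpoly K[10]}) :
    Prop :=
  [/\ \rank W = (n + 5)%N, q \is 2.-homog &
      smooth_variety (gr_quadric_section W q) n].

Definition ordinary_GM (n : nat) (X : projScheme K) : Prop :=
  exists W q, ordinary_GM_data n W q /\ X = gr_quadric_section W q.

Definition special_GM (n : nat) (X : projScheme K) : Prop :=
  smooth_variety X n /\
  exists W (q : {mpoly K[10]}) pi,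
    [/\ \rank W = (n + 4)%N,
        krull_dim (points (gr_linear_section W)) n,
        ordinary_GM_data n.-1 W q &
        @double_cover _ X (gr_linear_section W) q pi].

(* For n = 5 or n = 6; lower-dimensional ordinary varieties occur only as
   branch loci. *)
Definition GushelMukai (n : nat) (X : projScheme K) : Prop :=
  n = 5%N /\ ordinary_GM 5 X \/ special_GM n X.

Lemma plucker_relationE (m : 'I_5) (x : 'rV[K]_10) :
  let P i j := x 0 (plucker_index (bump m i) (bump m j)) in
  peval (plucker_relation m) x =
    P 0%N 1%N * P 2%N 3%N - P 0%N 2%N * P 1%N 3%N + P 0%N 3%N * P 1%N 2%N.
Proof.
rewrite /peval /plucker_relation; cbv zeta beta; move: plucker_index => P.
rewrite mevalD mevalB (mevalM _ 'X_(P (bump m 0) (bump m 1))).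
rewrite (mevalM _ 'X_(P (bump m 0) (bump m 2))).
rewrite (mevalM _ 'X_(P (bump m 0) (bump m 3))).
by do 6 rewrite mevalXU.
Qed.

Lemma plucker_pairs_mem i j : (i < j < 5)%N -> (i, j) \in plucker_pairs.
Proof.
case/andP.
by move: i j => [|[|[|[|[|i]]]]] [|[|[|[|[|j]]]]].
Qed.

Lemma wedgeE (u v : 'rV[K]_5) i j : (i < j < 5)%N ->
  wedge u v 0 (plucker_index i j) =
    u 0 (inord i) * v 0 (inord j) - u 0 (inord j) * v 0 (inord i).
Proof.
move=> /plucker_pairs_mem ij.
have ij10 : (index (i, j) plucker_pairs < 10)%N by rewrite index_mem.
by rewrite mxE /plucker_index inordK // nth_index.
Qed.

Lemma wedge_gr u v m : peval (plucker_relation m) (wedge u v) = 0.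
Proof.
rewrite plucker_relationE.
case: m => m hm; cbn [nat_of_ord].
have [h1 h2 h3 h4]: [/\ bump m 0 < bump m 1, bump m 1 < bump m 2, bump m 2 < bump m 3 & bump m 3 < 5]%N.
  by move: hm; case: m => [|[|[|[|[|m]]]]].
move: h1 h2 h3 h4; move: (bump m 0) (bump m 1) (bump m 2) (bump m 3) => a b c d ab bc cd d5.
have T := ltn_trans.
have bd := T _ _ _ bc cd; have ac := T _ _ _ ab bc; have ad := T _ _ _ ab bd.
have c5 := T _ _ _ cd d5. have b5 := T _ _ _ bc c5.
rewrite !wedgeE ?ab ?ac ?ad ?bc ?bd ?cd ?b5 ?c5 ?d5 //.
ring.
Qed.

Definition skewc (p : nat -> nat -> K) i j :=
  if (i < j)%N then p i j else if (j < i)%N then - p j i else 0.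

Lemma skew_plucker (p : nat -> nat -> K) :
  (forall m, (m < 5)%N ->
    let P i j := p (bump m i) (bump m j) in
    P 0%N 1%N * P 2%N 3%N - P 0%N 2%N * P 1%N 3%N + P 0%N 3%N * P 1%N 2%N = 0) ->
  forall a b i j, (a < b < 5)%N -> (i < j < 5)%N ->
  skewc p a b * skewc p i j = skewc p a i * skewc p b j - skewc p a j * skewc p b i.
Proof.
move=> H a b i j /andP[ab b5] /andP[ij j5].
have := H 0%N isT; have := H 1%N isT; have := H 2%N isT; have := H 3%N isT; have := H 4%N isT.
rewrite /bump /= !addnE /= {H} => H4 H3 H2 H1 H0.
rewrite /skewc.
move: a b i j ab b5 ij j5 =>
 [|[|[|[|[|?]]]]] [|[|[|[|[|?]]]]] // [|[|[|[|[|?]]]]] [|[|[|[|[|?]]]]] //= _ _ _ _.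
all: try ring.
all: apply/eqP; rewrite -subr_eq0; apply/eqP.
all: have N : forall z : K, z = 0 -> - z = 0 by move=> z ->; rewrite oppr0.
all: first [refine (etrans _ H0); ring |
  refine (etrans _ H1); ring |
  refine (etrans _ H2); ring |
  refine (etrans _ H3); ring |
  refine (etrans _ H4); ring |
  refine (etrans _ (N _ H0)); ring |
  refine (etrans _ (N _ H1)); ring |
  refine (etrans _ (N _ H2)); ring |
  refine (etrans _ (N _ H3)); ring |
  refine (etrans _ (N _ H4)); ring].
Qed.

Lemma gr25P (x : 'rV[K]_10) :
  pzeros gr25_eqns x <-> x != 0 /\ exists u v, x = wedge u v.
Proof.
split=> [[x0 H]|[x0 [u [v xE]]]]; split=> //; last first.
  by move=> p /mapP[m _ ->]; rewrite xE wedge_gr.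
pose p i j := x 0 (plucker_index i j).
have /skew_plucker S : forall m, (m < 5)%N ->
    let P i j := p (bump m i) (bump m j) in
    P 0%N 1%N * P 2%N 3%N - P 0%N 2%N * P 1%N 3%N + P 0%N 3%N * P 1%N 2%N = 0.
  move=> m m5; have := H (plucker_relation (Ordinal m5)).
  by rewrite plucker_relationE; apply; apply: map_f; rewrite mem_enum.
have idx (k : 'I_10) : exists i j,
    [/\ (i < j < 5)%N, nth (0, 0)%N plucker_pairs k = (i, j) &
         k = plucker_index i j].
  case kE : (nth (0, 0)%N plucker_pairs k) => [i j]; exists i, j; split=> //.
    have : (i, j) \in plucker_pairs by rewrite -kE mem_nth.
    by move/(allP (isT : all (fun ij => ij.1 < ij.2 < 5)%N plucker_pairs)).
  apply/val_inj; rewrite /plucker_index -kE index_uniq //= inordK //.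
have /existsP[k xk] : [exists k, x 0 k != 0].
  apply/contraNT: x0 => /existsPn H0; apply/eqP/rowP=> k; rewrite mxE.
  by apply/eqP; move: (H0 k); rewrite negbK.
have [a [b [ab _ kE]]] := idx k.
have pab : skewc p a b != 0 by rewrite /skewc; case/andP: ab => -> _; rewrite /p -kE.
exists (\row_j (skewc p a j / skewc p a b)), (\row_j skewc p b j).
apply/rowP=> l; have [i [j [ij lE ->]]] := idx l.
rewrite wedgeE // !mxE.
have [ij' j5] := andP ij; have i5 := ltn_trans ij' j5.
rewrite !inordK //.
have -> : x 0 (plucker_index i j) = skewc p i j by rewrite /skewc ij'.
apply: (mulfI pab); rewrite (S a b i j ab ij).
move: pab (skewc p a i) (skewc p b j) (skewc p a j) (skewc p b i).
by move: (skewc p a b) => c c0 s1 s2 s3 s4; field.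
Qed.

Lemma linear_eqnsP (W : 'M[K]_10) (x : 'rV[K]_10) :
  (forall p, p \in linear_eqns W -> peval p x = 0) <-> (x <= W)%MS.
Proof.
have E j : peval (\sum_(i < 10) cokermx W i j *: 'X_i) x =
    (x *m cokermx W) 0 j.
  rewrite /peval raddf_sum mxE; apply: eq_bigr => i _.
  by rewrite /= mevalZ mevalXU mulrC.
split=> [H|].
  rewrite submxE; apply/eqP/rowP=> j; rewrite [RHS]mxE -E; apply: H.
  by apply: map_f; rewrite mem_enum.
by rewrite submxE => /eqP xW p /mapP[j _ ->]; rewrite E xW mxE.
Qed.

End GushelMukai.

(* Main.v *)
Require Import Defs.
From mathcomp Require Import all_boot all_order all_algebra.
From mathcomp Require Import ring lra zify.
From mathcomp Require Import boolp classical_sets reals.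
From mathcomp Require Import complex.
From mathcomp Require Import mpoly.

(* Write the variety over Gr(2,V5) with the equation q(w) = 0, or t^2 = q(w).

   Suppose that a flag V1 < V4 < V5 is such that q vanishes on the plane
   P(V1 /\ V4), or, for the special fivefolds, is the square of a linear form
   there, with V1 /\ V4 in the hyperplane W.  Mapping a 2-plane to its
   intersection with V4 makes the variety a quadric bundle over P(V4), and
   V1 /\ V4 provides a section of it; hence it is rational, provided the
   section avoids the vertex of the general fibre.  Explicitly, in suitable
   Pluecker coordinates the equation is linear in one variable with nonzero
   coefficient.  That the coefficient is nonzero follows from the smoothness of
   the branch locus, resp. of the variety.

   Flags of this kind form a proper family over the space of quadratic forms, so
   the forms which have one are cut out by eliminants (this uses the
   Nullstellensatz).  Join the given form to a particular form q0: near q0 the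
   forms which have a flag depend on the flag through a map which at q0 itself
   is a linear surjection.  So every eliminant vanishes to infinite order along
   the fibre over q0, hence is zero, and every form has a flag. *)

Set Implicit Arguments.
Unset Strict Implicit.
Unset Printing Implicit Defensive.

Import GRing.Theory Num.Theory Order.TTheory.
Local Open Scope ring_scope.

(** * The Nullstellensatz over the complex numbers *)

(** Flags V1 < V4 < V5 depend on 7 parameters, and vanishing on the plane P(V1 /\ V4) is 6
    conditions, so a flag is to be expected for every form. For the special fivefolds the form need
    only be a square on the plane, which is 3 conditions, and this leaves 3 for V1 /\ V4 to lie in
    the hyperplane. Both problems belong to one family, with an auxiliary linear form theta on V4
    such that q = eps theta^2 and om + delta theta = 0 on V1 /\ V4. Here (delta, eps) = (1, 0) with
    om = 0 is the first problem and (0, 1) the second. A single deformation, starting at (1, 0),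
    where theta = - om can be solved for, settles both. The flag is not followed along the
    deformation, which would need implicit functions. It is kept fixed, and the form is corrected
    instead: three Pluecker coordinates restrict to coordinates on V1 /\ V4, so a quadratic form in
    them compensates any change of the restriction, and the correction is linear in the deformation
    parameter. Only polynomial identities remain. *)

Section Uncountable.
Variable R : realType.

Lemma real_avoids_sequence (e : nat -> R) :
  exists2 x : R, 0 < x & forall n, x != e n.
Proof.
(* In the second case the right end lies strictly below the midpoint, so that [x] equal to the
   midpoint is excluded as well. Starting from the interval between 1 and 2 makes the limit
   positive. *)
pose next (ab : R * R) (x : R) :=
  let m := (ab.1 + ab.2) / 2 in
  if x < m then (m, ab.2) else (ab.1, (ab.1 + m) / 2).
pose fix I n := if n is k.+1 then next (I k) (e k) else (1 : R, 2 : R).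
have lt n : (I n).1 < (I n).2.
  elim: n => [|n IH] /=; first lra.
  by rewrite /next; move: IH; case: (I n) => a b /= ab; case: ifP => _ /=; lra.
have nest n : (I n).1 <= (I n.+1).1 /\ (I n.+1).2 <= (I n).2.
  rewrite /= /next; move: (lt n); case: (I n) => a b /= ab.
  by case: ifP => _ /=; split; lra.
have nestD n k : (I n).1 <= (I (n + k)%N).1 /\ (I (n + k)%N).2 <= (I n).2.
  elim: k => [|k [h1 h2]]; first by rewrite addn0.
  by rewrite addnS; have [h3 h4] := nest (n + k)%N; split; apply: le_trans; eauto.
have cross n k : (I n).1 <= (I k).2.
  have [h1 _] := nestD n k; have [_ h2] := nestD k n.
  by rewrite addnC in h2; apply: (le_trans h1); apply: (le_trans (ltW (lt _))).
pose A := [set x : R | exists n, x = (I n).1]%classic.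
have ubA k : ubound A (I k).2 by move=> _ [n ->].
have supA n : (I n).1 <= sup A.
  by apply: ub_le_sup; [exists (I 0).2; apply: ubA | exists n].
have supB n : sup A <= (I n).2.
  by apply: ge_sup; [exists (I 0).1, 0%N | apply: ubA].
exists (sup A); first by apply: lt_le_trans (supA 0%N); exact: ltr01.
move=> n; apply/eqP => sE; move: (supA n.+1) (supB n.+1) (lt n).
rewrite /= /next sE; case: (I n) => a b /=.
case: ifP => /= h h1 h2 h3; first by rewrite ltNge h1 in h.
by move/negbT: h; rewrite -leNgt; lra.
Qed.

Lemma finite_or_unbounded (T : eqType) (Q : T -> Prop) r :
  (exists s : seq T, [/\ uniq s, size s = r & forall c, c \in s -> Q c]) \/
  exists L : seq T, forall c, Q c -> c \in L.
Proof.
elim: r => [|r [[s [us ss Qs]]|]]; [by left; exists [::] | | by right].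
have [[c Qc cs]|nex] := pselect (exists2 c, Q c & c \notin s).
  left; exists (c :: s); split=> /=; [by rewrite cs | by rewrite ss |].
  by move=> d; rewrite inE => /orP[/eqP->|/Qs].
right; exists s => c Qc; apply/negPn/negP => cs; apply: nex; by exists c.
Qed.

(* The uncountability of the complex numbers, used for the Nullstellensatz. *)
Lemma complex_pigeonhole (P : nat -> R[i] -> Prop) :
  (forall c, c != 0 -> exists d, P d c) ->
  exists d, forall r, exists s : seq R[i],
    [/\ uniq s, size s = r & forall c, c \in s -> c != 0 /\ P d c].
Proof.
move=> H; apply: contrapT => nex.
have /choice[L LP] d : exists L : seq R[i], forall c, c != 0 /\ P d c -> c \in L.
  have /existsNP[r nr] : ~ forall r, exists s : seq R[i],
      [/\ uniq s, size s = r & forall c, c \in s -> c != 0 /\ P d c].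
    by move=> h; apply: nex; exists d.
  by have [] := finite_or_unbounded (fun c => c != 0 /\ P d c) r.
(* One sequence runs through the real parts of all the finite lists; a positive real number avoiding
   it lies in no list. *)
pose e n := if unpickle n is Some (d, i) then complex.Re (nth 0 (L d) i) else 0.
have [x x0 xe] := real_avoids_sequence e.
have c0 : (x%:C)%C != 0 by rewrite (inj_eq (@complexI _)) gt_eqF.
have [d Pd] := H _ c0; have cL := LP d _ (conj c0 Pd).
have /eqP[] := xe (pickle (d, index (x%:C)%C (L d))).
by rewrite /e pickleK nth_index.
Qed.

End Uncountable.

Section Nullstellensatz.
Variables (R : realType) (N : nat).
Local Notation K := R[i].
Local Notation MP := {mpoly K[N]}.

Record mideal (I : MP -> Prop) : Prop := MIdeal {
  mideal0 : I 0;
  midealD : forall f g, I f -> I g -> I (f + g);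
  midealM : forall a f, I f -> I (a * f) }.

Lemma midealB I f g : mideal I -> I f -> I g -> I (f - g).
Proof.
by move=> iI If Ig; rewrite -mulN1r; apply: midealD => //; apply: midealM.
Qed.

Lemma mideal_sum I (T : Type) (r : seq T) (F : T -> MP) :
  mideal I -> (forall i, I (F i)) -> I (\sum_(i <- r) F i).
Proof.
move=> iI IF; elim: r => [|x r IH]; first by rewrite big_nil; apply: mideal0.
by rewrite big_cons; apply: midealD.
Qed.

Lemma mpoly_linear_dependence d r (g : 'I_r -> MP) :
  (forall i, msize (g i) <= d)%N -> (#|{: 'X_{1..N < d}}| < r)%N ->
  exists2 a : 'I_r -> K, exists i, a i != 0 & \sum_i a i *: g i = 0.
Proof.
move=> gd lt_r.
pose A := \matrix_(i < r, k < #|{: 'X_{1..N < d}}|) (g i)@_(enum_val k).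
have /rowV0Pn[a aker a0] : kermx A != 0.
  by rewrite kermx_eq0 /row_free neq_ltn (leq_ltn_trans (rank_leq_col _)).
exists (fun i => a 0 i).
  apply/existsP; apply: contraNT a0 => /existsPn h; apply/eqP/rowP => i.
  by rewrite mxE; apply/eqP; move: (h i); rewrite negbK.
apply/mpolyP => m; rewrite mcoeff0 raddf_sum /=.
have [md|dm] := ltnP (mdeg m) d; last first.
  rewrite big1 // => i _; rewrite mcoeffZ [X in _ * X](_ : _ = 0) ?mulr0 //.
  by apply/eqP; rewrite mcoeff_eq0 msize_mdeg_ge // (leq_trans (gd i)).
move/sub_kermxP: aker => /rowP/(_ (enum_rank (BMultinom md))).
rewrite !mxE => aA; rewrite -[RHS]aA; apply: eq_bigr => i _.
by rewrite mcoeffZ mxE enum_rankK.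
Qed.

Definition var_poly (i : 'I_N) (p : {poly K}) : MP :=
  (map_poly (@mpolyC N K) p).['X_i].

Lemma var_polyM i p q : var_poly i (p * q) = var_poly i p * var_poly i q.
Proof. by rewrite /var_poly rmorphM hornerM. Qed.

Lemma var_polyXsubC i c : var_poly i ('X - c%:P) = 'X_i - c%:MP.
Proof. by rewrite /var_poly rmorphB /= map_polyX map_polyC /= hornerXsubC. Qed.

Lemma var_polyZ i c p : var_poly i (c *: p) = c%:MP * var_poly i p.
Proof. by rewrite /var_poly map_polyZ hornerZ. Qed.

Lemma var_poly1 i : var_poly i 1 = 1.
Proof. by rewrite /var_poly rmorph1 hornerC. Qed.

Lemma var_poly_sum i (T : Type) (r : seq T) (F : T -> {poly K}) :
  var_poly i (\sum_(j <- r) F j) = \sum_(j <- r) var_poly i (F j).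
Proof. by rewrite /var_poly rmorph_sum horner_sum. Qed.

(* Adding a root to an ideal: if every [X_i - c] were invertible modulo [I],
   uncountably many inverses would have bounded degree, hence be linearly
   dependent; clearing denominators would put a nonzero polynomial in [X_i],
   a product of invertible factors, into [I]. *)
Lemma proper_ideal_root I (i : 'I_N) (sat : bool) :
  mideal I -> ~ I 1 -> (sat -> forall f, I ('X_i * f) -> I f) ->
  exists c : K, (sat -> c != 0) /\
    ~ exists a, I (1 - a * ('X_i - c%:MP)).
Proof.
move=> iI I1 Isat; apply: contrapT => nex.
have inv c : (sat -> c != 0) -> exists a, I (1 - a * ('X_i - c%:MP)).
  by move=> hc; apply: contrapT => h; apply: nex; exists c.
have cancel c : (sat -> c != 0) ->
    forall f, I (('X_i - c%:MP) * f) -> I f.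
  move=> /inv[a Ia] f If.
  rewrite [f](_ : _ = f * (1 - a * ('X_i - c%:MP)) + a * (('X_i - c%:MP) * f)).
    by apply: (midealD iI); apply: midealM.
  ring.
(* Under [sat] the excluded value c = 0 is harmless: saturation itself allows cancelling the
   variable. *)
have cancel' c f : I (('X_i - c%:MP) * f) -> I f.
  have [c0|c0] := eqVneq c 0; last by apply: cancel.
  case: (boolP sat) => [hs|hs]; last by apply: cancel; rewrite (negbTE hs).
  by rewrite c0 mpolyC0 subr0; apply: Isat.
have [c c0|d dP] := @complex_pigeonhole R
    (fun d c => exists2 g : MP, (msize g <= d)%N & I (1 - g * ('X_i - c%:MP))).
  by have [//|g Ig] := inv c; exists (msize g), g.
have [s [us ss sP]] := dP #|{: 'X_{1..N < d}}|.+1.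
have /choice[g gP] (j : 'I_#|{: 'X_{1..N < d}}|.+1) :
    exists g : MP, (msize g <= d)%N /\ I (1 - g * ('X_i - (s`_j)%:MP)).
  have /sP[_ [h h1 h2]] : s`_j \in s by rewrite mem_nth ?ss.
  by exists h.
have [|//|a [j0 aj0] ag] := @mpoly_linear_dependence d _ g.
  by move=> j; have [] := gP j.
pose q j := \prod_(k | k != j) ('X - (s`_(k : 'I_#|{: 'X_{1..N < d}}|.+1))%:P) : {poly K}.
pose p := \sum_j a j *: q j.
have p0 : p != 0.
  apply: contraNneq aj0 => /(congr1 (fun p => p.[s`_j0])).
  rewrite horner0 horner_sum (bigD1 j0) //= big1 => [|k kj]; last first.
    by rewrite hornerZ /q (bigD1 j0) 1?eq_sym //= hornerM hornerXsubC subrr mul0r mulr0.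
  rewrite addr0 hornerZ => /eqP; rewrite mulf_eq0 => /orP[/eqP-> //|].
  rewrite /q horner_prod prodf_seq_eq0 => /hasP[k _ /andP[kj]].
  by rewrite hornerXsubC subr_eq0 nth_uniq ?ss // => /eqP/val_inj ej; rewrite ej eqxx in kj.
have Ip : I (var_poly i p).
  (* The subtracted part is the full product of the linear factors times the linear combination of
     the [g j], which is zero. What remains is a combination of elements of [I]. *)
  have -> : var_poly i p = \sum_j (a j)%:MP * var_poly i (q j) *
      (1 - g j * ('X_i - (s`_j)%:MP)).
    rewrite /p var_poly_sum; under eq_bigr do rewrite var_polyZ.
    apply/eqP; rewrite -subr_eq0 -sumrB.
    rewrite [X in X == 0](_ : _ =
      var_poly i (\prod_j ('X - (s`_(j : 'I_#|{: 'X_{1..N < d}}|.+1))%:P)) *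
      \sum_j a j *: g j); first by rewrite ag mulr0.
    rewrite mulr_sumr; apply: eq_bigr => j _.
    rewrite (bigD1 j) //= -/(q j) var_polyM var_polyXsubC -mul_mpolyC; ring.
  by apply: mideal_sum => // j; apply: midealM => //; have [] := gP j.
apply: I1; move: Ip; have [rs ->] := closed_field_poly_normal p.
have lp0 : lead_coef p != 0 by rewrite lead_coef_eq0.
rewrite var_polyZ => /(midealM iI ((lead_coef p)^-1)%:MP).
rewrite mulrA -mpolyCM mulVf // mpolyC1 mul1r.
elim: rs => [|z rs IH]; first by rewrite big_nil var_poly1.
by rewrite big_cons var_polyM var_polyXsubC => /cancel'/IH.
Qed.

Definition add_root I (i : 'I_N) (c : K) : MP -> Prop :=
  fun f => exists a, I (f - a * ('X_i - c%:MP)).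

Lemma add_root_mideal I i c : mideal I -> mideal (add_root I i c).
Proof.
move=> iI; split=> [|f g [a fa] [b gb]|b f [a fa]].
- by exists 0; rewrite mul0r subr0; apply: mideal0.
- exists (a + b); rewrite mulrDl opprD addrACA; exact: midealD.
- by exists (b * a); rewrite -mulrA -mulrBr; apply: midealM.
Qed.

Lemma sub_add_root I i c f : I f -> add_root I i c f.
Proof. by move=> If; exists 0; rewrite mul0r subr0. Qed.

(** Roots are adjoined one variable at a time, keeping the ideal proper. Modulo the final ideal
    every polynomial is congruent to its value at [c], so a nonzero value of a member would be a
    unit in a proper ideal. *)
Lemma weak_nullstellensatz I : mideal I -> ~ I 1 ->
  exists c : 'I_N -> K, forall f, I f -> f.@[c] = 0.
Proof.
move=> iI I1.
have step (s : seq 'I_N) : exists J, [/\ mideal J, ~ J 1, forall f, I f -> J f &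
    forall i, i \in s -> exists c, J ('X_i - c%:MP)].
  elim: s => [|i s [J [iJ J1 IJ Js]]]; first by exists I.
  have [//|c [_ Jc]] := @proper_ideal_root J i false iJ J1.
  exists (add_root J i c); split => //; first exact: add_root_mideal.
    by move=> f /IJ; apply: sub_add_root.
  move=> j; rewrite inE => /orP[/eqP->|/Js[e Je]]; last by exists e; apply: sub_add_root.
  by exists c, 1; rewrite mul1r subrr; apply: mideal0.
have [J [iJ J1 IJ JX]] := step (enum 'I_N).
have /choice[c cP] i : exists c, J ('X_i - c%:MP) by apply: JX; rewrite mem_enum.
have Jeval f : J (f - (f.@[c])%:MP).
  pose Q (f : MP) := J (f - (f.@[c])%:MP).
  have QC e : Q e%:MP by rewrite /Q mevalC subrr; apply: mideal0.
  have QD f1 f2 : Q f1 -> Q f2 -> Q (f1 + f2).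
    by move=> h1 h2; rewrite /Q mevalD mpolyCD opprD addrACA; apply: midealD.
  have QM f1 f2 : Q f1 -> Q f2 -> Q (f1 * f2).
    move=> h1 h2; rewrite /Q mevalM mpolyCM.
    rewrite [_ - _](_ : _ = f2 * (f1 - (f1.@[c])%:MP) +
      (f1.@[c])%:MP * (f2 - (f2.@[c])%:MP)); last by ring.
    by apply: midealD => //; apply: midealM.
  have QX i : Q 'X_i by rewrite /Q mevalXU.
  have QXm m : Q 'X_[m].
    rewrite mpolyXE_id; elim/big_ind: _ => //; first by rewrite -mpolyC1.
    move=> i _; elim: (m i) => [|e IHe]; first by rewrite expr0 -mpolyC1.
    by rewrite exprS; apply: QM.
  rewrite -/(Q f) [f]mpolyE; elim/big_ind: _ => //; first by rewrite -mpolyC0.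
  by move=> m _; rewrite -mul_mpolyC; apply: QM.
exists c => f /IJ Jf; apply/eqP/negPn/negP => fc; apply: J1.
have := midealM iJ ((f.@[c])^-1)%:MP (midealB iJ Jf (Jeval f)).
by rewrite opprB addrCA subrr addr0 -mpolyCM mulVf.
Qed.

(** Saturation replaces the Rabinowitsch trick. If no power of the variable lies in [I], the
    saturation [J] is proper and saturated, so a root c != 0 of the variable can be adjoined to it.
    A zero of the enlarged ideal is a zero of [I] with i-th coordinate c. *)
Lemma nullstellensatz_var I (i : 'I_N) : mideal I ->
  (forall c : 'I_N -> K, (forall f, I f -> f.@[c] = 0) -> c i = 0) ->
  exists M, I ('X_i ^+ M).
Proof.
move=> iI H; apply: contrapT => nex.
pose J f := exists M, I ('X_i ^+ M * f).
have iJ : mideal J.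
  split=> [|f g [a fa] [b gb]|b f [a fa]].
  - by exists 0%N; rewrite mulr0; apply: mideal0.
  - exists (a + b)%N; rewrite mulrDr; apply: midealD => //; last first.
      by rewrite exprD -mulrA; apply: midealM.
    by rewrite addnC exprD -mulrA; apply: midealM.
  - by exists a; rewrite mulrCA; apply: midealM.
have [|_|c [/(_ isT) c0 Jc]] := @proper_ideal_root J i true iJ.
- by case=> M; rewrite mulr1 => IM; apply: nex; exists M.
- by move=> f [M]; rewrite mulrA -exprSr => IM; exists M.+1.
have [|e eP] := weak_nullstellensatz (add_root_mideal i c iJ).
  by case=> a Ja; apply: Jc; exists a.
have ei : e i = c.
  apply/eqP; rewrite -subr_eq0; apply/eqP.
  have := eP ('X_i - c%:MP); rewrite mevalB mevalXU mevalC; apply.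
  by exists 1; rewrite mul1r subrr; apply: mideal0.
case/eqP: c0; rewrite -ei; apply: H => f If; apply: eP; apply: sub_add_root.
by exists 0%N; rewrite expr0 mul1r.
Qed.

End Nullstellensatz.

(** * Elimination *)

Section Elimination.
Variables (R : realType) (N : nat).
Local Notation K := R[i].
Local Notation MP := {mpoly K[N]}.

(** A stand-in for polynomial functions of the parameter. An eliminant is a determinant, so these
    closure properties are enough to place it in the class, and the class can later be chosen to
    suit the deformation. *)
Record fun_subring (T : Type) (P : (T -> K) -> Prop) : Prop := FunSubring {
  fsub_const : forall c, P (fun=> c);
  fsubD : forall f g, P f -> P g -> P (fun t => f t + g t);
  fsubM : forall f g, P f -> P g -> P (fun t => f t * g t) }.

Lemma fsub_sum (T I : Type) (P : (T -> K) -> Prop) (r : seq I) (Q : pred I)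
    (F : I -> T -> K) :
  fun_subring P -> (forall i, P (F i)) -> P (fun t => \sum_(i <- r | Q i) F i t).
Proof.
move=> hP PF; elim: r => [|i r IH].
  by under eq_fun do rewrite big_nil; apply: fsub_const.
under eq_fun do rewrite big_cons.
by case: (Q i) => //; apply: fsubD.
Qed.

Lemma fsub_prod (T I : Type) (P : (T -> K) -> Prop) (r : seq I) (Q : pred I)
    (F : I -> T -> K) :
  fun_subring P -> (forall i, P (F i)) -> P (fun t => \prod_(i <- r | Q i) F i t).
Proof.
move=> hP PF; elim: r => [|i r IH].
  by under eq_fun do rewrite big_nil; apply: fsub_const.
under eq_fun do rewrite big_cons.
by case: (Q i) => //; apply: fsubM.
Qed.

Lemma fsub_det (T : Type) (P : (T -> K) -> Prop) n (A : T -> 'M[K]_n) :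
  fun_subring P -> (forall i j, P (fun t => A t i j)) -> P (fun t => \det (A t)).
Proof.
move=> hP PA; apply: fsub_sum => // s; apply: fsubM => //; first exact: fsub_const.
exact: fsub_prod.
Qed.

Section Degree.
Variable D : nat.

Definition deg_monom : finType := {m : 'X_{1..N < D.+1} | mdeg m == D}.

Definition monom_of (t : deg_monom) : 'X_{1..N} := val t.

Lemma monom_of_deg t : mdeg (monom_of t) = D.
Proof. exact/eqP/(valP t). Qed.

Lemma monom_ofP (m : 'X_{1..N}) : mdeg m = D -> exists t, monom_of t = m.
Proof.
move=> mD; have mlt : (mdeg m < D.+1)%N by rewrite mD.
by exists (exist (fun m : 'X_{1..N < D.+1} => mdeg m == D) (BMultinom mlt) (introT eqP mD)).
Qed.

Lemma monom_of_inj : injective monom_of.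
Proof. by move=> s t /val_inj/val_inj. Qed.

Definition deg_part (y : 'rV[K]_N) (f : MP) : K :=
  \sum_t f@_(monom_of t) * peval 'X_[monom_of t] y.

Lemma deg_part_sum (T : Type) (r : seq T) (F : T -> MP) y :
  deg_part y (\sum_(i <- r) F i) = \sum_(i <- r) deg_part y (F i).
Proof.
rewrite /deg_part exchange_big; apply: eq_bigr => t _ /=.
by rewrite raddf_sum mulr_suml.
Qed.

Lemma deg_part_homog y f e : f \is e.-homog -> peval f y = 0 -> deg_part y f = 0.
Proof.
move=> fe fy; have [eD|neD] := eqVneq e D; last first.
  rewrite /deg_part big1 // => t _; rewrite (dhomog_nemf_coeff fe) ?mul0r //.
  by rewrite [X in X != _]monom_of_deg eq_sym.
rewrite -[RHS]fy {2}[f](_ : _ = \sum_t f@_(monom_of t) *: 'X_[monom_of t]).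
  by rewrite /peval raddf_sum; apply: eq_bigr => t _ /=; rewrite mevalZ.
apply/mpolyP => m; rewrite raddf_sum /=.
have [mD|mD] := eqVneq (mdeg m) D.
  have [t tm] := monom_ofP mD; rewrite (bigD1 t) //= big1 => [|s st].
    by rewrite addr0 mcoeffZ mcoeffX tm eqxx mulr1.
  by rewrite mcoeffZ mcoeffX -tm (inj_eq monom_of_inj) (negbTE st) mulr0.
rewrite (dhomog_nemf_coeff fe) ?eD // big1 // => t _.
rewrite mcoeffZ mcoeffX; case: eqP => [tm|]; last by rewrite mulr0.
by rewrite -tm monom_of_deg eqxx in mD.
Qed.

(** Each monomial of [a] contributes a homogeneous polynomial vanishing at [y]. In elimination this
    turns the monomials at a common zero into a kernel vector. *)
Lemma deg_partM y a f e : f \is e.-homog -> peval f y = 0 -> deg_part y (a * f) = 0.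
Proof.
move=> fe fy; rewrite [a]mpolyE mulr_suml deg_part_sum big1 // => m _.
apply: (@deg_part_homog _ _ (mdeg m + e)).
  by apply: dhomogM => //; apply: dhomogZ; rewrite dhomogX.
by rewrite /peval mevalM [f.@[_]]fy mulr0.
Qed.

End Degree.

(* The main theorem of elimination theory: if the system has no nontrivial zero
   at [t1], then the forms of some large degree are generated by the equations,
   and the determinant expressing this is a nonzero eliminant. *)
Lemma elimination (T : Type) (P : (T -> K) -> Prop) (J : finType)
    (d : J -> nat) (F : J -> T -> MP) (t1 : T) :
  fun_subring P -> (forall j t, F j t \is (d j).-homog) ->
  (forall j a m, P (fun t => (a * F j t)@_m)) ->
  (forall y : 'rV[K]_N, (forall j, peval (F j t1) y = 0) -> y = 0) ->
  exists G, [/\ P G, G t1 != 0 &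
    forall t (y : 'rV[K]_N), y != 0 -> (forall j, peval (F j t) y = 0) -> G t = 0].
Proof.
move=> hP Fh FP F0.
pose I f := exists a : J -> MP, f = \sum_j a j * F j t1.
have iI : mideal I.
  split=> [|f g [a ->] [b ->]|b f [a ->]].
  - by exists (fun=> 0); rewrite big1 // => j _; rewrite mul0r.
  - by exists (fun j => a j + b j); rewrite -big_split; apply: eq_bigr => j _; rewrite mulrDl.
  - by exists (fun j => b * a j); rewrite mulr_sumr; apply: eq_bigr => j _; rewrite mulrA.
have /choice[M0 M0P] i : exists M, I ('X_i ^+ M).
  apply: nullstellensatz_var => // c cP.
  have /rowP/(_ i) : \row_k c k = 0.
    apply: F0 => j; rewrite /peval (meval_eq (v2 := c)); last by move=> k; rewrite mxE.
    apply: cP; exists (fun k => (k == j)%:R).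
    rewrite (bigD1 j) //= eqxx mul1r big1 ?addr0 // => k kj.
    by rewrite (negbTE kj) mul0r.
  by rewrite !mxE.
(* A monomial of degree exceeding N * M has an exponent exceeding M, hence is divisible by a power
   of a variable lying in the ideal. *)
pose M := \max_i M0 i; pose D := (N * M).+1.
have IX (m : 'X_{1..N}) : mdeg m = D -> I 'X_[m].
  move=> mD; have [i Mi] : exists i, (M < m i)%N.
    apply/existsP; rewrite -[[exists _, _]]negbK negb_exists; apply/negP => /forallP h.
    have : (mdeg m <= N * M)%N.
      rewrite mdegE -[X in (X * _)%N]card_ord -sum_nat_const; apply: leq_sum => i _.
      by rewrite leqNgt.
    by rewrite mD ltnn.
  have le : (U_(i) *+ M0 i <= m)%MM.
    apply/mnm_lepP => k; rewrite mulmnE mnm1E.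
    have [<-|] := eqVneq i k; last by rewrite mul0n.
    by rewrite mul1n (leq_trans _ (ltnW Mi)) // /M leq_bigmax.
  by rewrite -(submK le) mpolyXD -mpolyXn; apply: midealM.
have /choice[a aP] (t : deg_monom D) : exists a : J -> MP,
    'X_[monom_of t] = \sum_j a j * F j t1 by apply: IX; rewrite monom_of_deg.
(* The multipliers [a] are frozen at [t1]: the matrix is the identity there, and elsewhere its
   entries are sums of coefficients of multiples of the equations. *)
pose C t := \matrix_(u, v < #|deg_monom D|)
  (\sum_j a (enum_val u) j * F j t)@_(monom_of (enum_val v)).
exists (fun t => \det (C t)); split.
- apply: fsub_det => // u v.
  rewrite [X in P X](_ : _ = fun t => \sum_j (a (enum_val u) j * F j t)@_(monom_of (enum_val v))).
    exact: fsub_sum.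
  by apply/funext => t; rewrite mxE raddf_sum.
- rewrite [C t1](_ : _ = 1%:M) ?det1 ?oner_neq0 //.
  apply/matrixP => u v; rewrite !mxE -aP mcoeffX (inj_eq (@monom_of_inj _)).
  by rewrite (inj_eq enum_val_inj).
(* The vector of degree D monomials at the common zero is annihilated by every row. It is nonzero
   because it contains the D-th power of a nonzero coordinate. *)
move=> t y y0 Fy; apply/eqP; rewrite -det_tr; apply/det0P.
exists (\row_v peval 'X_[monom_of (enum_val v : deg_monom D)] y).
  have [k yk] : exists k, y 0 k != 0.
    apply/existsP; apply: contraNT y0 => /existsPn h; apply/eqP/rowP => i.
    by rewrite mxE; apply/eqP; move: (h i); rewrite negbK.
  have [s sk] : exists s : deg_monom D, monom_of s = (U_(k) *+ D)%MM.
    by apply: monom_ofP; rewrite mdegMn mdeg1 mul1n.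
  apply: contraNneq yk => /rowP/(_ (enum_rank s)).
  rewrite !mxE enum_rankK sk -mpolyXn /peval rmorphXn /= mevalXU => /eqP.
  by rewrite expf_eq0 => /andP[].
apply/rowP => u; rewrite !mxE.
have := deg_part_sum D (index_enum J) (fun j => a (enum_val u) j * F j t) y.
rewrite [RHS]big1 => [|j _]; last exact: (deg_partM _ _ (Fh j t) (Fy j)).
rewrite /deg_part (reindex _ (onW_bij _ (enum_val_bij _))) /= => E.
by rewrite -[RHS]E; apply: eq_bigr => v _; rewrite !mxE mulrC.
Qed.

End Elimination.

(** * Homogeneous polynomial maps and the exterior square *)

Section HomogeneousFunctions.
Variable K : fieldType.

(** Forms are handled as functions, so that the charts can be written as vector and matrix
    expressions; polynomials reappear only where regular maps and open sets require them. *)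
Definition hform n d (f : 'rV[K]_n -> K) : Prop :=
  exists2 p : {mpoly K[n]}, p \is d.-homog & forall x, peval p x = f x.

Definition hvec n d m (F : 'rV[K]_n -> 'rV[K]_m) : Prop :=
  forall i, hform d (fun x => F x 0 i).

Lemma pevalD n (p q : {mpoly K[n]}) x : peval (p + q) x = peval p x + peval q x.
Proof. exact: mevalD. Qed.

Lemma pevalB n (p q : {mpoly K[n]}) x : peval (p - q) x = peval p x - peval q x.
Proof. exact: mevalB. Qed.

Lemma pevalM n (p q : {mpoly K[n]}) x : peval (p * q) x = peval p x * peval q x.
Proof. exact: mevalM. Qed.

Lemma pevalZ n c (p : {mpoly K[n]}) x : peval (c *: p) x = c * peval p x.
Proof. exact: mevalZ. Qed.

Lemma pevalX n i (x : 'rV[K]_n) : peval 'X_i x = x 0 i.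
Proof. exact: mevalXU. Qed.

Lemma peval_sum n (I : Type) (r : seq I) (F : I -> {mpoly K[n]}) x :
  peval (\sum_(i <- r) F i) x = \sum_(i <- r) peval (F i) x.
Proof. exact: raddf_sum. Qed.

Lemma hform_peval n d (p : {mpoly K[n]}) : p \is d.-homog -> hform d (peval p).
Proof. by exists p. Qed.

Lemma hform0 n d : hform d (fun _ : 'rV[K]_n => 0).
Proof. by exists 0 => [|x]; [exact: dhomog0 | exact: meval0]. Qed.

Lemma hform_const n c : hform 0 (fun _ : 'rV[K]_n => c).
Proof.
exists c%:MP => [|x]; last exact: mevalC.
by rewrite -[_%:MP]mulr1 mul_mpolyC dhomogZ // dhomog1.
Qed.

Lemma hform_coord n i : hform 1 (fun x : 'rV[K]_n => x 0 i).
Proof. by exists 'X_i => [|x]; [rewrite dhomogX /= mdeg1 | exact: mevalXU]. Qed.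

Lemma hformD n d (f g : 'rV[K]_n -> K) :
  hform d f -> hform d g -> hform d (fun x => f x + g x).
Proof.
move=> [p hp pf] [q hq qg]; exists (p + q) => [|x]; first exact: dhomogD.
by rewrite /peval mevalD [p.@[_]]pf [q.@[_]]qg.
Qed.

Lemma hformM n d e (f g : 'rV[K]_n -> K) :
  hform d f -> hform e g -> hform (d + e) (fun x => f x * g x).
Proof.
move=> [p hp pf] [q hq qg]; exists (p * q) => [|x]; first exact: dhomogM.
by rewrite /peval mevalM [p.@[_]]pf [q.@[_]]qg.
Qed.

Lemma hformZ n d c (f : 'rV[K]_n -> K) :
  hform d f -> hform d (fun x => c * f x).
Proof. by move=> hf; apply: (hformM (hform_const _ c) hf). Qed.

Lemma hformN n d (f : 'rV[K]_n -> K) : hform d f -> hform d (fun x => - f x).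
Proof.
by move=> /(hformZ (-1)) [p hp pf]; exists p => // x; rewrite pf mulN1r.
Qed.

Lemma hformB n d (f g : 'rV[K]_n -> K) :
  hform d f -> hform d g -> hform d (fun x => f x - g x).
Proof. by move=> hf /hformN hg; apply: hformD. Qed.

Lemma hform_sum n d (I : Type) (r : seq I) (F : I -> 'rV[K]_n -> K) :
  (forall i, hform d (F i)) -> hform d (fun x => \sum_(i <- r) F i x).
Proof.
move=> hF; elim: r => [|i r [p hp pf]].
  by have [p hp pf] := hform0 n d; exists p => // x; rewrite pf big_nil.
have [q hq qf] := hformD (hF i) (ex_intro2 _ _ p hp pf).
by exists q => // x; rewrite qf big_cons.
Qed.

Lemma hformX n d e (f : 'rV[K]_n -> K) :
  hform d f -> hform (d * e) (fun x => f x ^+ e).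
Proof.
move=> [p hp pf]; exists (p ^+ e) => [|x]; first exact: dhomogMn.
by rewrite /peval rmorphXn [X in X ^+ _]pf.
Qed.

Lemma hform_scale n d (f : 'rV[K]_n -> K) c x :
  hform d f -> f (c *: x) = c ^+ d * f x.
Proof.
move=> [p hp pf]; rewrite -!pf /peval !mevalE mulr_sumr.
apply: eq_big_seq => m /(dhomog_mf hp) /= <-.
under eq_bigr do rewrite mxE exprMn.
by rewrite big_split /= prodrXr -mdegE mulrCA.
Qed.

Lemma hform_comp n m d e (p : {mpoly K[m]}) (F : 'rV[K]_n -> 'rV[K]_m) :
  p \is d.-homog -> hvec e F -> hform (e * d) (fun x => peval p (F x)).
Proof.
move=> hp hF.
have hX (mm : 'X_{1..m}) : hform (e * mdeg mm) (fun x => \prod_i F x 0 i ^+ mm i).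
  rewrite mdegE; elim: (index_enum _) => [|i r [q hq qf]].
    have [q hq qf] := hform_const n 1.
    by exists q => [|x]; rewrite ?qf big_nil ?muln0.
  have [q' hq' qf'] := hformM (hformX (mm i) (hF i)) (ex_intro2 _ _ q hq qf).
  by exists q' => [|x]; rewrite ?qf' big_cons ?mulnDr.
have : forall r : seq 'X_{1..m}, {subset r <= msupp p} ->
    hform (e * d) (fun x => \sum_(mm <- r) p@_mm * \prod_i F x 0 i ^+ mm i).
  elim=> [|mm r IH] rp.
    by have [q hq qf] := hform0 n (e * d); exists q => // x; rewrite qf big_nil.
  have [|q hq qf] := IH; first by move=> k kr; apply: rp; rewrite inE kr orbT.
  have := hX mm; rewrite (dhomog_mf hp (rp mm _)) ?inE ?eqxx // => h.
  have [q' hq' qf'] := hformD (hformZ p@_mm h) (ex_intro2 _ _ q hq qf).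
  by exists q' => // x; rewrite qf' big_cons.
move=> /(_ (msupp p) (fun _ h => h)) [q hq qf].
by exists q => // x; rewrite qf -mevalE.
Qed.

Lemma hform_compf n m d e (f : 'rV[K]_m -> K) (F : 'rV[K]_n -> 'rV[K]_m) :
  hform d f -> hvec e F -> hform (e * d) (fun x => f (F x)).
Proof.
move=> [p hp pf] hF; have [q hq qf] := hform_comp hp hF.
by exists q => // x; rewrite qf pf.
Qed.

Lemma hvec_comp n m l d e (G : 'rV[K]_m -> 'rV[K]_l) (F : 'rV[K]_n -> 'rV[K]_m) :
  hvec d G -> hvec e F -> hvec (e * d) (fun x => G (F x)).
Proof. by move=> hG hF i; apply: (hform_compf (hG i) hF). Qed.

Lemma hvec_scale n m d (F : 'rV[K]_n -> 'rV[K]_m) c x :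
  hvec d F -> F (c *: x) = c ^+ d *: F x.
Proof. by move=> hF; apply/rowP => i; rewrite mxE (hform_scale c x (hF i)). Qed.

Lemma hform_ext n d (f g : 'rV[K]_n -> K) : f =1 g -> hform d f -> hform d g.
Proof. by move=> fg [p hp pf]; exists p => // x; rewrite pf fg. Qed.

Lemma hvec_id n : hvec 1 (@id 'rV[K]_n).
Proof. by move=> i; apply: hform_coord. Qed.

Lemma hvec_const n m (c : 'rV[K]_m) : hvec 0 (fun _ : 'rV[K]_n => c).
Proof. by move=> i; apply: hform_const. Qed.

Lemma hvecD n m d (F G : 'rV[K]_n -> 'rV[K]_m) :
  hvec d F -> hvec d G -> hvec d (fun x => F x + G x).
Proof.
by move=> hF hG i; apply: hform_ext (hformD (hF i) (hG i)) => x; rewrite mxE.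
Qed.

Lemma hvecZ n m d e (f : 'rV[K]_n -> K) (F : 'rV[K]_n -> 'rV[K]_m) :
  hform d f -> hvec e F -> hvec (d + e) (fun x => f x *: F x).
Proof.
by move=> hf hF i; apply: hform_ext (hformM hf (hF i)) => x; rewrite mxE.
Qed.

Lemma hvecB n m d (F G : 'rV[K]_n -> 'rV[K]_m) :
  hvec d F -> hvec d G -> hvec d (fun x => F x - G x).
Proof.
by move=> hF hG i; apply: hform_ext (hformB (hF i) (hG i)) => x; rewrite !mxE.
Qed.

Lemma hvecZr n m d (f : 'rV[K]_n -> K) (c : 'rV[K]_m) :
  hform d f -> hvec d (fun x => f x *: c).
Proof. by move=> hf; have := hvecZ hf (hvec_const n c); rewrite addn0. Qed.

Lemma hvec_mulmx n m l d (F : 'rV[K]_n -> 'rV[K]_m) (A : 'M[K]_(m, l)) :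
  hvec d F -> hvec d (fun x => F x *m A).
Proof.
move=> hF i.
apply: (@hform_ext _ _ (fun x => \sum_j A j i * F x 0 j)); last first.
  by apply: hform_sum => j; apply: hformZ.
by move=> x; rewrite mxE; apply: eq_bigr => j _; rewrite mulrC.
Qed.

Lemma hvec_row_mx n m l d (F : 'rV[K]_n -> 'rV[K]_m) (G : 'rV[K]_n -> 'rV[K]_l) :
  hvec d F -> hvec d G -> hvec d (fun x => row_mx (F x) (G x)).
Proof.
move=> hF hG i; case: (splitP i) => j ij.
  apply: hform_ext (hF j) => x; rewrite (_ : i = lshift l j) ?row_mxEl //.
  exact/val_inj.
apply: hform_ext (hG j) => x; rewrite (_ : i = rshift m j) ?row_mxEr //.
exact/val_inj.
Qed.

Lemma hvec_wedge n d e (F G : 'rV[K]_n -> 'rV[K]_5) :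
  hvec d F -> hvec e G -> hvec (d + e) (fun x => wedge (F x) (G x)).
Proof.
move=> hF hG k; set ij := nth (0, 0)%N plucker_pairs k.
apply: hform_ext (hformB (hformM (hF (inord ij.1)) (hG (inord ij.2)))
  (hformM (hF (inord ij.2)) (hG (inord ij.1)))) => x.
by rewrite mxE.
Qed.

End HomogeneousFunctions.

(** * The exterior square of a five-dimensional space *)

Section WedgeAlgebra.
Variable K : fieldType.
Implicit Types a b c : 'rV[K]_5.

Definition pl (k : 'I_10) : 'I_5 * 'I_5 :=
  let ij := nth (0, 0)%N plucker_pairs k in (inord ij.1, inord ij.2).

Lemma wedge_coord a b k :
  wedge a b 0 k = a 0 (pl k).1 * b 0 (pl k).2 - a 0 (pl k).2 * b 0 (pl k).1.
Proof. by rewrite mxE. Qed.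

Lemma wedgeDl a b c : wedge (a + b) c = wedge a c + wedge b c.
Proof. by apply/rowP => k; rewrite [RHS]mxE !wedge_coord !mxE; ring. Qed.

Lemma wedgeZl x a b : wedge (x *: a) b = x *: wedge a b.
Proof. by apply/rowP => k; rewrite [RHS]mxE !wedge_coord !mxE; ring. Qed.

Lemma wedgeN a b : wedge b a = - wedge a b.
Proof. by apply/rowP => k; rewrite [RHS]mxE !wedge_coord; ring. Qed.

Lemma wedgeaa a : wedge a a = 0.
Proof. by apply/rowP => k; rewrite [RHS]mxE !wedge_coord; ring. Qed.

Lemma wedgeDr a b c : wedge a (b + c) = wedge a b + wedge a c.
Proof. by rewrite wedgeN wedgeDl opprD -!wedgeN. Qed.

Lemma wedgeZr x a b : wedge a (x *: b) = x *: wedge a b.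
Proof. by rewrite wedgeN wedgeZl -scalerN -wedgeN. Qed.

Lemma wedge0l a : wedge 0 a = 0.
Proof. by rewrite -(scale0r 0) wedgeZl scale0r. Qed.

Lemma wedge0r a : wedge a 0 = 0.
Proof. by rewrite wedgeN wedge0l oppr0. Qed.

Lemma wedge_comb x y z t a b :
  wedge (x *: a + y *: b) (z *: b + t *: a) = (x * z - y * t) *: wedge a b.
Proof. by apply/rowP => k; rewrite [RHS]mxE !wedge_coord !mxE; ring. Qed.

Lemma wedge_suml (I : Type) (r : seq I) (F : I -> 'rV[K]_5) a :
  wedge (\sum_(i <- r) F i) a = \sum_(i <- r) wedge (F i) a.
Proof.
elim: r => [|i r IH]; first by rewrite !big_nil wedge0l.
by rewrite !big_cons wedgeDl IH.
Qed.

Lemma wedge_sumr (I : Type) (r : seq I) (F : I -> 'rV[K]_5) a :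
  wedge a (\sum_(i <- r) F i) = \sum_(i <- r) wedge a (F i).
Proof.
elim: r => [|i r IH]; first by rewrite !big_nil wedge0r.
by rewrite !big_cons wedgeDr IH.
Qed.

Lemma sum3E (V : nmodType) (F : 'I_3 -> V) :
  \sum_i F i = F (inord 0) + F (inord 1) + F (inord 2).
Proof.
rewrite !big_ord_recl big_ord0 addr0 addrA.
by congr (F _ + F _ + F _); apply/val_inj; rewrite /= inordK.
Qed.

Lemma sum5E (V : nmodType) (F : 'I_5 -> V) : \sum_i F i =
  F (inord 0) + F (inord 1) + F (inord 2) + F (inord 3) + F (inord 4).
Proof.
rewrite !big_ord_recl big_ord0 addr0 !addrA.
by congr (F _ + F _ + F _ + F _ + F _); apply/val_inj; rewrite /= inordK.
Qed.

Lemma sum10E (F : 'I_10 -> K) : \sum_i F i =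
  F (inord 0) + F (inord 1) + F (inord 2) + F (inord 3) + F (inord 4) +
  F (inord 5) + F (inord 6) + F (inord 7) + F (inord 8) + F (inord 9).
Proof.
rewrite !big_ord_recl big_ord0 addr0 !addrA.
by congr (F _ + F _ + F _ + F _ + F _ + F _ + F _ + F _ + F _ + F _);
  apply/val_inj; rewrite /= inordK.
Qed.

Lemma plE (k : nat) (k10 : (k < 10)%N) : pl (inord k) =
  (inord (nth (0, 0)%N plucker_pairs k).1, inord (nth (0, 0)%N plucker_pairs k).2).
Proof. by rewrite /pl inordK. Qed.

(** The terms at (i, j) and (j, i) combine into a Pluecker coordinate. This is how an alternating
    bilinear expression in two vectors becomes a linear one in their wedge. *)
Lemma alternating_sum (g : 'I_5 -> 'I_5 -> K) a b :
  (forall i, g i i = 0) -> (forall i j, g j i = - g i j) ->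
  \sum_i \sum_j a 0 i * b 0 j * g i j =
  \sum_k wedge a b 0 k * g (pl k).1 (pl k).2.
Proof.
move=> g0 gN; rewrite sum10E !wedge_coord !plE //= sum5E !sum5E !g0.
rewrite (gN (inord 0) (inord 1)) (gN (inord 0) (inord 2)) (gN (inord 0) (inord 3)).
rewrite (gN (inord 0) (inord 4)) (gN (inord 1) (inord 2)) (gN (inord 1) (inord 3)).
rewrite (gN (inord 1) (inord 4)) (gN (inord 2) (inord 3)) (gN (inord 2) (inord 4)).
rewrite (gN (inord 3) (inord 4)).
ring.
Qed.

(** Cauchy-Binet for 2 by 2 minors. Wedges of functionals thereby give the Pluecker coordinates with
    respect to any basis. *)
Lemma wedge_pairing (f g : 'cV[K]_5) a b :
  wedge a b *m (wedge f^T g^T)^T =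
  (a *m f) *m (b *m g) - (a *m g) *m (b *m f).
Proof.
apply/matrixP => i j; rewrite (ord1 i) (ord1 j) mxE.
transitivity (\sum_i \sum_j a 0 i * b 0 j * (f i 0 * g j 0 - g i 0 * f j 0)).
  rewrite alternating_sum => [|k|k l]; try ring.
  by apply: eq_bigr => k _; rewrite [_^T k _]mxE !wedge_coord !mxE; ring.
rewrite !mxE !big_ord1 !mxE !mulr_suml -sumrB; apply: eq_bigr => k _.
rewrite !mulr_sumr -sumrB; apply: eq_bigr => l _; ring.
Qed.

End WedgeAlgebra.

(** * Existence of isotropic flags *)

Section IsotropicFlags.
Variable K : numFieldType.

Definition qform n (S : 'M[K]_n) (x : 'rV[K]_n) : K := (x *m S *m x^T) 0 0.
Definition lform n (w : 'cV[K]_n) (x : 'rV[K]_n) : K := (x *m w) 0 0.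

(* With [delta = 1], [eps = 0], [om = 0] this forces [theta = 0] on [ker xi] and
   the quadratic form to vanish on [v /\ ker xi]; with [delta = 0], [eps = 1] the
   form is a square there. *)
Definition isotropic_flag (S : 'M[K]_10) (om : 'cV[K]_10) (delta eps : K)
    (v : 'rV[K]_5) (xi theta : 'cV[K]_5) : Prop :=
  [/\ v != 0, xi != 0, v *m xi = 0 & forall w : 'rV[K]_5, w *m xi = 0 ->
      qform S (wedge v w) = eps * lform theta w ^+ 2 /\
      lform om (wedge v w) + delta * lform theta w = 0].

Definition bform n (S : 'M[K]_n) (x y : 'rV[K]_n) : K := (x *m S *m y^T) 0 0.

Lemma bformDl n (S : 'M[K]_n) x y z : bform S (x + y) z = bform S x z + bform S y z.
Proof. by rewrite /bform !mulmxDl mxE. Qed.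

Lemma bformDr n (S : 'M[K]_n) x y z : bform S z (x + y) = bform S z x + bform S z y.
Proof. by rewrite /bform linearD mulmxDr mxE. Qed.

Lemma bformZl n (S : 'M[K]_n) c x y : bform S (c *: x) y = c * bform S x y.
Proof. by rewrite /bform -!scalemxAl mxE. Qed.

Lemma bformZr n (S : 'M[K]_n) c x y : bform S x (c *: y) = c * bform S x y.
Proof. by rewrite /bform linearZ -scalemxAr mxE. Qed.

Lemma qformD n (S : 'M[K]_n) x y :
  qform S (x + y) = qform S x + (bform S x y + bform S y x) + qform S y.
Proof. by rewrite -![qform _ _]/(bform S _ _) bformDl !bformDr; ring. Qed.

Lemma qform_comb n (S : 'M[K]_n) a b x y : qform S (a *: x + b *: y) =
  a ^+ 2 * qform S x + a * b * (bform S x y + bform S y x) + b ^+ 2 * qform S y.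
Proof.
rewrite -![qform _ _]/(bform S _ _) bformDl !bformDr !bformZl !bformZr.
move: (bform S x x) (bform S x y) (bform S y x) (bform S y y) => p q r s; ring.
Qed.

Lemma lformD n (w : 'cV[K]_n) x y : lform w (x + y) = lform w x + lform w y.
Proof. by rewrite /lform mulmxDl mxE. Qed.

Lemma lformZ n (w : 'cV[K]_n) c x : lform w (c *: x) = c * lform w x.
Proof. by rewrite /lform -scalemxAl mxE. Qed.

Lemma lformDr n (w w' : 'cV[K]_n) x : lform (w + w') x = lform w x + lform w' x.
Proof. by rewrite /lform mulmxDr mxE. Qed.

Lemma lformZr n (w : 'cV[K]_n) c x : lform (c *: w) x = c * lform w x.
Proof. by rewrite /lform -scalemxAr mxE. Qed.

Lemma lformNr n (w : 'cV[K]_n) x : lform (- w) x = - lform w x.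
Proof. by rewrite /lform mulmxN mxE. Qed.

Lemma lformMr n m (A : 'M[K]_(n, m)) w x : lform (A *m w) x = lform w (x *m A).
Proof. by rewrite /lform mulmxA. Qed.

Lemma lformE n (w : 'cV[K]_n) x : x *m w = (lform w x)%:M.
Proof. by apply/matrixP => i j; rewrite !ord1 /lform !mxE. Qed.

Lemma qform_congr n m (W : 'M[K]_(m, n)) S x :
  qform S (x *m W) = qform (W *m S *m W^T) x.
Proof. by rewrite /qform trmx_mul !mulmxA. Qed.

Lemma qform_addm n (A B : 'M[K]_n) x : qform (A + B) x = qform A x + qform B x.
Proof. by rewrite /qform mulmxDr mulmxDl mxE. Qed.

Lemma qform_scalem n c (A : 'M[K]_n) x : qform (c *: A) x = c * qform A x.
Proof. by rewrite /qform -scalemxAr -scalemxAl mxE. Qed.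

Lemma rank_one_form n (tau x : 'rV[K]_n) :
  qform (tau^T *m tau) x = lform tau^T x ^+ 2.
Proof.
rewrite /qform mulmxA -mulmxA -[tau *m x^T]trmxK trmx_mul trmxK (lformE tau^T).
by rewrite tr_scalar_mx -scalar_mxM mxE expr2 mulr1n.
Qed.

Lemma quadratic_alternating n (M : 'M[K]_n) :
  (forall x, qform M x = 0) -> M + M^T = 0.
Proof.
move=> H; have bil i j : M i j = bform M (delta_mx 0 i) (delta_mx 0 j).
  by rewrite /bform -rowE trmx_delta -colE !mxE.
apply/matrixP => i j; have := H (delta_mx 0 i + delta_mx 0 j).
by rewrite qformD !H add0r addr0 -!bil !mxE.
Qed.

Definition basis_vec (i : 'I_5) : 'rV[K]_5 := delta_mx 0 i.

(** The Lie algebra action of [A] on the exterior square. It is linear in [A], so restricting a form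
    to V1 /\ V4, the image for the matrix of a flag, becomes a pullback with coefficients
    homogeneous in [A]. *)
Definition derivation (A : 'M[K]_5) (a b : 'rV[K]_5) : 'rV[K]_10 :=
  wedge (a *m A) b + wedge a (b *m A).

Definition derivation_mx (A : 'M[K]_5) : 'M[K]_10 :=
  \matrix_k derivation A (basis_vec (pl k).1) (basis_vec (pl k).2).

Lemma row_basis (a : 'rV[K]_5) : a = \sum_i a 0 i *: basis_vec i.
Proof. exact: row_sum_delta. Qed.

Lemma derivationN A a b : derivation A b a = - derivation A a b.
Proof. by rewrite /derivation wedgeN [X in _ + X]wedgeN -opprD addrC. Qed.

Lemma derivation_suml A (I : Type) (r : seq I) (x : I -> K) (F : I -> 'rV[K]_5) b :
  derivation A (\sum_(i <- r) x i *: F i) b =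
  \sum_(i <- r) x i *: derivation A (F i) b.
Proof.
rewrite /derivation mulmx_suml !wedge_suml -big_split; apply: eq_bigr => i _ /=.
by rewrite -scalemxAl !wedgeZl scalerDr.
Qed.

Lemma derivation_sumr A (I : Type) (r : seq I) (x : I -> K) (F : I -> 'rV[K]_5) b :
  derivation A b (\sum_(i <- r) x i *: F i) =
  \sum_(i <- r) x i *: derivation A b (F i).
Proof.
rewrite derivationN derivation_suml -sumrN; apply: eq_bigr => i _.
by rewrite derivationN scalerN opprK.
Qed.

Lemma derivationE A a b : wedge a b *m derivation_mx A = derivation A a b.
Proof.
apply/rowP => l; rewrite mxE.
transitivity (\sum_k wedge a b 0 k *
    derivation A (basis_vec (pl k).1) (basis_vec (pl k).2) 0 l).
  by apply: eq_bigr => k _; rewrite [derivation_mx _ _ _]mxE.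
rewrite -(@alternating_sum _ (fun i j => derivation A (basis_vec i) (basis_vec j) 0 l)).
- rewrite {2}(row_basis a) derivation_suml summxE; apply: eq_bigr => i _.
  rewrite {2}(row_basis b) derivation_sumr [RHS]mxE summxE mulr_sumr.
  by apply: eq_bigr => j _; rewrite [in RHS]mxE mulrA.
- by move=> i; rewrite /derivation wedgeN addNr mxE.
- by move=> i j; rewrite derivationN mxE.
Qed.

(** The second factor on the right is killed by [xi], so for nonzero [xi] the image is exactly [v]
    wedged with the kernel of [xi]. *)
Lemma rank_one_derivation (v : 'rV[K]_5) (xi : 'cV[K]_5) a b :
  derivation (xi *m v) a b = wedge v (lform xi a *: b - lform xi b *: a).
Proof.
rewrite /derivation !mulmxA !lformE !mul_scalar_mx !wedgeZl !wedgeZr.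
by rewrite wedgeDr wedgeZr -scaleNr wedgeZr scaleNr [wedge v a]wedgeN scalerN opprK.
Qed.

(* The unknown is [y = (A, tau)]: the nilpotent rank one matrix [A = xi *m v]
   encodes the flag, and [tau] is [theta] read through [wedge xi theta]. *)
Definition unknown_mx (y : 'rV[K]_(5 * 5 + 10)) : 'M[K]_5 := vec_mx (lsubmx y).
Definition unknown_form (y : 'rV[K]_(5 * 5 + 10)) : 'rV[K]_10 := rsubmx y.

Definition flag_coef := ('M[K]_10 * 'cV[K]_10 * K * K)%type.
Implicit Type c : flag_coef.

Definition flag_eqn : finType :=
  ('I_5 * 'I_5 * ('I_5 * 'I_5) + unit + ('I_10 + 'I_10 * 'I_10))%type.

Definition flag_eqn_deg (j : flag_eqn) : nat :=
  match j with
  | inl (inl _) => 2 | inl (inr _) => 1 | inr (inl _) => 1 | inr (inr _) => 2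
  end.

(** The minors and the trace say that [A] has rank at most one and is nilpotent. The matrix [Q] is
    not assumed symmetric, so equality of quadratic forms is stated after symmetrisation, whence the
    factor 2. All equations are homogeneous in ([A], [tau]) jointly. *)
Definition flag_system (c : flag_coef) (y : 'rV[K]_(5 * 5 + 10)) : Prop :=
  let: (Q, om, delta, eps) := c in
  let A := unknown_mx y in let T := derivation_mx A in let tau := unknown_form y in
  [/\ forall i j k l, A i j * A k l = A i l * A k j,
      \tr A = 0,
      T *m om + delta *: tau^T = 0 &
      T *m Q *m T^T + (T *m Q *m T^T)^T = (2 * eps) *: (tau^T *m tau)].

(** The condition on [delta] and [eps] excludes degenerate solutions: for A = 0 the last two
    equations reduce to [delta] times [tau] and [eps] times its square being zero, which forces y =
    0. *)
Lemma flag_system_sound S om delta eps y :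
  delta != 0 \/ eps != 0 -> y != 0 -> flag_system (S, om, delta, eps) y ->
  exists v xi theta, isotropic_flag S om delta eps v xi theta.
Proof.
move=> de y0 [Hminor Htr Hlin Hq].
set A := unknown_mx y in Hminor Htr Hlin Hq.
set tau := unknown_form y in Hlin Hq.
have Qeq x : qform S (x *m derivation_mx A) = eps * lform tau^T x ^+ 2.
  have two : (2 : K) != 0 by rewrite pnatr_eq0.
  apply: (mulfI two).
  have /(congr1 (fun M => (x *m M *m x^T) 0 0)) := Hq.
  rewrite mulmxDr mulmxDl [LHS]mxE.
  have -> : (x *m (derivation_mx A *m S *m (derivation_mx A)^T)^T *m x^T) =
      (x *m (derivation_mx A *m S *m (derivation_mx A)^T) *m x^T)^T.
    by rewrite !trmx_mul !trmxK !mulmxA.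
  rewrite [X in _ + X]mxE -mulr2n => h.
  rewrite mulr_natl qform_congr /qform h.
  by rewrite -scalemxAr -scalemxAl mxE -mulrA -rank_one_form.
have Leq x : lform om (x *m derivation_mx A) + delta * lform tau^T x = 0.
  have /(congr1 (fun M => (x *m M) 0 0)) := Hlin.
  by rewrite mulmxDr -scalemxAr mulmx0 mulmxA [LHS]mxE [X in _ + X]mxE [RHS]mxE.
have [A0|] := eqVneq A 0.
  have T0 : derivation_mx A = 0.
    apply/row_matrixP => k; rewrite rowK /derivation A0 !mulmx0 wedge0l wedge0r.
    by rewrite addr0 row0.
  have tau0 : tau = 0.
    apply/rowP => k; have tk : lform tau^T (delta_mx 0 k) = tau 0 k.
      by rewrite /lform -rowE !mxE.
    rewrite [RHS]mxE -tk; case: de => [d0|e0].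
      have := Leq (delta_mx 0 k); rewrite T0 mulmx0 {1}/lform mul0mx mxE add0r.
      by move/eqP; rewrite mulf_eq0 (negbTE d0) => /eqP.
    have := Qeq (delta_mx 0 k); rewrite T0 mulmx0 /qform !mul0mx [X in X = _]mxE => /esym/eqP.
    by rewrite mulf_eq0 (negbTE e0) expf_eq0 => /eqP.
  case/eqP: y0; rewrite -(hsubmxK y) [rsubmx y]tau0.
  by rewrite -(vec_mxK (lsubmx y)) [vec_mx _]A0 linear0 row_mx0.
move=> A0; have [i0 [j0 Aij]] : exists i j, A i j != 0.
  apply: contrapT => h; case/eqP: A0; apply/matrixP => i j; rewrite [RHS]mxE.
  by apply/eqP/negPn/negP => Aij; apply: h; exists i, j.
pose v := row i0 A; pose xi := (A i0 j0)^-1 *: col j0 A.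
have AE : A = xi *m v.
  apply/matrixP => i j; rewrite [RHS]mxE big_ord1 [xi _ _]mxE [col _ _ _ _]mxE [v _ _]mxE.
  rewrite -mulrA -(Hminor i j i0 j0).
  by rewrite mulrC -mulrA [_ * _^-1]mulrC mulVf // mulr1.
(* Since [xi] takes the value 1 at the basis vector [i0], the derivation maps its wedge with any w
   in the kernel of [xi] to [wedge v w]; hence [tau] is read off along this vector. *)
pose theta : 'cV[K]_5 := \col_j lform tau^T (wedge (basis_vec i0) (basis_vec j)).
have thE w : lform theta w = lform tau^T (wedge (basis_vec i0) w).
  rewrite {2}(row_basis w) wedge_sumr /lform mulmx_suml summxE mxE.
  by apply: eq_bigr => j _; rewrite [theta _ _]mxE wedgeZr -scalemxAl [RHS]mxE.
have xi0 : lform xi (basis_vec i0) = 1.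
  by rewrite /lform -rowE [row _ _ _ _]mxE [xi _ _]mxE [col _ _ _ _]mxE mulVf.
exists v, xi, theta; split.
- by apply: contraNneq Aij => /rowP/(_ j0); rewrite !mxE => ->.
- by apply: contra_neq (oner_neq0 K) => xi00; rewrite -xi0 xi00 /lform mulmx0 mxE.
- by apply/matrixP => i j; rewrite !ord1 [RHS]mxE -Htr AE mxtrace_mulC /mxtrace big_ord1.
move=> w wxi.
have wE : wedge v w = wedge (basis_vec i0) w *m derivation_mx A.
  rewrite derivationE AE rank_one_derivation xi0 scale1r.
  by rewrite [lform xi w](_ : _ = 0) ?scale0r ?subr0 // /lform wxi mxE.
by rewrite wE thE; split.
Qed.

Lemma flag_system_complete S om delta eps v xi theta :
  isotropic_flag S om delta eps v xi theta ->
  exists2 y, y != 0 & flag_system (S, om, delta, eps) y.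
Proof.
case=> v0 xi0 vxi H.
pose tau := wedge xi^T theta^T.
exists (row_mx (mxvec (xi *m v)) tau).
  apply: contra_neq v0 => /eqP; rewrite row_mx_eq0 => /andP[/eqP h _].
  have xv : xi *m v = 0 by rewrite -[_ *m _]mxvecK h linear0.
  have [i xii] : exists i, xi i 0 != 0.
    apply: contrapT => hi; case/eqP: xi0; apply/colP => i; rewrite mxE.
    by apply/eqP/negPn/negP => xii; apply: hi; exists i.
  apply/rowP => j; move/matrixP/(_ i j): xv; rewrite !mxE big_ord1 => /eqP.
  by rewrite mulf_eq0 (negbTE xii) => /eqP.
rewrite /flag_system /unknown_mx /unknown_form row_mxKl row_mxKr mxvecK.
set T := derivation_mx _.
(* The contraction of [x] with [xi]. It lands in the kernel of [xi], so evaluating the flag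
   conditions at [W x] gives the equations for all [x]. *)
pose W (x : 'rV[K]_10) := \sum_k x 0 k *:
  (lform xi (basis_vec (pl k).1) *: basis_vec (pl k).2 -
   lform xi (basis_vec (pl k).2) *: basis_vec (pl k).1).
have TW x : x *m T = wedge v (W x).
  rewrite mulmx_sum_row wedge_sumr; apply: eq_bigr => k _.
  by rewrite rowK rank_one_derivation wedgeZr.
have tauW x : lform tau^T x = lform theta (W x).
  rewrite /lform /W mulmx_suml summxE mxE; apply: eq_bigr => k _.
  rewrite -scalemxAl [RHS]mxE; congr (_ * _).
  rewrite [LHS]mxE wedge_coord mulmxBl -!scalemxAl /basis_vec.
  by rewrite /lform -!rowE !mxE; ring.
have WK x : W x *m xi = 0.
  rewrite /W mulmx_suml big1 // => k _; rewrite -scalemxAl mulmxBl -!scalemxAl !lformE.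
  by rewrite !scale_scalar_mx mulrC subrr scaler0.
split.
- by move=> i j k l; rewrite !mxE !big_ord1; ring.
- by rewrite mxtrace_mulC vxi mxtrace0.
- apply/row_matrixP => k; rewrite row0 rowE; apply/matrixP => i j; rewrite !ord1.
  have [_ h] := H _ (WK (delta_mx 0 k)); rewrite -TW -tauW in h.
  by rewrite mulmxDr -scalemxAr mulmxA [RHS]mxE -h [LHS]mxE [X in _ + X]mxE.
pose M := T *m S *m T^T - eps *: (tau^T *m tau).
have /quadratic_alternating : forall x, qform M x = 0.
  move=> x; have [h _] := H _ (WK x); rewrite -TW -tauW in h.
  rewrite /qform /M mulmxBr mulmxBl mxE [X in _ + X]mxE.
  have -> : (x *m (T *m S *m T^T) *m x^T) 0 0 = qform S (x *m T).
    by rewrite /qform trmx_mul !mulmxA.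
  rewrite h.
  apply/eqP; rewrite subr_eq0; apply/eqP.
  by rewrite -scalemxAr -scalemxAl mxE -rank_one_form.
have sym : (eps *: (tau^T *m tau))^T = eps *: (tau^T *m tau).
  by rewrite linearZ /= trmx_mul trmxK.
rewrite /M linearB /= addrACA -opprD sym.
by move/eqP; rewrite subr_eq0 => /eqP ->; rewrite -scalerDl mulr_natl mulr2n.
Qed.

End IsotropicFlags.

(** * The flag equations as polynomials *)

Section FlagPolynomials.
Variable R : realType.
Local Notation K := R[i].
Local Notation MP := {mpoly K[5 * 5 + 10]}.

Lemma hvec_derivation_mx k :
  hvec 1 (fun y : 'rV[K]_(5 * 5 + 10) => row k (derivation_mx (unknown_mx y))).
Proof.
have hA i : hvec 1 (fun y : 'rV[K]_(5 * 5 + 10) => basis_vec K i *m unknown_mx y).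
  move=> j; apply: hform_ext (hform_coord _ (lshift 10 (mxvec_index i j))) => y.
  by rewrite /basis_vec -rowE !mxE.
move=> a; apply: (@hform_ext _ _ _ (fun y => derivation (unknown_mx y)
    (basis_vec K (pl k).1) (basis_vec K (pl k).2) 0 a)).
  by move=> y; rewrite rowK.
apply: (@hvecD _ _ _ 1).
  by apply: (@hvec_wedge _ _ 1 0) => //; apply: hvec_const.
by apply: (@hvec_wedge _ _ 0 1) => //; apply: hvec_const.
Qed.

(** Fixed multiples are included because the eliminant is built from coefficients of multiples of
    the equations. *)
Definition coef_class (T : Type) (P : (T -> K) -> Prop) (F : T -> MP) : Prop :=
  forall a m, P (fun t => (a * F t)@_m).

Section CoefClass.
Variables (T : Type) (P : (T -> K) -> Prop).
Hypothesis hP : fun_subring P.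

Lemma coef_class_const p : coef_class P (fun=> p).
Proof. by move=> a m; apply: fsub_const. Qed.

Lemma coef_classD F G :
  coef_class P F -> coef_class P G -> coef_class P (fun t => F t + G t).
Proof.
move=> hF hG a m; rewrite [X in P X](_ : _ = fun t => (a * F t)@_m + (a * G t)@_m).
  exact: fsubD.
by apply/funext => t; rewrite mulrDr mcoeffD.
Qed.

Lemma coef_class_scale (c : T -> K) p : P c -> coef_class P (fun t => c t *: p).
Proof.
move=> hc a m; rewrite [X in P X](_ : _ = fun t => c t * (a * p)@_m).
  by apply: fsubM => //; apply: fsub_const.
by apply/funext => t; rewrite -scalerAr mcoeffZ.
Qed.

Lemma coef_class_sum (I : finType) (F : I -> T -> MP) :
  (forall i, coef_class P (F i)) -> coef_class P (fun t => \sum_i F i t).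
Proof.
move=> hF a m; rewrite [X in P X](_ : _ = fun t => \sum_i (a * F i t)@_m).
  by apply: fsub_sum => // i; apply: hF.
by apply/funext => t; rewrite mulr_sumr raddf_sum.
Qed.

End CoefClass.

Lemma flag_polynomials : exists F : flag_eqn -> flag_coef K -> MP,
  [/\ forall j c, F j c \is (flag_eqn_deg j).-homog,
      forall c y, (forall j, peval (F j c) y = 0) <-> flag_system c y &
      forall (T : Type) (P : (T -> K) -> Prop) (Q : T -> 'M_10) (om : T -> 'cV_10)
        (delta eps : T -> K), fun_subring P ->
        (forall a b, P (fun t => Q t a b)) -> (forall a, P (fun t => om t a 0)) ->
        P delta -> P eps ->
        forall j, coef_class P (fun t => F j (Q t, om t, delta t, eps t))].
Proof.
have /choice[t tP] (ka : 'I_10 * 'I_10) : exists p : MP, p \is 1.-homog /\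
    forall y, peval p y = derivation_mx (unknown_mx y) ka.1 ka.2.
  have [p hp pE] := hvec_derivation_mx ka.1 ka.2; exists p; split=> // y.
  by rewrite pE mxE.
have t_homog k a : t (k, a) \is 1.-homog by case: (tP (k, a)).
have tE k a y : peval (t (k, a)) y = derivation_mx (unknown_mx y) k a.
  by case: (tP (k, a)).
pose XA i j : MP := 'X_(lshift 10 (mxvec_index i j)).
pose Xt k : MP := 'X_(rshift (5 * 5) k).
have XA_homog i j : XA i j \is 1.-homog by rewrite dhomogX /= mdeg1.
have Xt_homog k : Xt k \is 1.-homog by rewrite dhomogX /= mdeg1.
have XAE i j y : peval (XA i j) y = unknown_mx y i j.
  by rewrite pevalX /unknown_mx !mxE.
have XtE k y : peval (Xt k) y = unknown_form y 0 k.
  by rewrite pevalX /unknown_form !mxE.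
pose F (j : flag_eqn) (c : flag_coef K) : MP :=
  let: (Q, om, delta, eps) := c in
  match j with
  | inl (inl (ij, kl)) => XA ij.1 ij.2 * XA kl.1 kl.2 - XA ij.1 kl.2 * XA kl.1 ij.2
  | inl (inr _) => \sum_i XA i i
  | inr (inl k) => \sum_a om a 0 *: t (k, a) + delta *: Xt k
  | inr (inr (k, l)) =>
      \sum_a \sum_b Q a b *: (t (k, a) * t (l, b) + t (l, a) * t (k, b)) +
      (- (2 * eps)) *: (Xt k * Xt l)
  end.
exists F; split.
- move=> [[[ij kl]|u]|[k|[k l]]] [[[Q om] delta] eps] /=.
  + by rewrite rpredB //; apply: (@dhomogM _ _ _ 1 _ 1).
  + by apply: rpred_sum => i _.
  + apply: dhomogD; last exact: dhomogZ.
    by apply: rpred_sum => a _; apply: dhomogZ.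
  + apply: dhomogD; last by apply: dhomogZ; apply: (@dhomogM _ _ _ 1 _ 1).
    apply: rpred_sum => a _; apply: rpred_sum => b _; apply: dhomogZ.
    by apply: dhomogD; apply: (@dhomogM _ _ _ 1 _ 1).
- move=> [[[Q om] delta] eps] y.
  have minorE i j k l : peval (F (inl (inl ((i, j), (k, l)))) (Q, om, delta, eps)) y =
      unknown_mx y i j * unknown_mx y k l - unknown_mx y i l * unknown_mx y k j.
    by rewrite /= pevalB !pevalM !XAE.
  have trE u : peval (F (inl (inr u)) (Q, om, delta, eps)) y = \tr (unknown_mx y).
    by rewrite /= peval_sum; apply: eq_bigr => i _; rewrite XAE.
  have linE k : peval (F (inr (inl k)) (Q, om, delta, eps)) y =
      (derivation_mx (unknown_mx y) *m om + delta *: (unknown_form y)^T) k 0.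
    rewrite /= pevalD peval_sum pevalZ XtE [RHS]mxE.
    rewrite [X in _ = X + _]mxE [X in _ = _ + X]mxE [X in _ = _ + _ * X]mxE; congr (_ + _).
    by apply: eq_bigr => a _; rewrite pevalZ tE mulrC.
  have quadE k l : peval (F (inr (inr (k, l))) (Q, om, delta, eps)) y =
      (derivation_mx (unknown_mx y) *m Q *m (derivation_mx (unknown_mx y))^T +
       (derivation_mx (unknown_mx y) *m Q *m (derivation_mx (unknown_mx y))^T)^T -
       (2 * eps) *: ((unknown_form y)^T *m unknown_form y)) k l.
    set D := derivation_mx _; set f := unknown_form y.
    have DE m n : (D *m Q *m D^T) m n = \sum_a \sum_b Q a b * (D m a * D n b).
      rewrite mxE exchange_big; apply: eq_bigr => b _; rewrite [in LHS]mxE mulr_suml.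
      by apply: eq_bigr => a _; rewrite [D^T _ _]mxE; ring.
    rewrite /= pevalD pevalZ pevalM !XtE -/f.
    rewrite [RHS]mxE [X in _ = X + _]mxE [X in _ = _ + X + _]mxE [X in _ = _ + X]mxE.
    rewrite [X in _ = _ - X]mxE [X in _ = _ - _ * X]mxE big_ord1 [f^T _ _]mxE !DE mulNr.
    congr (_ - _).
    rewrite -big_split peval_sum; apply: eq_bigr => a _ /=.
    rewrite peval_sum -big_split /=; apply: eq_bigr => b _.
    by rewrite pevalZ pevalD !pevalM !tE -/D; ring.
  split=> [H|[h1 h2 h3 h4] [[[[i j] [k l]]|u]|[k|[k l]]]].
  + split=> [i j k l| | |].
    * by apply/eqP; rewrite -subr_eq0 -minorE H.
    * by rewrite -(trE tt) H.
    * by apply/matrixP => k i; rewrite ord1 -linE H mxE.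
    * by apply/eqP; rewrite -subr_eq0; apply/eqP/matrixP => k l; rewrite -quadE H mxE.
  + by rewrite minorE h1 subrr.
  + by rewrite trE.
  + by rewrite linE h3 mxE.
  + by rewrite quadE h4 subrr mxE.
move=> T P Q om delta eps hP PQ Pom Pd Pe [[[ij kl]|u]|[k|[k l]]] /=.
- exact: coef_class_const.
- exact: coef_class_const.
- apply: (coef_classD hP); last exact: coef_class_scale.
  by apply: (coef_class_sum hP) => a; apply: coef_class_scale.
apply: (coef_classD hP).
  apply: (coef_class_sum hP) => a; apply: (coef_class_sum hP) => b.
  exact: coef_class_scale.
apply: coef_class_scale => //.
rewrite [X in P X](_ : _ = fun t => (-2) * eps t).
  by apply: fsubM => //; apply: fsub_const.
by apply/funext => s; rewrite mulNr.
Qed.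

End FlagPolynomials.

(** * Functions polynomial in a deformation parameter *)

Section Deformation.
Variable R : realType.
Local Notation K := R[i].

Lemma poly_vanish (p : {poly K}) : (forall s, p.[s] = 0) -> p = 0.
Proof.
move=> H; apply: (@roots_geq_poly_eq0 _ p [seq i%:R | i <- iota 0 (size p)]).
- by apply/allP => s _; apply/rootP.
- by rewrite map_inj_uniq ?iota_uniq // => i j /eqP; rewrite eqr_nat => /eqP.
- by rewrite size_map size_iota.
Qed.

Variable H : lmodType K.

(** Polynomiality on each line is all that the vanishing argument asks for, and it avoids choosing
    coordinates on [H]. *)
Definition line_poly (f : H -> K) : Prop :=
  forall h0 h1, exists p : {poly K}, forall s, f (h0 + s *: h1) = p.[s].

Lemma line_poly_subring : fun_subring line_poly.
Proof.
split=> [c h0 h1|f g hf hg h0 h1|f g hf hg h0 h1].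
- by exists c%:P => s; rewrite hornerC.
- have [[p pE] [q qE]] := (hf h0 h1, hg h0 h1).
  by exists (p + q) => s; rewrite pE qE hornerD.
- have [[p pE] [q qE]] := (hf h0 h1, hg h0 h1).
  by exists (p * q) => s; rewrite pE qE hornerM.
Qed.

(** The uniform bound on the degree in [s] turns the vanishing argument into a finite sum. *)
Definition deform_poly (G : K * H -> K) : Prop :=
  exists (D : nat) (g : H -> {poly K}),
    [/\ forall s h, G (s, h) = (g h).[s], forall h, (size (g h) <= D)%N &
        forall k, line_poly (fun h => (g h)`_k)].

Lemma deform_poly_subring : fun_subring deform_poly.
Proof.
have hL := line_poly_subring.
split=> [c|G1 G2 [D1 [g1 [e1 s1 l1]]] [D2 [g2 [e2 s2 l2]]]|
  G1 G2 [D1 [g1 [e1 s1 l1]]] [D2 [g2 [e2 s2 l2]]]].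
- exists 1%N, (fun=> c%:P); split=> [s h|h|k]; first by rewrite hornerC.
    exact: size_polyC_leq1.
  exact: (fsub_const hL).
- exists (maxn D1 D2), (fun h => g1 h + g2 h); split=> [s h|h|k].
  + by rewrite e1 e2 hornerD.
  + by rewrite (leq_trans (size_polyD _ _)) // geq_max !leq_max s1 s2 orbT.
  + by under eq_fun do rewrite coefD; exact: (fsubD hL (l1 k) (l2 k)).
- exists (D1 + D2)%N, (fun h => g1 h * g2 h); split=> [s h|h|k].
  + by rewrite e1 e2 hornerM.
  + rewrite (leq_trans (size_polyMleq _ _)) //.
    by rewrite (leq_trans (leq_pred _)) // leq_add.
  + under eq_fun do rewrite coefM.
    by refine (fsub_sum _ _ hL _) => i; exact: (fsubM hL (l1 _) (l2 _)).
Qed.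

Lemma deform_poly_fst : deform_poly (fun t => t.1).
Proof.
exists 2%N, (fun=> 'X); split=> [s h|h|k]; rewrite ?hornerX ?size_polyX //.
exact: (fsub_const line_poly_subring).
Qed.

Lemma deform_poly_snd f : line_poly f -> deform_poly (fun t => f t.2).
Proof.
move=> hf; exists 1%N, (fun h => (f h)%:P); split=> [s h|h|k].
- by rewrite hornerC.
- exact: size_polyC_leq1.
under eq_fun do rewrite coefC.
by case: k => [//|k]; apply: (fsub_const line_poly_subring).
Qed.

(* Every [h] is the value at [s = 0] of a line along which [G] vanishes: then
   the coefficients of [G] as a polynomial in [s] vanish one after the other. *)
Lemma deform_poly_eq0 G : deform_poly G ->
  (forall h, exists h1, forall s, G (s, h + s *: h1) = 0) -> forall t, G t = 0.
Proof.
move=> [D [g [gE gD gl]]] H0.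
suff gk k : forall h, (g h)`_k = 0.
  case=> s h; rewrite gE; have -> : g h = 0 by apply/polyP => i; rewrite gk coef0.
  exact: horner0.
elim/ltn_ind: k => k IH h; have [kD|Dk] := ltnP k D; last first.
  by rewrite nth_default // (leq_trans (gD h)).
have [h1 G0] := H0 h.
have /choice[p pE] i : exists p : {poly K}, forall s, (g (h + s *: h1))`_i = p.[s].
  exact: gl.
have p0 i : (i < k)%N -> p i = 0.
  by move=> ik; apply: poly_vanish => s; rewrite -pE IH.
(* This polynomial is [G] along the line. In degree k the terms with i < k vanish by induction and
   those with i > k do not contribute, which leaves the value of [p k] at 0, that is the k-th
   coefficient at [h]. *)
have : \sum_(i < D) p i * 'X^i = 0.
  apply: poly_vanish => s; rewrite horner_sum -[RHS](G0 s) gE.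
  rewrite (horner_coef_wide _ (gD _)); apply: eq_bigr => i _.
  by rewrite hornerM hornerXn pE.
move/(congr1 (coefp k)); rewrite /= coef0 coef_sum (bigD1 (Ordinal kD)) //=.
rewrite big1 => [|i /negP ik].
  by rewrite addr0 coefMXn ltnn subnn -horner_coef0 -pE scale0r addr0.
rewrite coefMXn; case: ltngtP => [//|ik'|e]; last first.
  by case: ik; apply/eqP/val_inj; rewrite /= e.
by rewrite p0 // coef0.
Qed.

End Deformation.

(** * The base form and the existence of flags *)

Section Existence.
Variable R : realType.
Local Notation K := R[i].

Definition vec5 (a b c d e : K) : 'rV[K]_5 := \row_i [:: a; b; c; d; e]`_i.

Lemma vec5E a b c d e k : (k < 5)%N ->
  vec5 a b c d e 0 (inord k) = [:: a; b; c; d; e]`_k.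
Proof. by move=> k5; rewrite mxE inordK. Qed.

(** The coordinates p_01, p_02, p_03. Forms in these three are the directions in which the given
    data are corrected. *)
Definition wedge_e0 : 'M[K]_(10, 3) := \matrix_(k, i) (k == i :> nat)%:R.

(* p_04 p_01 + p_23 p_02 + p_13 p_03 *)
Definition base_quadric : 'M[K]_10 :=
  \matrix_(k, l) ((k : nat, l : nat) \in [:: (3, 0); (7, 1); (5, 2)]%N)%:R.

(** V1 /\ V4 for the hyperplane x4 = l1 x1 + l2 x2 + l3 x3. These hyperplanes contain e0; with the
    three free coordinates of [v] there are six parameters, as many as a ternary quadratic form has
    coefficients. *)
Definition base_flag_span (v : 'rV[K]_5) (l1 l2 l3 : K) : 'M[K]_(3, 10) :=
  \matrix_(i < 3) [:: wedge v (vec5 0 1 0 0 l1); wedge v (vec5 0 0 1 0 l2);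
    wedge v (vec5 0 0 0 1 l3)]`_i.

Lemma base_flag_spanE v l1 l2 l3 (c : 'rV[K]_3) :
  c *m base_flag_span v l1 l2 l3 = wedge v (vec5 0 (c 0 (inord 0)) (c 0 (inord 1))
    (c 0 (inord 2)) (c 0 (inord 0) * l1 + c 0 (inord 1) * l2 + c 0 (inord 2) * l3)).
Proof.
rewrite mulmx_sum_row sum3E !rowK !inordK //= -!wedgeZr -!wedgeDr.
congr wedge; apply/rowP => i; rewrite !mxE.
by case: i => [[|[|[|[|[|i]]]]] hi] //=; ring.
Qed.

Lemma wedge_e0E (x : 'rV[K]_10) (i : nat) : (i < 3)%N ->
  (x *m wedge_e0) 0 (inord i) = x 0 (inord i).
Proof.
move=> i3; rewrite mxE (bigD1 (inord i)) //= big1 => [|k ki].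
  by rewrite mxE !inordK ?eqxx ?mulr1 ?addr0 // (ltn_trans i3).
rewrite mxE inordK //; case: eqP => [e|]; last by rewrite mulr0.
by case/eqP: ki; apply/val_inj; rewrite /= inordK // (ltn_trans i3).
Qed.

Lemma qform_base_quadric x : qform base_quadric x =
  x 0 (inord 3) * x 0 (inord 0) + x 0 (inord 7) * x 0 (inord 1) +
  x 0 (inord 5) * x 0 (inord 2).
Proof.
have S l : (x *m base_quadric) 0 l = if l == 0%N :> nat then x 0 (inord 3)
    else if l == 1%N :> nat then x 0 (inord 7)
    else if l == 2%N :> nat then x 0 (inord 5) else 0.
  rewrite mxE sum10E !mxE !inordK // !inE !xpair_eqE /=.
  by case: l => [[|[|[|l]]] hl] /=; ring.
rewrite /qform mxE sum10E !S !inordK //= ![x^T _ _]mxE; ring.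
Qed.

(* [base_quadric] is chosen to make this a linear system for the flag. *)
Lemma base_flag_exists (Y : 'M[K]_3) : exists b1 b2 b3 l1 l2 l3,
  let v := vec5 1 b1 b2 b3 (b1 * l1 + b2 * l2 + b3 * l3) in
  forall c, qform base_quadric (c *m base_flag_span v l1 l2 l3) + qform Y c = 0.
Proof.
pose y i j := Y (inord i) (inord j).
(* With c = (c1, c2, c3) the base form restricts to l1 c1^2 + l2 c1 c2 + (l3 - b3) c1 c3 - b3 c2^2 +
   b2 c2 c3 + b1 c3^2; the witnesses solve for the negative of [Y]. *)
exists (- y 2 2), (- (y 1 2 + y 2 1)), (y 1 1), (- y 0 0), (- (y 0 1 + y 1 0)),
  (y 1 1 - (y 0 2 + y 2 0)).
move=> v c; rewrite base_flag_spanE qform_base_quadric.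
have -> : qform Y c = \sum_i \sum_j c 0 i * Y i j * c 0 j.
  rewrite /qform mxE exchange_big; apply: eq_bigr => j _.
  by rewrite mxE mulr_suml [c^T _ _]mxE.
rewrite sum3E !sum3E -!/(y _ _) !wedge_coord !plE //= /v !vec5E //=; ring.
Qed.

(** The hypothesis says that the coordinates [E] restrict to the standard ones on the span [W], so
    the correction [Y] arrives there unchanged. *)
Lemma congr_deformation (W : 'M[K]_(3, 10)) E Y A B a b : W *m E = 1%:M ->
  W *m (a *: A + b *: B + E *m Y *m E^T) *m W^T =
  a *: (W *m A *m W^T) + b *: (W *m B *m W^T) + Y.
Proof.
move=> WE; rewrite !mulmxDr !mulmxDl -!scalemxAr -!scalemxAl; congr (_ + _).
by rewrite -!mulmxA -trmx_mul WE trmx1 mulmx1 mulmxA WE mul1mx.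
Qed.

Theorem exists_isotropic_flag (S : 'M[K]_10) (om : 'cV[K]_10) (delta eps : K) :
  delta != 0 \/ eps != 0 ->
  exists v xi theta, isotropic_flag S om delta eps v xi theta.
Proof.
move=> de; apply: contrapT => nex.
have [F [Fh Fsys Fcl]] := flag_polynomials R.
pose H : lmodType K := ('M[K]_3 * 'cV[K]_3)%type.
(* At parameter 1 and without correction these are the given data. At parameter 0 they are the base
   form with om = 0, delta = 1, eps = 0, up to the correction. *)
pose Q (t : K * H) : 'M[K]_10 := (1 - t.1) *: base_quadric + t.1 *: S +
  wedge_e0 *m t.2.1 *m wedge_e0^T.
pose Om (t : K * H) : 'cV[K]_10 := t.1 *: om + wedge_e0 *m t.2.2.
pose De (t : K * H) := (1 - t.1) + t.1 * delta.
pose Ep (t : K * H) := t.1 * eps.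
have hP := @deform_poly_subring R H.
have Ps : deform_poly (fun t : K * H => t.1) by apply: deform_poly_fst.
have Pc c : deform_poly (fun _ : K * H => c) by exact: (fsub_const hP c).
have Ps' : deform_poly (fun t : K * H => 1 - t.1).
  rewrite [X in deform_poly X](_ : _ = fun t => 1 + (-1) * t.1).
    exact: (fsubD hP (Pc 1) (fsubM hP (Pc (-1)) Ps)).
  by apply/funext => t; rewrite mulN1r.
have PY i j : deform_poly (fun t : K * H => t.2.1 i j).
  apply: (@deform_poly_snd _ _ (fun h : H => h.1 i j)) => h0 h1.
  exists ((h0.1 i j)%:P + 'X * (h1.1 i j)%:P) => s.
  by rewrite hornerD hornerM hornerX !hornerC /= !mxE.
have Pe i j : deform_poly (fun t : K * H => t.2.2 i j).
  apply: (@deform_poly_snd _ _ (fun h : H => h.2 i j)) => h0 h1.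
  exists ((h0.2 i j)%:P + 'X * (h1.2 i j)%:P) => s.
  by rewrite hornerD hornerM hornerX !hornerC /= !mxE.
have [||y|G [PG G1 G0]] := @elimination R _ _ _ _ flag_eqn_deg
    (fun j t => F j (Q t, Om t, De t, Ep t)) (1, (0, 0)) hP.
- by move=> j t; apply: Fh.
- apply: (Fcl _ _ Q Om De Ep hP).
  + move=> a b; under eq_fun do rewrite /Q !mxE.
    refine (fsubD hP (fsubD hP (fsubM hP Ps' (Pc _)) (fsubM hP Ps (Pc _))) _).
    refine (fsub_sum _ _ hP _) => j; refine (fsubM hP _ (Pc _)).
    under eq_fun do rewrite mxE.
    by refine (fsub_sum _ _ hP _) => k; exact: (fsubM hP (Pc _) (PY _ _)).
  + move=> a; under eq_fun do rewrite /Om !mxE.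
    refine (fsubD hP (fsubM hP Ps (Pc _)) _).
    by refine (fsub_sum _ _ hP _) => k; exact: (fsubM hP (Pc _) (Pe _ _)).
  + exact: (fsubD hP Ps' (fsubM hP Ps (Pc _))).
  + exact: (fsubM hP Ps (Pc _)).
- move=> /(proj1 (Fsys _ _)); rewrite /Q /Om /De /Ep /= !(mulmx0, mul0mx).
  rewrite subrr scale0r !scale1r !mul1r !addr0 !add0r => y0.
  apply/eqP/negPn/negP => yn0; apply: nex.
  exact: flag_system_sound de yn0 y0.
case/eqP: G1; apply: (deform_poly_eq0 PG) => -[Y eta].
have [b1 [b2 [b3 [l1 [l2 [l3 bP]]]]]] := base_flag_exists Y.
set v := vec5 1 _ _ _ _ in bP; set W := base_flag_span v l1 l2 l3 in bP.
(* The flag and [th] depend on ([Y], [eta]) only. The direction is chosen so that, for every s, the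
   corrected form restricts to s eps times the square of [th] on this flag and the corrected [om] to
   -((1 - s) + s delta) times [th]. *)
pose th := - eta.
pose dY := W *m base_quadric *m W^T - W *m S *m W^T + eps *: (th *m th^T).
pose deta := th - delta *: th - W *m om.
exists (dY, deta) => s; pose Ys := Y + s *: dY; pose es := eta + s *: deta.
rewrite -[(Y, eta) + s *: (dY, deta)]/((Ys, es) : H).
(* The vector [v] has first coordinate 1, and the vectors it is wedged with have first coordinate
   0. *)
have WE : W *m wedge_e0 = 1%:M.
  apply/row_matrixP => i; rewrite rowE mulmxA base_flag_spanE.
  apply/rowP => j; rewrite -(inord_val j) wedge_e0E ?ltn_ord // wedge_coord.
  rewrite plE ?(ltn_trans (ltn_ord j)) // /v row1 !mxE.
  case: j i => [[|[|[|j]]] hj] [[|[|[|i]]] hi] //=; rewrite !inordK //=; ring.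
pose xi : 'cV[K]_5 := (vec5 0 (- l1) (- l2) (- l3) 1)^T.
(* The extension of [th] that vanishes on [v]: modulo [v], a vector of the hyperplane is given by
   its coordinates w_i - w_0 b_i. *)
pose theta : 'cV[K]_5 := (vec5 (- (b1 * th (inord 0) 0 + b2 * th (inord 1) 0 +
  b3 * th (inord 2) 0)) (th (inord 0) 0) (th (inord 1) 0) (th (inord 2) 0) 0)^T.
suff /flag_system_complete[y y0 ys] :
    isotropic_flag (Q (s, (Ys, es))) (Om (s, (Ys, es))) (De (s, (Ys, es)))
      (Ep (s, (Ys, es))) v xi theta.
  by apply: (G0 _ y y0); apply/(proj2 (Fsys _ _)).
have xiE (w : 'rV[K]_5) : (w *m xi) 0 0 = w 0 (inord 4) -
    (w 0 (inord 1) * l1 + w 0 (inord 2) * l2 + w 0 (inord 3) * l3).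
  by rewrite mxE sum5E ![xi _ _]mxE !vec5E //=; ring.
have thE (w : 'rV[K]_5) : lform theta w = (w 0 (inord 1) - w 0 (inord 0) * b1) * th (inord 0) 0
    + (w 0 (inord 2) - w 0 (inord 0) * b2) * th (inord 1) 0 +
    (w 0 (inord 3) - w 0 (inord 0) * b3) * th (inord 2) 0.
  by rewrite /lform mxE sum5E ![theta _ _]mxE !vec5E //=; ring.
split.
- apply: contra_neq (oner_neq0 K) => /rowP/(_ (inord 0)).
  by rewrite vec5E // mxE.
- apply: contra_neq (oner_neq0 K) => /colP/(_ (inord 4)).
  by rewrite mxE vec5E // mxE.
- by apply/matrixP => i j; rewrite !ord1 xiE /v !vec5E //= mxE; ring.
move=> w /matrixP/(_ 0 0); rewrite xiE [RHS]mxE => /eqP; rewrite subr_eq0 => /eqP w4.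
pose c : 'rV[K]_3 := \row_i (w 0 (inord i.+1) - w 0 (inord 0) * [:: b1; b2; b3]`_i).
have cE i : (i < 3)%N -> c 0 (inord i) = w 0 (inord i.+1) - w 0 (inord 0) * [:: b1; b2; b3]`_i.
  by move=> i3; rewrite mxE inordK.
have wd : w = w 0 (inord 0) *: v + vec5 0 (w 0 (inord 1) - w 0 (inord 0) * b1)
    (w 0 (inord 2) - w 0 (inord 0) * b2) (w 0 (inord 3) - w 0 (inord 0) * b3)
    ((w 0 (inord 1) - w 0 (inord 0) * b1) * l1 +
     (w 0 (inord 2) - w 0 (inord 0) * b2) * l2 +
     (w 0 (inord 3) - w 0 (inord 0) * b3) * l3).
  apply/rowP => i; rewrite -(inord_val i); case: i => [[|[|[|[|[|i]]]]] hi] //=;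
    rewrite [RHS]mxE vec5E //= mxE /v vec5E //= ?w4; ring.
have wE : wedge v w = c *m W.
  by rewrite base_flag_spanE !cE //= {1}wd wedgeDr wedgeZr wedgeaa scaler0 add0r.
have tE : lform theta w = lform th c.
  have -> : lform th c = \sum_i c 0 i * th i 0 by rewrite /lform [LHS]mxE.
  by rewrite thE sum3E !cE.
rewrite wE tE; split.
  rewrite qform_congr.
  have -> : W *m Q (s, (Ys, es)) *m W^T =
      W *m base_quadric *m W^T + Y + (s * eps) *: (th *m th^T).
    rewrite /Q /= congr_deformation // /Ys /dY.
    set A := W *m base_quadric *m _; set B := W *m S *m _; set C := th *m _.
    by apply/matrixP => i j; rewrite !mxE; ring.
  rewrite !qform_addm qform_scalem -qform_congr bP add0r.
  by have := rank_one_form th^T c; rewrite trmxK => ->.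
have etaE : lform eta c = - lform th c by rewrite /th lformNr opprK.
rewrite /Om /De /= /es /deta; move: (th) etaE => th' etaE.
rewrite !(lformDr, lformZr, lformNr, lformMr) -(mulmxA c W) WE mulmx1 etaE; ring.
Qed.

End Existence.

(** * Birational charts *)

Section BirationalCharts.
Variable K : fieldType.

Lemma peq_sym n (x y : 'rV[K]_n) : peq x y -> peq y x.
Proof.
by case=> c c0 ->; exists c^-1; rewrite ?invr_eq0 // scalerA mulVf // scale1r.
Qed.

Lemma peq_trans n (x y z : 'rV[K]_n) : peq x y -> peq y z -> peq x z.
Proof.
by move=> [c c0 ->] [e e0 ->]; exists (e * c); rewrite ?mulf_neq0 // scalerA.
Qed.

Lemma peq_hvec n m d (F : 'rV[K]_n -> 'rV[K]_m) x y :
  hvec d F -> peq x y -> peq (F x) (F y).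
Proof.
move=> hF [c c0 ->]; exists (c ^+ d); first exact: expf_neq0.
exact: (hvec_scale _ _ hF).
Qed.

Lemma peq_hform n d (f : 'rV[K]_n -> K) x y :
  hform d f -> peq x y -> (f x == 0) = (f y == 0).
Proof.
move=> hf [c c0 ->]; rewrite (hform_scale _ _ hf) mulf_eq0.
by rewrite expf_eq0 (negbTE c0) andbF.
Qed.

Lemma principal_open n d (s : 'rV[K]_n -> K) : hform d s ->
  popen (fun x => x != 0 /\ s x != 0).
Proof.
move=> [p hp pE]; exists [:: p] => [q|x]; first by rewrite inE => /eqP->; exists d.
split=> -[x0 H]; split=> //.
  by case=> _ /(_ p); rewrite inE eqxx pE => /(_ isT)/eqP; rewrite (negbTE H).
apply/eqP => sx; apply: H; split=> // q; rewrite inE => /eqP->.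
by rewrite pE.
Qed.

Lemma popen_principal n (O : pset K n) x : popen O -> O x ->
  exists d (s : 'rV[K]_n -> K),
    [/\ hform d s, s x != 0 & forall y, y != 0 -> s y != 0 -> O y].
Proof.
move=> [S hS OE] /OE[x0 nz].
have [p pS px] : exists2 p, p \in S & peval p x != 0.
  apply: contrapT => h; apply: nz; split=> // p pS.
  by apply/eqP/negPn/negP => px; apply: h; exists p.
have [d pd] := hS _ pS.
exists d, (peval p); split=> // [|y y0 py]; first exact: hform_peval.
by apply/OE; split=> // -[_ /(_ p pS)] /eqP; rewrite (negbTE py).
Qed.

Lemma regular_on_hvec n m d (U : pset K n) (F : 'rV[K]_n -> 'rV[K]_m) :
  (forall x, U x -> x != 0) -> (forall x, U x -> F x != 0) -> hvec d F ->
  regular_on U F.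
Proof.
move=> U0 F0 hF x Ux.
have /choice[P PP] i : exists p : {mpoly K[n]},
    p \is d.-homog /\ forall x, peval p x = F x 0 i.
  by have [p hp pE] := hF i; exists p.
exists (fun y => y != 0 /\ (1 : K) != 0), d, P; split.
- exact: (principal_open (hform_const _ 1)).
- by split; [exact: U0 | exact: oner_neq0].
- by move=> i; have [] := PP i.
move=> y Uy _.
have -> : \row_i peval (P i) y = F y.
  by apply/rowP => i; rewrite mxE; have [_ ->] := PP i.
by split; [exact: F0 | exists 1; rewrite ?oner_neq0 ?scale1r].
Qed.

Lemma regular_on_local n m (U : pset K n) (f : 'rV[K]_n -> 'rV[K]_m) x :
  regular_on U f -> (forall x, U x -> x != 0) -> U x ->
  exists e d (s : 'rV[K]_n -> K) (F : 'rV[K]_n -> 'rV[K]_m),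
    [/\ hform e s, hvec d F, s x != 0 &
        forall y, U y -> s y != 0 -> F y != 0 /\ peq (f y) (F y)].
Proof.
move=> rf U0 Ux; have [O [d [P [openO Ox hP fP]]]] := rf x Ux.
have [e [s [hs sx sO]]] := popen_principal openO Ox.
exists e, d, s, (fun y => \row_i peval (P i) y); split=> //.
  by move=> i; apply: hform_ext (hform_peval (hP i)) => y; rewrite mxE.
by move=> y Uy sy; apply: fP => //; apply: sO => //; apply: U0.
Qed.

Definition cone n (Z : pset K n) : Prop :=
  (forall x, Z x -> x != 0) /\ forall x c, c != 0 -> Z x -> Z (c *: x).

Lemma cone_peq n (Z : pset K n) x y : cone Z -> peq x y -> Z x -> Z y.
Proof. by move=> [_ cZ] [c c0 ->]; apply: cZ. Qed.

(** The maps [f] and [g] are polynomial only locally, so representatives [F] and [G] are fixed near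
    one pair of corresponding points, and the open sets are shrunk until all composites are
    defined. *)
Lemma rational_of_chart n m k (Z : pset K n) (D : pset K m) f g d e c
    (phi : 'rV[K]_m -> 'rV[K]_k.+1) (psi : 'rV[K]_k.+1 -> 'rV[K]_m)
    (s : 'rV[K]_k.+1 -> K) :
  pirreducible Z -> cone Z -> cone D -> isomorphism_on Z D f g ->
  hvec d phi -> hvec e psi -> hform c s ->
  (forall z, s z != 0 -> z != 0) ->
  (forall y, D y -> s (phi y) != 0 -> peq (psi (phi y)) y) ->
  (forall z, s z != 0 -> D (psi z) /\ peq (phi (psi z)) z) ->
  (exists z, s z != 0) -> rational_variety Z k.
Proof.
move=> irrZ cZ cD [rf rg fZ gD] hphi hpsi hs s0 phiK psiK [z0 sz0]; split=> //.
have [Z0 _] := cZ; have [D0 _] := cD.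
have [Dy0 y0z0] := psiK _ sz0; set y0 := psi z0 in Dy0 y0z0.
have [Zx0 fgy0] := gD _ Dy0; set x0 := g y0 in Zx0 fgy0.
have [e1 [d1 [s1 [F [hs1 hF s1x0 fF]]]]] := regular_on_local rf Z0 Zx0.
have [e2 [d2 [s2 [G [hs2 hG s2y0 gG]]]]] := regular_on_local rg D0 Dy0.
(* The locus in [D] where the chart and both representatives are usable; [s4] and [s5] are its
   pullbacks to [Z] and to projective space. *)
pose s3 y := s (phi y) * s2 y * s1 (G y).
have hs3 := hformM (hformM (hform_compf hs hphi) hs2) (hform_compf hs1 hG).
rewrite -/(hform _ s3) in hs3.
have s3P y : s3 y != 0 -> [/\ s (phi y) != 0, s2 y != 0 & s1 (G y) != 0].
  by rewrite /s3 !mulf_eq0 !negb_or -andbA => /and3P[].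
pose s4 x := s1 x * s3 (F x).
have hs4 := hformM hs1 (hform_compf hs3 hF); rewrite -/(hform _ s4) in hs4.
pose s5 z := s z * s3 (psi z).
have hs5 := hformM hs (hform_compf hs3 hpsi); rewrite -/(hform _ s5) in hs5.
have Z4 x : Z x -> s4 x != 0 -> [/\ D (F x), s3 (F x) != 0, peq (f x) (F x),
    s5 (phi (F x)) != 0 & peq (G (psi (phi (F x)))) x].
  move=> Zx; rewrite /s4 mulf_eq0 negb_or => /andP[s1x s3x].
  have [F0 fFx] := fF x Zx s1x; have [Dfx gfx] := fZ x Zx.
  have DFx := cone_peq cD fFx Dfx; have [sx s2x s1x'] := s3P _ s3x.
  have psx := phiK _ DFx sx.
  have s2fx : s2 (f x) != 0 by rewrite (peq_hform hs2 fFx).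
  have [_ gGf] := gG _ Dfx s2fx.
  split=> //; first by rewrite /s5 mulf_neq0 // (peq_hform hs3 psx).
  apply: peq_trans (peq_hvec hG psx) _.
  apply: peq_trans (peq_hvec hG (peq_sym fFx)) _.
  exact: peq_trans (peq_sym gGf) gfx.
have Z5 z : s5 z != 0 -> [/\ Z (G (psi z)), s4 (G (psi z)) != 0 &
    peq (phi (F (G (psi z)))) z].
  rewrite /s5 mulf_eq0 negb_or => /andP[sz s3z].
  have [Dy phy] := psiK z sz; have [sy s2y s1y] := s3P _ s3z.
  have [G0 gGy] := gG _ Dy s2y; have [Zgy fgy] := gD _ Dy.
  have ZG := cone_peq cZ gGy Zgy.
  have s1g : s1 (g (psi z)) != 0 by rewrite (peq_hform hs1 gGy).
  have [_ fFg] := fF _ Zgy s1g.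
  have FG : peq (F (G (psi z))) (psi z).
    apply: peq_trans (peq_hvec hF (peq_sym gGy)) _.
    exact: peq_trans (peq_sym fFg) fgy.
  split=> //; first by rewrite /s4 mulf_neq0 // (peq_hform hs3 FG).
  exact: peq_trans (peq_hvec hphi FG) phy.
have s50 : s5 z0 != 0.
  rewrite /s5 mulf_neq0 //; rewrite /s3 !mulf_neq0 //.
    by rewrite (peq_hform hs y0z0).
  by have [_ /(peq_hform hs1) <-] := gG _ Dy0 s2y0.
exists (fun x => x != 0 /\ s4 x != 0), (fun z => z != 0 /\ s5 z != 0); split.
- exact: principal_open hs4.
- exact: principal_open hs5.
- by have [Zx s4x _] := Z5 _ s50; exists (G (psi z0)); split=> //; split=> //; apply: Z0.
- by exists z0; split=> //; apply: s0.
have s5_0 z : s5 z != 0 -> z != 0.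
  by rewrite /s5 mulf_eq0 negb_or => /andP[/s0].
exists (fun x => phi (F x)), (fun z => G (psi z)); split.
- apply: (@regular_on_hvec _ _ (d1 * d)) => [x [Zx _]|x [Zx [_ s4x]]|].
  + exact: Z0.
  + by have [_ _ _ /s5_0] := Z4 x Zx s4x.
  + exact: hvec_comp.
- apply: (@regular_on_hvec _ _ (e * d2)) => [z [] //|z [_ s5z]|].
  + by have [/Z0] := Z5 z s5z.
  + exact: hvec_comp.
- move=> x [Zx [_ s4x]]; have [_ _ _ s5x ex] := Z4 x Zx s4x.
  by split=> //; split=> //; apply: s5_0.
move=> z [_ s5z]; have [Zx s4x ez] := Z5 z s5z.
by split=> //; split=> //; split=> //; apply: Z0.
Qed.

End BirationalCharts.

(** * Projection of a quadric bundle from a section *)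

Section QuadricSection.
Variable K : numFieldType.

Lemma hform_bform n m d e (S : 'M[K]_m) (F G : 'rV[K]_n -> 'rV[K]_m) :
  hvec d F -> hvec e G -> hform (d + e) (fun x => bform S (F x) (G x)).
Proof.
move=> hF hG; apply: (@hform_ext _ _ _ (fun x => \sum_j (F x *m S) 0 j * G x 0 j)).
  by move=> x; rewrite /bform [RHS]mxE; apply: eq_bigr => j _; rewrite [_^T _ _]mxE.
by apply: hform_sum => j; apply: hformM; [exact: hvec_mulmx | exact: hG].
Qed.

Lemma qformZ n (S : 'M[K]_n) c x : qform S (c *: x) = c ^+ 2 * qform S x.
Proof. by rewrite -![qform _ _]/(bform S _ _) bformZl bformZr; ring. Qed.

(* [E z] is a point of the quadric in the fibre over [z] and [P z] another point
   of the linear span of this fibre; the line through them meets the quadric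
   again in [L z *: P z - qform S (P z) *: E z]. *)
Lemma quadric_section_chart n m k (Z : pset K n) (C : pset K m) f g dP dE dk
    (S : 'M[K]_m) (Phi : 'M[K]_(m, k.+1)) (P E : 'rV[K]_k.+1 -> 'rV[K]_m)
    (kappa : 'rV[K]_k.+1 -> K) :
  let L z := bform S (E z) (P z) + bform S (P z) (E z) in
  pirreducible Z -> cone Z -> cone C ->
  isomorphism_on Z (fun y => C y /\ qform S y = 0) f g ->
  hvec dP P -> hvec dE E -> hform dk kappa -> (0 < dk)%N ->
  (forall z, qform S (E z) = 0) ->
  (forall z, P z *m Phi = kappa z *: z) -> (forall z, E z *m Phi = 0) ->
  (forall z a c, kappa z != 0 -> a != 0 -> C (a *: P z + c *: E z)) ->
  (forall y, C y -> exists a,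
     kappa (y *m Phi) *: y = P (y *m Phi) + a *: E (y *m Phi)) ->
  (exists z, kappa z != 0 /\ L z != 0) -> rational_variety Z k.
Proof.
move=> L irrZ cZ [C0 cC] isoZ hP hE hk dk0 qE PPhi EPhi CPE CP [z0 [kz0 Lz0]].
have hL : hform (dE + dP) L.
  by apply: hformD; [|rewrite addnC]; apply: hform_bform.
have hM : hform (dP + dP) (fun z => qform S (P z)) by apply: hform_bform.
pose psi z := L z *: P z - qform S (P z) *: E z.
have hpsi : hvec (dE + dP + dP) psi.
  by apply: hvecB; [|rewrite -addnA addnC]; apply: hvecZ.
have qPE z a c : qform S (a *: P z + c *: E z) =
    a ^+ 2 * qform S (P z) + a * c * L z.
  by rewrite qform_comb qE mulr0 addr0 [bform S _ (E z) + _]addrC.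
apply: (@rational_of_chart _ _ _ _ _ _ f g 1 _ _ (fun y => y *m Phi) psi
  (fun z => kappa z * L z) irrZ cZ _ isoZ _ hpsi (hformM hk hL)).
- split=> [y [/C0]|y c c0 [Cy qy]] //; split; first exact: cC.
  by rewrite qformZ qy mulr0.
- exact/hvec_mulmx/hvec_id.
(* The positive degree of [kappa] makes it vanish at the zero vector. *)
- move=> z; apply: contraNneq => ->; have := hform_scale 0 0 hk.
  by rewrite scale0r expr0n -[_ == _]negbK -lt0n dk0 mul0r => ->; rewrite mul0r.
- move=> y [Cy qy]; rewrite mulf_eq0 negb_or => /andP[ky Ly].
  have [a ya] := CP y Cy.
  (* On the line through the two points the form is linear in [a], because [E] is isotropic. Solving
     for [a] identifies [psi] with a multiple of [y]. *)
  have Ma : qform S (P (y *m Phi)) = - (a * L (y *m Phi)).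
    apply/eqP; rewrite -addr_eq0; apply/eqP.
    have := qPE (y *m Phi) 1 a; rewrite scale1r -ya qformZ qy mulr0 => ->.
    by rewrite expr1n !mul1r.
  exists (L (y *m Phi) * kappa (y *m Phi))^-1; first by rewrite invr_eq0 mulf_neq0.
  rewrite /psi Ma scaleNr opprK [a * _]mulrC -scalerA -scalerDr -ya.
  by rewrite [L _ *: _]scalerA scalerA mulVf ?scale1r ?mulf_neq0.
- move=> z; rewrite mulf_eq0 negb_or => /andP[kz Lz]; split; first split.
  + by rewrite /psi -scaleNr; apply: CPE.
  + by rewrite /psi -scaleNr qPE; ring.
  exists (L z * kappa z)^-1; first by rewrite invr_eq0 mulf_neq0.
  rewrite /psi mulmxBl -!scalemxAl PPhi EPhi scaler0 subr0.
  by rewrite [L _ *: _]scalerA scalerA mulVf ?scale1r ?mulf_neq0.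
- by exists z0; rewrite mulf_neq0.
Qed.

End QuadricSection.

(** * Smoothness and adapted bases *)

Section LinearAlgebra.
Variable K : fieldType.

Lemma row_free_extend k n (A : 'M[K]_(k, n)) (d : 'rV[K]_n) :
  row_free A -> ~~ (d <= A)%MS -> row_free (col_mx A d).
Proof.
move=> fA dA; rewrite /row_free eqn_leq rank_leq_row /=.
have : (A < col_mx A d)%MS.
  rewrite ltmxE col_mx_sub negb_and dA orbT andbT.
  by rewrite -addsmxE addsmxSl.
by rewrite ltmxErank (eqP fA) => /andP[_] h; apply: leq_trans h; rewrite addn1.
Qed.

Lemma row_free_pick k m n (A : 'M[K]_(k, n)) (V : 'M[K]_(m, n)) :
  row_free A -> (k < \rank V)%N ->
  exists2 d : 'rV[K]_n, (d <= V)%MS & row_free (col_mx A d).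
Proof.
move=> fA kV; have /row_subPn[i iA] : ~~ (V <= A)%MS.
  by apply: contraL kV => /mxrankS; rewrite (eqP fA) -leqNgt.
by exists (row i V); [exact: row_sub | exact: row_free_extend].
Qed.

Lemma row_free_rV n (v : 'rV[K]_n) : v != 0 -> row_free v.
Proof. by move=> v0; rewrite /row_free rank_rV v0. Qed.

Definition basis5 (f0 f1 f2 f3 f4 : 'rV[K]_5) : 'M[K]_5 :=
  col_mx (col_mx (col_mx (col_mx f0 f1) f2) f3) f4.

Lemma row_basis5 f0 f1 f2 f3 f4 k : (k < 5)%N ->
  row (inord k) (basis5 f0 f1 f2 f3 f4) = nth 0 [:: f0; f1; f2; f3; f4] k.
Proof.
have rowd m (A : 'M[K]_(m, 5)) (d : 'rV[K]_5) (i : 'I_(m + 1)) :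
    i = m :> nat -> row i (col_mx A d) = d.
  move=> im; rewrite (_ : i = rshift m 0); last by apply/val_inj; rewrite /= addn0.
  by rewrite rowKd row_id.
have rowu m (A : 'M[K]_(m, 5)) (d : 'rV[K]_5) (i : 'I_(m + 1)) (j : 'I_m) :
    i = j :> nat -> row i (col_mx A d) = row j A.
  by move=> ij; rewrite (_ : i = lshift 1 j) ?rowKu //; apply/val_inj.
rewrite /basis5; case: k => [|[|[|[|[|k]]]]] // _ /=.
- rewrite (rowu (1 + 1 + 1 + 1)%N _ _ _ (inord 0 : 'I_4)) ?inordK //.
  rewrite (rowu (1 + 1 + 1)%N _ _ _ (inord 0 : 'I_3)) ?inordK //.
  rewrite (rowu (1 + 1)%N _ _ _ (inord 0 : 'I_2)) ?inordK //.
  rewrite (rowu 1%N _ _ _ (inord 0 : 'I_1)) ?inordK //.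
  by rewrite (_ : inord 0 = 0) ?row_id //; apply/val_inj; rewrite /= inordK.
- rewrite (rowu (1 + 1 + 1 + 1)%N _ _ _ (inord 1 : 'I_4)) ?inordK //.
  rewrite (rowu (1 + 1 + 1)%N _ _ _ (inord 1 : 'I_3)) ?inordK //.
  rewrite (rowu (1 + 1)%N _ _ _ (inord 1 : 'I_2)) ?inordK //.
  by apply: rowd; rewrite inordK.
- rewrite (rowu (1 + 1 + 1 + 1)%N _ _ _ (inord 2 : 'I_4)) ?inordK //.
  rewrite (rowu (1 + 1 + 1)%N _ _ _ (inord 2 : 'I_3)) ?inordK //.
  by apply: rowd; rewrite inordK.
- rewrite (rowu (1 + 1 + 1 + 1)%N _ _ _ (inord 3 : 'I_4)) ?inordK //.
  by apply: rowd; rewrite inordK.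
- by apply: rowd; rewrite inordK.
Qed.

End LinearAlgebra.

Section Tangent.
Variable K : numFieldType.

Definition dual_bases (f : 'I_5 -> 'rV[K]_5) (g : 'I_5 -> 'cV[K]_5) : Prop :=
  (forall i j, lform (g i) (f j) = (i == j)%:R) /\
  forall a, a = \sum_i lform (g i) a *: f i.

Lemma dual_bases_exist (e : 'M[K]_5) : row_free e ->
  dual_bases (fun i => row i e) (fun i => col i (invmx e)).
Proof.
rewrite row_free_unit => ue.
have gE i a : lform (col i (invmx e)) a = (a *m invmx e) 0 i.
  by rewrite /lform [LHS]mxE [RHS]mxE; apply: eq_bigr => k _; rewrite [col _ _ _ _]mxE.
split=> [i j|a]; last first.
  by rewrite -[LHS](mulmxKV ue) mulmx_sum_row; apply: eq_bigr => i _; rewrite gE.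
by rewrite gE -row_mul mulmxV // !mxE eq_sym.
Qed.

Lemma wedge_pairing_lform f g (a b : 'rV[K]_5) :
  lform (wedge f^T g^T)^T (wedge a b) =
  lform f a * lform g b - lform g a * lform f b.
Proof.
rewrite [LHS]/lform wedge_pairing (lformE f a) (lformE g b) (lformE g a) (lformE f b).
rewrite -!scalar_mxM -raddfB /=.
by rewrite mxE mulr1n.
Qed.

Definition wedge_mx (u : 'rV[K]_5) : 'M[K]_(5, 10) :=
  \matrix_i wedge u (basis_vec K i).

Lemma wedge_mxE u y : y *m wedge_mx u = wedge u y.
Proof.
rewrite mulmx_sum_row {2}(row_basis y) wedge_sumr; apply: eq_bigr => i _.
by rewrite rowK wedgeZr.
Qed.

Definition tangent_mx (u u' : 'rV[K]_5) : 'M[K]_(5 + 5, 10) :=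
  col_mx (wedge_mx u) (wedge_mx u').

Lemma tangent_mxP u u' t :
  (t <= tangent_mx u u')%MS <-> exists y y', t = wedge u y + wedge u' y'.
Proof.
split=> [/submxP[D ->]|[y [y' ->]]].
  exists (lsubmx D), (rsubmx D).
  by rewrite -{1}(hsubmxK D) mul_row_col !wedge_mxE.
apply/submxP; exists (row_mx y y').
by rewrite mul_row_col !wedge_mxE.
Qed.

Lemma wedge_row_free u u' : wedge u u' != 0 -> row_free (col_mx u u' : 'M[K]_(1 + 1, 5)).
Proof.
move=> uu; apply: row_free_extend.
  by apply: row_free_rV; apply: contra_neq uu => ->; rewrite wedge0l.
apply: contra uu => /submxP[D ->]; rewrite (mx11_scalar D) mul_scalar_mx.
by rewrite wedgeZr wedgeaa scaler0.
Qed.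

(** The row space is the tangent space of the cone over the six-dimensional Grassmannian. In a basis
    starting with u, u' it contains the seven wedges involving one of them, and these are
    independent by pairing with the dual basis. *)
Lemma tangent_mx_rank u u' : wedge u u' != 0 -> (7 <= \rank (tangent_mx u u'))%N.
Proof.
move=> /wedge_row_free fA.
have [|a _ fa] := @row_free_pick _ _ _ _ _ (1%:M : 'M_5) fA; first by rewrite mxrank1.
have [|b _ fb] := @row_free_pick _ _ _ _ _ (1%:M : 'M_5) fa; first by rewrite mxrank1.
have [|c _ fc] := @row_free_pick _ _ _ _ _ (1%:M : 'M_5) fb; first by rewrite mxrank1.
have := dual_bases_exist (fc : row_free (basis5 u u' a b c)).
set f := (fun i => row i _); set g := (fun i => col i _); case=> gf _.
have f0 : f (inord 0) = u := row_basis5 u u' a b c (isT : 0 < 5)%N.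
have f1 : f (inord 1) = u' := row_basis5 u u' a b c (isT : 1 < 5)%N.
pose ix := [:: (0, 1); (0, 2); (0, 3); (0, 4); (1, 2); (1, 3); (1, 4)]%N.
pose A := \matrix_(k < 7) wedge (f (inord (nth (0, 0)%N ix k).1)) (f (inord (nth (0, 0)%N ix k).2)).
pose B := \matrix_(k < 7) wedge (g (inord (nth (0, 0)%N ix k).1))^T
   (g (inord (nth (0, 0)%N ix k).2))^T.
have eqi i j : (i < 5)%N -> (j < 5)%N -> (inord i == inord j :> 'I_5) = (i == j).
  by move=> i5 j5; rewrite -val_eqE /= !inordK.
have AB : A *m B^T = 1%:M.
  apply/matrixP => k l.
  transitivity (lform (wedge (g (inord (nth (0, 0)%N ix l).1))^T
     (g (inord (nth (0, 0)%N ix l).2))^T)^T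
     (wedge (f (inord (nth (0, 0)%N ix k).1)) (f (inord (nth (0, 0)%N ix k).2)))).
    rewrite /lform [LHS]mxE [RHS]mxE; apply: eq_bigr => j _.
    by rewrite [A _ _]mxE [B^T _ _]mxE [B _ _]mxE [_^T _ 0]mxE.
  rewrite wedge_pairing_lform !gf !eqi ?[RHS]mxE;
    case: k => [[|[|[|[|[|[|[|k]]]]]]] hk] //; case: l => [[|[|[|[|[|[|[|l]]]]]]] hl] //=;
    ring.
have rA : (7 <= \rank A)%N.
  by rewrite eq_leq //; apply/esym/eqP; rewrite -/(row_free A); apply/row_freeP; exists B^T.
apply: leq_trans rA (mxrankS _); apply/row_subP => k; rewrite rowK; apply/tangent_mxP.
case: k => [[|[|[|[|[|[|[|k]]]]]]] hk] //=.
- by exists (f (inord 1)), 0; rewrite f0 wedge0r addr0.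
- by exists (f (inord 2)), 0; rewrite f0 wedge0r addr0.
- by exists (f (inord 3)), 0; rewrite f0 wedge0r addr0.
- by exists (f (inord 4)), 0; rewrite f0 wedge0r addr0.
- by exists 0, (f (inord 2)); rewrite f1 wedge0r add0r.
- by exists 0, (f (inord 3)); rewrite f1 wedge0r add0r.
- by exists 0, (f (inord 4)); rewrite f1 wedge0r add0r.
Qed.

End Tangent.

(** * Consequences of the Jacobian criterion *)

Section Smoothness.
Variable K : numFieldType.

Definition directional n (p : {mpoly K[n]}) (x t : 'rV[K]_n) : K :=
  \sum_j peval p^`M(j) x * t 0 j.

Lemma mderiv_var n (i j : 'I_n) : mderiv j ('X_i : {mpoly K[n]}) = (i == j)%:R.
Proof.
rewrite mderivX mnm1E; have [<-|_] := eqVneq i j; last by rewrite scale0r.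
rewrite scale1r [(_ - _)%MM](_ : _ = 0%MM) ?mpolyX0 //.
by apply/mnmP => k; rewrite mnmBE subnn mnm0E.
Qed.

Lemma directional_sum n (I : Type) (r : seq I) (F : I -> {mpoly K[n]}) x t :
  directional (\sum_(i <- r) F i) x t = \sum_(i <- r) directional (F i) x t.
Proof.
rewrite /directional exchange_big; apply: eq_bigr => j _ /=.
by rewrite raddf_sum peval_sum mulr_suml.
Qed.

Lemma directionalZ n c (p : {mpoly K[n]}) x t :
  directional (c *: p) x t = c * directional p x t.
Proof.
by rewrite /directional mulr_sumr; apply: eq_bigr => j _; rewrite mderivZ pevalZ mulrA.
Qed.

Lemma directional_var n (i : 'I_n) x t : directional 'X_i x t = t 0 i.
Proof.
rewrite /directional (bigD1 i) //= big1 => [|j ji].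
  by rewrite mderiv_var eqxx /peval meval1 mul1r addr0.
by rewrite mderiv_var eq_sym (negbTE ji) /peval meval0 mul0r.
Qed.

Lemma directionalM n (p q : {mpoly K[n]}) x t :
  directional (p * q) x t =
  directional p x t * peval q x + peval p x * directional q x t.
Proof.
rewrite /directional mulr_suml mulr_sumr -big_split; apply: eq_bigr => j _ /=.
by rewrite mderivM pevalD !pevalM mulrDl mulrAC mulrA.
Qed.

Lemma homog2_monomials n (q : {mpoly K[n]}) : q \is 2.-homog ->
  exists S : 'M[K]_n, q = \sum_i \sum_j S i j *: ('X_i * 'X_j).
Proof.
move=> hq.
have two (m : 'X_{1..n}) : mdeg m = 2 -> exists i j, 'X_[K, m] = 'X_i * 'X_j.
  move=> m2; have pick (m' : 'X_{1..n}) d : mdeg m' = d.+1 ->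
      exists i (m'' : 'X_{1..n}), mdeg m'' = d /\ m' = (U_(i) + m'')%MM.
    move=> dm; have [i mi] : exists i, m' i != 0%N.
      apply/existsP; rewrite -[[exists _, _]]negbK negb_exists; apply/negP => /forallP h.
      move: dm; rewrite mdegE big1 // => i _.
      by apply/eqP; move: (h i); rewrite negbK.
    have le : (U_(i) <= m')%MM by rewrite lep1mP.
    exists i, (m' - U_(i))%MM; split; last by rewrite addmC submK.
    by move: dm; rewrite -{1}(submK le) mdegD mdeg1 addn1 => -[].
  have [i [m1 [d1 ->]]] := pick m 1%N m2; have [j [m0 [/eqP d0 ->]]] := pick m1 0%N d1.
  exists i, j; rewrite !mpolyXD; congr (_ * _).
  by move: d0; rewrite mdeg_eq0 => /eqP ->; rewrite mpolyX0 mulr1.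
have : forall r : seq 'X_{1..n}, {subset r <= msupp q} -> exists S : 'M[K]_n,
    \sum_(m <- r) q@_m *: 'X_[m] = \sum_i \sum_j S i j *: ('X_i * 'X_j).
  elim=> [|m r IH] rq.
    exists 0; rewrite big_nil big1 // => i _; rewrite big1 // => j _.
    by rewrite mxE scale0r.
  have [|S SE] := IH; first by move=> k kr; apply: rq; rewrite inE kr orbT.
  have [|i0 [j0 mE]] := two m; first by apply: (dhomog_mf hq); rewrite rq // inE eqxx.
  exists (S + q@_m *: delta_mx i0 j0); rewrite big_cons SE mE.
  have -> : q@_m *: ('X_i0 * 'X_j0) =
      \sum_i \sum_j (q@_m * delta_mx i0 j0 i j) *: ('X_i * 'X_j) :> {mpoly K[n]}.
    rewrite (bigD1 i0) //= [X in _ + X]big1 => [|i ii].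
      rewrite (bigD1 j0) //= big1 => [|j jj].
        by rewrite mxE !eqxx mulr1 !addr0.
      by rewrite mxE (negbTE jj) andbF mulr0 scale0r.
    by rewrite big1 // => j _; rewrite mxE (negbTE ii) mulr0 scale0r.
  rewrite addrC -big_split; apply: eq_bigr => i _; rewrite -big_split.
  by apply: eq_bigr => j _ /=; rewrite -scalerDl; congr (_ *: _); rewrite !mxE.
by move=> /(_ (msupp q) (fun _ h => h)) [S SE]; exists S; rewrite -SE -mpolyE.
Qed.

Lemma homog2_qform n (q : {mpoly K[n]}) : q \is 2.-homog -> exists S : 'M[K]_n,
  (forall x, peval q x = qform S x) /\
  forall x t, directional q x t = bform S x t + bform S t x.
Proof.
move=> /homog2_monomials[S ->]; exists S.
have bE x y : bform S x y = \sum_i \sum_j S i j * (x 0 i * y 0 j).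
  rewrite /bform mxE exchange_big; apply: eq_bigr => j _.
  by rewrite [_^T _ _]mxE mxE mulr_suml; apply: eq_bigr => i _; ring.
split=> [x|x t].
  rewrite -[qform S x]/(bform S x x) bE peval_sum; apply: eq_bigr => i _.
  by rewrite peval_sum; apply: eq_bigr => j _; rewrite pevalZ pevalM !pevalX.
rewrite !bE -big_split directional_sum; apply: eq_bigr => i _ /=.
rewrite directional_sum -big_split; apply: eq_bigr => j _ /=.
by rewrite directionalZ directionalM !directional_var !pevalX; ring.
Qed.

Lemma directional_homog2 n (q : {mpoly K[n]}) x t : q \is 2.-homog ->
  directional q x t = peval q (x + t) - peval q x - peval q t.
Proof. by move=> /homog2_qform[S [qE ->]]; rewrite !qE qformD; ring. Qed.

Lemma jacobian_kernel (X : projScheme K) (x t : 'rV[K]_(ncoord X)) :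
  (forall p, p \in eqns X -> directional p x t = 0) -> t *m (jacobian x)^T = 0.
Proof.
move=> H; apply/rowP => i; rewrite [RHS]mxE mxE -[RHS](H (eqns X)`_i) ?mem_nth //.
by apply: eq_bigr => j _; rewrite mxE [jacobian _ _ _]mxE mulrC.
Qed.

Lemma plucker_homog m : @plucker_relation K m \is 2.-homog.
Proof.
rewrite /plucker_relation; do 2?[apply: dhomogD]; rewrite ?dhomogN;
  by apply: (@dhomogM _ _ _ 1 _ 1); rewrite dhomogX /= mdeg1.
Qed.

Lemma directional_linear (W : 'M[K]_10) x t p :
  p \in linear_eqns W -> directional p x t = peval p t.
Proof.
move=> /mapP[j _ ->]; rewrite directional_sum peval_sum; apply: eq_bigr => i _.
by rewrite directionalZ directional_var pevalZ pevalX.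
Qed.

Definition polar (S : 'M[K]_10) (x t : 'rV[K]_10) : K := bform S x t + bform S t x.

Lemma polarDr S x t t' : polar S x (t + t') = polar S x t + polar S x t'.
Proof. by rewrite /polar bformDl bformDr addrACA. Qed.

Lemma polarZr S x c t : polar S x (c *: t) = c * polar S x t.
Proof. by rewrite /polar bformZl bformZr; ring. Qed.

Lemma polarNr S x t : polar S x (- t) = - polar S x t.
Proof. by rewrite -scaleN1r polarZr mulN1r. Qed.

Lemma polarC S x t : polar S x t = polar S t x.
Proof. by rewrite /polar addrC. Qed.

Section GM.
Variables (n : nat) (W : 'M[K]_10) (q : {mpoly K[10]}) (S : 'M[K]_10).
Hypothesis GM : ordinary_GM_data n W q.
Hypothesis qS : forall x, peval q x = qform S x.
Variables u u' : 'rV[K]_5.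
Let w := wedge u u'.
Hypotheses (w0 : w != 0) (wW : (w <= W)%MS) (qw : qform S w = 0).

(** A Pluecker relation is quadratic, so its derivative at w along u /\ y is a combination of its
    values at w, u /\ y and w + u /\ y. These are all decomposable, and likewise for the second
    summand. *)
Lemma GM_kernel (t : 'rV[K]_10) : (t <= tangent_mx u u')%MS -> (t <= W)%MS ->
  polar S w t = 0 ->
  t *m (jacobian (w : 'rV_(ncoord (gr_quadric_section W q))))^T = 0.
Proof.
move=> /tangent_mxP[y [y' tE]] tW Bt; have [_ hq _] := GM.
apply: jacobian_kernel => p; rewrite /= !mem_cat inE => /or3P[/mapP[m _ ->]|pl|/eqP->].
- have h := plucker_homog m.
  have D t1 t2 : directional (plucker_relation K m) w (t1 + t2) =
      directional (plucker_relation K m) w t1 + directional (plucker_relation K m) w t2.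
    by rewrite /directional -big_split; apply: eq_bigr => j _; rewrite mxE mulrDr.
  have e1 : w + wedge u y = wedge u (u' + y) by rewrite wedgeDr.
  have e2 : w + wedge u' y' = wedge (u - y') u'.
    by rewrite wedgeDl -scaleN1r wedgeZl scaleN1r -wedgeN.
  by rewrite tE D !directional_homog2 // e1 e2 !wedge_gr !subr0 addr0.
- by rewrite (directional_linear _ _ pl); apply: (proj2 (linear_eqnsP W t)).
- by rewrite directional_homog2 // !qS qformD -/(polar S w t) Bt; ring.
Qed.

Lemma GM_point : points (gr_quadric_section W q) w.
Proof.
split=> // p; rewrite /= !mem_cat inE => /or3P[pg|pl|/eqP->].
- by have [_] := proj2 (gr25P w) (conj w0 (ex_intro _ u (ex_intro _ u' erefl))); apply.
- exact: (proj2 (linear_eqnsP W w)).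
- by rewrite qS.
Qed.

Lemma GM_kernel_rank m (G : 'M[K]_(m, 10)) :
  (forall t : 'rV_10, (t <= G)%MS -> [/\ (t <= tangent_mx u u')%MS, (t <= W)%MS &
     polar S w t = 0]) -> (\rank G <= n.+1)%N.
Proof.
move=> GP; have [_ _ [_ _ _ /(_ w GM_point) rk]] := GM; move: rk.
move=> rk; pose X := gr_quadric_section W q.
pose J : 'M[K]_(size (eqns X), 10) := @jacobian K X w.
have rJ : (\rank J + n).+1 = 10%N by exact: rk.
have : G *m J^T = 0.
  apply/row_matrixP => i; rewrite row_mul row0.
  by have [h1 h2 h3] := GP _ (row_sub i G); apply: GM_kernel.
by move/mulmx0_rank_max; rewrite mxrank_tr; lia.
Qed.

(** The tangent space meets [W] in dimension at least 7 + (n + 5) - 10 = n + 2, while smoothness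
    bounds the part orthogonal to [w] by n + 1. *)
Lemma GM_tangent : exists y y',
  ((wedge u y + wedge u' y')%R <= W)%MS /\ polar S w (wedge u y + wedge u' y') != 0.
Proof.
apply: contrapT => nex.
have : (\rank (tangent_mx u u' :&: W)%MS <= n.+1)%N.
  apply: GM_kernel_rank => t; rewrite sub_capmx => /andP[tT tW]; split=> //.
  apply/eqP/negPn/negP => Bt; have /tangent_mxP[y [y' tE]] := tT.
  by apply: nex; exists y, y'; split; rewrite -tE.
have := mxrank_sum_cap (tangent_mx u u') W; have := tangent_mx_rank w0.
have := rank_leq_col (tangent_mx u u' + W)%MS; have [-> _ _] := GM.
lia.
Qed.

(** Otherwise [W] imposes no condition on the tangent space, and orthogonality to [w] leaves
    dimension at least 6, against the bound n + 1 = 5. *)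
Lemma GM_tangent_not_sub : n = 4 -> exists y y', ~~ ((wedge u y + wedge u' y')%R <= W)%MS.
Proof.
move=> n4; apply: contrapT => nex.
pose B : 'cV[K]_10 := S *m w^T + S^T *m w^T.
have BE t : t *m B = (polar S w t)%:M.
  have e : t *m S^T *m w^T = (w *m S *m t^T)^T by rewrite !trmx_mul trmxK mulmxA.
  by rewrite [LHS]lformE /lform /B mulmxDr !mulmxA e mxE [_^T 0 0]mxE addrC.
have : (\rank (tangent_mx u u' :&: kermx B)%MS <= n.+1)%N.
  apply: GM_kernel_rank => t; rewrite sub_capmx => /andP[tT /sub_kermxP tB]; split=> //.
    apply/negPn/negP => tW; have /tangent_mxP[y [y' tE]] := tT.
    by apply: nex; exists y, y'; rewrite -tE.
  by move: tB; rewrite BE => /matrixP/(_ 0 0); rewrite !mxE mulr1n.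
have := mxrank_sum_cap (tangent_mx u u') (kermx B); have := tangent_mx_rank w0.
have := rank_leq_col (tangent_mx u u' + kermx B)%MS.
rewrite mxrank_ker; have := rank_leq_col B; lia.
Qed.

End GM.
End Smoothness.

(** * Bases adapted to a flag *)

Section AdaptedBases.
Variable K : numClosedFieldType.
Implicit Types u v y : 'rV[K]_5.

Lemma wedge_eq0P v u : v != 0 -> wedge v u = 0 -> exists c, u = c *: v.
Proof.
move=> v0 vu; have /submxP[D ->] : (u <= v)%MS.
  apply/negPn/negP => /(row_free_extend (row_free_rV v0)) fA.
  have [|a _ fa] := @row_free_pick _ _ _ _ _ (1%:M : 'M_5) fA; first by rewrite mxrank1.
  have [|b _ fb] := @row_free_pick _ _ _ _ _ (1%:M : 'M_5) fa; first by rewrite mxrank1.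
  have [|c _ fc] := @row_free_pick _ _ _ _ _ (1%:M : 'M_5) fb; first by rewrite mxrank1.
  have := dual_bases_exist (fc : row_free (basis5 v u a b c)).
  set f := (fun i => row i _); set g := (fun i => col i _); case=> gf _.
  have f0 : f (inord 0) = v := row_basis5 v u a b c (isT : 0 < 5)%N.
  have f1 : f (inord 1) = u := row_basis5 v u a b c (isT : 1 < 5)%N.
  have := wedge_pairing_lform (g (inord 0)) (g (inord 1)) v u.
  rewrite vu -f0 -f1 !gf -!val_eqE /= !inordK // /lform mul0mx mxE => /eqP.
  by rewrite mulr1 mul0r subr0 eq_sym oner_eq0.
by exists (D 0 0); rewrite {1}(mx11_scalar D) mul_scalar_mx.
Qed.

Lemma adapted_basis (xi : 'cV[K]_5) (f0 f1 f2 y : 'rV[K]_5) :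
  row_free (col_mx (col_mx f0 f1) f2) -> f0 *m xi = 0 -> f1 *m xi = 0 ->
  f2 *m xi = 0 -> y *m xi != 0 ->
  exists f g, [/\ dual_bases f g,
    [/\ f (inord 0) = f0, f (inord 1) = f1, f (inord 2) = f2 & f (inord 4) = y] &
    f (inord 3) *m xi = 0].
Proof.
move=> fA x0 x1 x2 xy.
have rk : (3 < \rank (kermx xi))%N.
  by rewrite mxrank_ker; have := rank_leq_col xi; lia.
have [f3 /sub_kermxP x3 fB] := row_free_pick fA rk.
have fC : row_free (col_mx (col_mx (col_mx (col_mx f0 f1) f2) f3) y).
  apply: row_free_extend => //; apply: contra xy => /submx_trans yK.
  apply/eqP/sub_kermxP/yK; rewrite !col_mx_sub.
  by do 3?[apply/andP; split]; apply/sub_kermxP.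
exists (fun i => row i (basis5 f0 f1 f2 f3 y)),
  (fun i => col i (invmx (basis5 f0 f1 f2 f3 y))); split.
- exact: (dual_bases_exist (fC : row_free (basis5 f0 f1 f2 f3 y))).
- by split; rewrite row_basis5.
- by rewrite row_basis5.
Qed.

Section Flag.
Variables (S : 'M[K]_10) (om : 'cV[K]_10) (v : 'rV[K]_5) (xi : 'cV[K]_5).
Hypotheses (v0 : v != 0) (xi0 : xi != 0) (vxi : v *m xi = 0).
Hypothesis om_flag : forall w, w *m xi = 0 -> lform om (wedge v w) = 0.

Lemma exists_off_hyperplane : exists y, y *m xi != 0.
Proof.
apply: contrapT => h; case/eqP: xi0; rewrite -[xi]mul1mx.
apply/row_matrixP => i; rewrite row_mul row0.
by apply/eqP/negPn/negP => hi; apply: h; exists (row i 1%:M).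
Qed.

(* Tangent directions at [v /\ u] can be moved within the pencil of points
   [u + l v], since the flag directions do not contribute. *)
Lemma secant_direction u y0 :
  (forall w, w *m xi = 0 -> qform S (wedge v w) = 0) ->
  u *m xi = 0 -> y0 *m xi != 0 -> lform om (wedge u y0) = 0 ->
  (exists y y', lform om (wedge v y + wedge u y') = 0 /\
     polar S (wedge v u) (wedge v y + wedge u y') != 0) ->
  exists l y1, [/\ y1 *m xi != 0, lform om (wedge (u + l *: v) y1) = 0 &
     polar S (wedge (u + l *: v) v) (wedge (u + l *: v) y1) != 0].
Proof.
move=> qv uxi y0xi omu [y [y' [omt Bt]]].
have Bv w : w *m xi = 0 -> polar S (wedge v u) (wedge v w) = 0.
  move=> wxi; have : qform S (wedge v (u + w)) = 0.
    by apply: qv; rewrite mulmxDl uxi wxi addr0.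
  by rewrite wedgeDr qformD !qv // add0r addr0.
have [z [z' [zxi omz Bz]]] : exists y y', [/\ y' *m xi != 0,
    lform om (wedge v y + wedge u y') = 0 &
    polar S (wedge v u) (wedge v y + wedge u y') != 0].
  have [y'xi|y'xi] := eqVneq (y' *m xi) 0; last by exists y, y'.
  pose t := wedge v y + wedge u y'.
  have E c : wedge v y + wedge u (y' + c *: y0) = t + c *: wedge u y0.
    by rewrite wedgeDr wedgeZr addrA.
  (* One of 1 and -1 works: if the sum vanishes, the difference is twice the nonzero value at
     [t]. *)
  have [c c0 Bc] : exists2 c : K, c != 0 &
      polar S (wedge v u) t + c * polar S (wedge v u) (wedge u y0) != 0.
    have [h|h] := eqVneq (polar S (wedge v u) t + polar S (wedge v u) (wedge u y0)) 0.
      exists (-1); first by rewrite oppr_eq0 oner_eq0.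
      rewrite mulN1r; move/eqP: h; rewrite addrC addr_eq0 => /eqP ->.
      by rewrite opprK -mulr2n -mulr_natl mulf_neq0 // pnatr_eq0.
    by exists 1; rewrite ?oner_eq0 ?mul1r.
  exists y, (y' + c *: y0); rewrite E; split.
  - by rewrite mulmxDl y'xi add0r -scalemxAl scaler_eq0 negb_or c0.
  - by rewrite lformD omt lformZ omu mulr0 addr0.
  - by rewrite polarDr polarZr.
have z'0 : lform xi z' != 0.
  by apply: contra_neq zxi => h; rewrite lformE h; apply/matrixP => i j; rewrite !mxE mul0rn.
(* With this [l] the vector z - l z' lies in V4, so replacing u by u + l v changes the tangent
   direction only by an element of V1 /\ V4. *)
pose l := lform xi z / lform xi z'; exists l, z'.
have zl : (z - l *: z') *m xi = 0.
  by rewrite mulmxBl -scalemxAl !lformE scale_scalar_mx divfK // subrr.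
have E : wedge (u + l *: v) z' = wedge v z + wedge u z' - wedge v (z - l *: z').
  rewrite wedgeDl wedgeZl wedgeDr -scaleNr wedgeZr scaleNr opprD opprK.
  by rewrite addrACA subrr add0r.
split; first exact: zxi.
  by rewrite E -scaleN1r lformD lformZ omz (om_flag zl) mulr0 addr0.
have Ew : wedge (u + l *: v) v = - wedge v u.
  by rewrite wedgeDl wedgeZl wedgeaa scaler0 addr0 wedgeN.
by rewrite Ew E polarC polarNr oppr_eq0 polarC polarDr polarNr (Bv _ zl) subr0.
Qed.

End Flag.

(** The last conclusion is the nonvanishing, at the plane spanned by f1 and f4, of the coefficient
    of the variable in which the chart makes the equation linear. *)
Lemma adapted_basis_full (S : 'M[K]_10) v (xi : 'cV[K]_5) :
  v != 0 -> xi != 0 -> v *m xi = 0 ->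
  (forall w, w *m xi = 0 -> qform S (wedge v w) = 0) ->
  (forall u u', wedge u u' != 0 -> qform S (wedge u u') = 0 ->
     exists y y', polar S (wedge u u') (wedge u y + wedge u' y') != 0) ->
  exists f g, [/\ dual_bases f g, f (inord 0) = v,
    forall k, (k < 4)%N -> f (inord k) *m xi = 0 &
    polar S (wedge (f (inord 1)) (f (inord 0))) (wedge (f (inord 1)) (f (inord 4))) != 0].
Proof.
move=> v0 xi0 vxi qv smooth.
have rk : (3 < \rank (kermx xi))%N.
  by rewrite mxrank_ker; have := rank_leq_col xi; lia.
have [|u uxi fu] := row_free_pick (row_free_rV v0) (_ : 1 < \rank (kermx xi))%N.
  exact: ltn_trans rk.
have {}uxi := sub_kermxP uxi.
have vu : wedge v u != 0.
  apply: contraL fu => /eqP/(wedge_eq0P v0)[c ->].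
  rewrite /row_free neq_ltn -addsmxE (addsmx_idPl (scalemx_sub _ _)) //.
  by rewrite rank_rV v0.
have [y0 y0xi] := exists_off_hyperplane xi0.
have om0 (w : 'rV[K]_10) : lform 0 w = 0 by rewrite /lform mulmx0 mxE.
have [|y [y' Bt]] := smooth v u vu; first exact: qv.
have [l [y1 [y1xi _ B1]]] := @secant_direction S 0 v xi (fun _ _ => om0 _) u y0
  qv uxi y0xi (om0 _) (ex_intro _ y (ex_intro _ y' (conj (om0 _) Bt))).
set u1 := u + l *: v in B1.
have u1xi : u1 *m xi = 0 by rewrite mulmxDl -scalemxAl uxi vxi scaler0 addr0.
have fu1 : row_free (col_mx v u1).
  by apply: wedge_row_free; rewrite /u1 wedgeDr wedgeZr wedgeaa scaler0 addr0.
have [|a axi fa] := row_free_pick fu1 (_ : 2 < \rank (kermx xi))%N.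
  exact: ltn_trans rk.
have {}axi := sub_kermxP axi.
have [f [g [fg [f0 f1 f2 f4] f3]]] := adapted_basis fa vxi u1xi axi y1xi.
exists f, g; split; [exact: fg | exact: f0 | | by rewrite f0 f1 f4].
by case=> [|[|[|[|k]]]] // _; rewrite ?f0 ?f1 ?f2 ?f3.
Qed.

Lemma quadratic_pencil_zero (S : 'M[K]_10) a b c : exists s t : K,
  (s, t) != (0, 0) /\ qform S (wedge a (s *: b + t *: c)) = 0.
Proof.
have E s t : qform S (wedge a (s *: b + t *: c)) = s ^+ 2 * qform S (wedge a b) +
    s * t * polar S (wedge a b) (wedge a c) + t ^+ 2 * qform S (wedge a c).
  by rewrite wedgeDr !wedgeZr qform_comb.
have [q0|q0] := eqVneq (qform S (wedge a c)) 0.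
  exists 0, 1; rewrite E q0 expr0n !mul0r mulr0 !addr0; split=> //.
  by rewrite xpair_eqE oner_eq0 andbF.
pose p : {poly K} := (qform S (wedge a b))%:P +
  (polar S (wedge a b) (wedge a c))%:P * 'X + (qform S (wedge a c))%:P * 'X^2.
have /closed_rootP[t /rootP pt] : size p != 1.
  apply/eqP => sp; have : p`_2 = 0 by rewrite nth_default ?sp.
  rewrite !coefD coefC coefCM coefX coefCM coefXn /= mulr0 mulr1 !add0r => h.
  by rewrite h eqxx in q0.
exists 1, t; split; first by rewrite xpair_eqE oner_eq0.
rewrite E -[RHS]pt /p !hornerD !hornerM !hornerC !hornerX.
by rewrite expr1n !mul1r expr2 [t * polar _ _ _]mulrC [t * t * _]mulrC.
Qed.

(** The pair (f1, f2) lets the hyperplane equation be solved for one Pluecker coordinate, and the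
    plane of f1 and f4 lies in the hyperplane. The final alternative is whether [theta] is nonzero
    on V4 or the form vanishes on V1 /\ V4. *)
Lemma adapted_basis_hyperplane (S : 'M[K]_10) (om : 'cV[K]_10) v (xi theta : 'cV[K]_5) :
  isotropic_flag S om 0 1 v xi theta ->
  (forall u u', wedge u u' != 0 -> lform om (wedge u u') = 0 ->
     qform S (wedge u u') = 0 ->
     exists y y', lform om (wedge u y + wedge u' y') = 0 /\
       polar S (wedge u u') (wedge u y + wedge u' y') != 0) ->
  (forall u u', wedge u u' != 0 -> lform om (wedge u u') = 0 ->
     qform S (wedge u u') = 0 ->
     exists y y', lform om (wedge u y + wedge u' y') != 0) ->
  exists f g, [/\ dual_bases f g, f (inord 0) = v,
    forall k, (k < 4)%N -> f (inord k) *m xi = 0,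
    lform om (wedge (f (inord 1)) (f (inord 4))) = 0 /\
    lform om (wedge (f (inord 1)) (f (inord 2))) != 0 &
    lform theta (f (inord 1)) != 0 \/
    polar S (wedge (f (inord 1)) (f (inord 0))) (wedge (f (inord 1)) (f (inord 4))) != 0].
Proof.
move=> [v0 xi0 vxi flag] smooth proper.
have om_flag w : w *m xi = 0 -> lform om (wedge v w) = 0.
  by move=> /flag[_]; rewrite mul0r addr0.
have [y0 y0xi] := exists_off_hyperplane xi0.
have xiy0 : lform xi y0 != 0.
  by apply: contra_neq y0xi => h; rewrite lformE h; apply/matrixP => i j; rewrite !mxE mul0rn.
(* If [om] vanished on the exterior square of V4, its kernel as an alternating form would contain
   the space [V] of dimension at least 3. A pencil in [V] contains a plane isotropic for the
   quadratic form, and the tangent space there would lie in the hyperplane, against [proper]. *)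
have [u [a [uxi axi oma]]] : exists u a,
    [/\ u *m xi = 0, a *m xi = 0 & lform om (wedge u a) != 0].
  apply: contrapT => nex.
  have om0 x y : x *m xi = 0 -> y *m xi = 0 -> lform om (wedge x y) = 0.
    by move=> hx hy; apply/eqP/negPn/negP => h; apply: nex; exists x, y.
  pose mu : 'cV[K]_5 := \col_i lform om (wedge (basis_vec K i) y0).
  have muE x : lform om (wedge x y0) = lform mu x.
    rewrite {1}(row_basis x) wedge_suml /lform mulmx_suml summxE mxE.
    by apply: eq_bigr => i _; rewrite [mu _ _]mxE wedgeZl -scalemxAl [LHS]mxE.
  pose V := kermx (row_mx xi mu).
  have VP x : (x <= V)%MS -> x *m xi = 0 /\ lform om (wedge x y0) = 0.
    move/sub_kermxP; rewrite mul_mx_row => /eqP; rewrite row_mx_eq0 => /andP[/eqP h1 /eqP h2].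
    by split=> //; rewrite muE /lform h2 mxE.
  have rV : (2 < \rank V)%N.
    by rewrite mxrank_ker; have := rank_leq_col (row_mx xi mu); lia.
  have [x xV x0] : exists2 x : 'rV_5, (x <= V)%MS & x != 0.
    by apply/rowV0Pn; apply: contraTneq rV => ->; rewrite mxrank0.
  have [|b bV fb] := row_free_pick (row_free_rV x0) (_ : 1 < \rank V)%N.
    exact: ltn_trans rV.
  have [c cV fc] := row_free_pick fb rV.
  have [s [t [st qst]]] := quadratic_pencil_zero S x b c.
  set x' := s *: b + t *: c in qst.
  have x'V : (x' <= V)%MS by rewrite addmx_sub ?scalemx_sub.
  have xx' : wedge x x' != 0.
    apply: contra st => /eqP/(wedge_eq0P x0)[d dE].
    have : row_mx (row_mx (- d%:M) s%:M) t%:M *m col_mx (col_mx x b) c = 0 :> 'rV_5.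
      by rewrite !mul_row_col mulNmx !mul_scalar_mx -dE /x' -addrA addNr.
    move/eqP; rewrite mulmx_free_eq0 // !row_mx_eq0 => /andP[/andP[_ /eqP s0] /eqP t0].
    by rewrite xpair_eqE; apply/andP; split; [move: s0 | move: t0];
      move/matrixP/(_ 0 0); rewrite !mxE eqxx mulr1n => ->.
  have [[xxi xy0] [x'xi x'y0]] := (VP _ xV, VP _ x'V).
  have omy z w : z *m xi = 0 -> lform om (wedge z y0) = 0 -> lform om (wedge z w) = 0.
    move=> zxi zy0; pose l := lform xi w / lform xi y0.
    rewrite -[w](subrK (l *: y0)) wedgeDr lformD wedgeZr lformZ zy0 mulr0 addr0.
    by apply: (om0 _ _ zxi); rewrite mulmxBl -scalemxAl !lformE scale_scalar_mx divfK // subrr.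
  have [||y [y' /eqP[]]] := proper x x' xx'; [exact: om0 | exact: qst |].
  by rewrite lformD (omy _ _ xxi xy0) (omy _ _ x'xi x'y0) addr0.
(* Two open conditions on w have to hold together; if u and z each violate one of them, u + z
   satisfies both. *)
have [w [wxi [b [bxi omb]] thw]] : exists w, [/\ w *m xi = 0,
    exists b, b *m xi = 0 /\ lform om (wedge w b) != 0 &
    lform theta w != 0 \/ forall z, z *m xi = 0 -> lform theta z = 0].
  have [th0|] := pselect (forall z, z *m xi = 0 -> lform theta z = 0).
    by exists u; split=> //; [exists a | right].
  move/existsNP => [z /not_implyP[zxi /eqP thz]].
  have [thu|thu] := eqVneq (lform theta u) 0; last first.
    by exists u; split=> //; [exists a | left].
  have [omz|omz] := eqVneq (lform om (wedge z a)) 0; last first.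
    by exists z; split=> //; [exists a | left].
  exists (u + z); split; first by rewrite mulmxDl uxi zxi addr0.
    by exists a; split=> //; rewrite wedgeDl lformD omz addr0.
  by left; rewrite lformD thu add0r.
(* A correction inside V4 moves w /\ y0 into the hyperplane and keeps y outside V4. *)
pose y := y0 - (lform om (wedge w y0) / lform om (wedge w b)) *: b.
have yxi : y *m xi != 0 by rewrite mulmxBl -scalemxAl bxi scaler0 subr0.
have omy : lform om (wedge w y) = 0.
  by rewrite wedgeDr -scaleNr wedgeZr lformD lformZ mulNr divfK // subrr.
have [w1 [y1 [w1xi omb1 y1xi omy1 H1]]] : exists w1 y1, [/\ w1 *m xi = 0,
    lform om (wedge w1 b) != 0, y1 *m xi != 0, lform om (wedge w1 y1) = 0 &
    lform theta w1 != 0 \/ polar S (wedge w1 v) (wedge w1 y1) != 0].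
  case: thw => [thw|th0]; first by exists w, y; split=> //; left.
  have qv z : z *m xi = 0 -> qform S (wedge v z) = 0.
    by move=> zxi; have [-> _] := flag z zxi; rewrite th0 // expr0n mulr0.
  have vw : wedge v w != 0.
    apply: contra omb => /eqP/(wedge_eq0P v0)[d ->].
    by rewrite wedgeZl lformZ om_flag // mulr0.
  have [l [z1 [z1xi omz1 B1]]] := secant_direction om_flag qv wxi yxi omy
    (smooth _ _ vw (om_flag _ wxi) (qv _ wxi)).
  exists (w + l *: v), z1; split=> //; last by right.
    by rewrite mulmxDl wxi -scalemxAl vxi scaler0 addr0.
  by rewrite wedgeDl wedgeZl lformD lformZ om_flag // mulr0 addr0.
have fvw : row_free (col_mx v w1).
  apply: row_free_extend; first exact: row_free_rV.
  apply: contra omb1 => /submxP[D ->]; rewrite (mx11_scalar D) mul_scalar_mx.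
  by rewrite wedgeZl lformZ om_flag // mulr0.
have fvwb : row_free (col_mx (col_mx v w1) b).
  (* A relation among v, w1 and b would make w1 /\ b a multiple of v /\ w1, on which [om]
     vanishes. *)
  apply: row_free_extend => //; apply: contra omb1 => /submxP[D bE].
  have {}bE : b = lsubmx D 0 0 *: v + rsubmx D 0 0 *: w1.
    rewrite bE -{1}(hsubmxK D) mul_row_col (mx11_scalar (lsubmx D)).
    by rewrite (mx11_scalar (rsubmx D)) !mul_scalar_mx !mxE.
  rewrite bE wedgeDr !wedgeZr wedgeaa scaler0 addr0 wedgeN lformZ.
  by rewrite -scaleN1r lformZ om_flag // !mulr0.
have [f [g [fg [f0 f1 f2 f4] f3]]] := adapted_basis fvwb vxi w1xi bxi y1xi.
exists f, g; rewrite f0 f1 f2 f4; split; [exact: fg | by [] | | by [] | exact: H1].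
by case=> [|[|[|[|k]]]] // _; rewrite ?f0 ?f1 ?f2 ?f3.
Qed.

End AdaptedBases.

(** * Charts of Gushel-Mukai varieties *)

Section GrassmannianCharts.
Variable K : numFieldType.
Variables (F : nat -> 'rV[K]_5) (G : nat -> 'cV[K]_5).
Hypothesis dual_basisE : forall i j, (i < 5)%N -> (j < 5)%N ->
  lform (G i) (F j) = (i == j)%:R.
Hypothesis dual_expand : forall a, a = lform (G 0) a *: F 0 + lform (G 1) a *: F 1 +
  lform (G 2) a *: F 2 + lform (G 3) a *: F 3 + lform (G 4) a *: F 4.
Let p i j (w : 'rV[K]_10) : K := lform (wedge (G i)^T (G j)^T)^T w.

Definition decomposable (w : 'rV[K]_10) : Prop :=
  w != 0 /\ exists a b : 'rV[K]_5, w = wedge a b.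

(** A plane with p_14 != 0 is spanned by its intersections with the hyperplanes G4 = 0 (this is V4)
    and G1 = 0; [U] and [V] parametrise these hyperplanes. The F 0 coordinate comes last in [V],
    since the equation will be linear in p_10. *)
Let U (a b c d : K) : 'rV[K]_5 := a *: F 1 + b *: F 0 + c *: F 2 + d *: F 3.
Let V (a b c d : K) : 'rV[K]_5 := a *: F 4 + b *: F 2 + c *: F 3 + d *: F 0.

Lemma pE i j a b : p i j (wedge a b) =
  lform (G i) a * lform (G j) b - lform (G j) a * lform (G i) b.
Proof. exact: wedge_pairing_lform. Qed.

Lemma comb_coord i j0 j1 j2 j3 (a b c d : K) :
  (i < 5)%N -> (j0 < 5)%N -> (j1 < 5)%N -> (j2 < 5)%N -> (j3 < 5)%N ->
  lform (G i) (a *: F j0 + b *: F j1 + c *: F j2 + d *: F j3) =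
  (if i == j0 then a else 0) + (if i == j1 then b else 0) +
  (if i == j2 then c else 0) + (if i == j3 then d else 0).
Proof.
move=> i5 h0 h1 h2 h3; rewrite !lformD !lformZ (dual_basisE i5 h0) (dual_basisE i5 h1).
rewrite (dual_basisE i5 h2) (dual_basisE i5 h3).
by congr (_ + _ + _ + _); case: eqP => _; rewrite (mulr1, mulr0).
Qed.

Lemma coordU a b c d : [/\ lform (G 0) (U a b c d) = b, lform (G 1) (U a b c d) = a,
  lform (G 2) (U a b c d) = c, lform (G 3) (U a b c d) = d & lform (G 4) (U a b c d) = 0].
Proof.
by split; (rewrite comb_coord; [|exact isT|exact isT|exact isT|exact isT|exact isT]);
  rewrite [LHS]/= ?add0r ?addr0.
Qed.

Lemma coordV a b c d : [/\ lform (G 0) (V a b c d) = d, lform (G 1) (V a b c d) = 0,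
  lform (G 2) (V a b c d) = b, lform (G 3) (V a b c d) = c & lform (G 4) (V a b c d) = a].
Proof.
by split; (rewrite comb_coord; [|exact isT|exact isT|exact isT|exact isT|exact isT]);
  rewrite [LHS]/= ?add0r ?addr0.
Qed.

Lemma pUV z0 z1 z2 z3 a b c d (w := wedge (U z0 z1 z2 z3) (V a b c d)) :
  [/\ p 1 4 w = z0 * a, p 0 4 w = z1 * a & p 2 4 w = z2 * a] /\
  [/\ p 3 4 w = z3 * a, p 1 2 w = z0 * b & p 1 3 w = z0 * c].
Proof.
have [u0 u1 u2 u3 u4] := coordU z0 z1 z2 z3; have [v0 v1 v2 v3 v4] := coordV a b c d.
rewrite /w !pE u0 u1 u2 u3 u4 v1 v2 v3 v4 !(mul0r, mulr0) !subr0.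
by split; split.
Qed.

Lemma expandU a : lform (G 4) a = 0 ->
  U (lform (G 1) a) (lform (G 0) a) (lform (G 2) a) (lform (G 3) a) = a.
Proof.
move=> h; rewrite [RHS]dual_expand h scale0r addr0 /U.
by rewrite [lform (G 0) a *: _ + _]addrC.
Qed.

Lemma expandV a : lform (G 1) a = 0 ->
  V (lform (G 4) a) (lform (G 2) a) (lform (G 3) a) (lform (G 0) a) = a.
Proof.
move=> h; rewrite [RHS]dual_expand h scale0r addr0 /V [RHS]addrC.
by rewrite -[X in _ = _ + X]addrA [X in _ = _ + X]addrC !addrA.
Qed.

(* Contracting [w = a /\ b] with two functionals gives two vectors spanning the
   same plane, whose coordinates are Pluecker coordinates of [w]. *)
Lemma decomposable_chart w : decomposable w -> p 1 4 w *: w =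
  wedge (U (p 1 4 w) (p 0 4 w) (p 2 4 w) (p 3 4 w))
        (V (p 1 4 w) (p 1 2 w) (p 1 3 w) (p 1 0 w)).
Proof.
move=> [_ [a [b ->]]].
pose u := lform (G 4) b *: a + (- lform (G 4) a) *: b.
pose v := lform (G 1) a *: b + (- lform (G 1) b) *: a.
have uE i : p i 4 (wedge a b) = lform (G i) u.
  by rewrite pE /u lformD !lformZ mulNr [lform (G i) a * _]mulrC.
have vE j : p 1 j (wedge a b) = lform (G j) v.
  by rewrite pE /v lformD !lformZ mulNr [lform (G j) a * _]mulrC.
have u4 : lform (G 4) u = 0 by rewrite -uE pE subrr.
have v1 : lform (G 1) v = 0 by rewrite -vE pE mulrC subrr.
rewrite {2}uE (uE 0) (uE 2) (uE 3) (expandU u4) vE (vE 2) (vE 3) (vE 0) (expandV v1).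
rewrite -(vE 4) pE /u /v wedge_comb mulrNN.
by congr (_ *: _); rewrite mulrC.
Qed.

Lemma hvecU n m (Z : 'rV[K]_m -> 'rV[K]_n) (i0 i1 i2 i3 : 'I_n) : hvec 1 Z ->
  hvec 1 (fun z => U (Z z 0 i0) (Z z 0 i1) (Z z 0 i2) (Z z 0 i3)).
Proof. by move=> hZ; do 3?[apply: hvecD]; apply: hvecZr. Qed.

Lemma hvecV n d (a b c e : 'rV[K]_n -> K) :
  hform d a -> hform d b -> hform d c -> hform d e ->
  hvec d (fun z => V (a z) (b z) (c z) (e z)).
Proof. by move=> ha hb hc he; do 3?[apply: hvecD]; apply: hvecZr. Qed.

Lemma decomposable_cone : cone decomposable.
Proof.
split=> [x []|x c c0 [x0 [a [b ab]]]] //; split.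
  by rewrite scaler_eq0 negb_or c0.
by exists (c *: a), b; rewrite ab wedgeZl.
Qed.

Lemma V0 : V 0 0 0 1 = F 0.
Proof. by rewrite /V !scale0r !add0r scale1r. Qed.

Lemma V_last a b c d : V a b c d = V a b c 0 + d *: F 0.
Proof. by rewrite /V scale0r addr0. Qed.

Definition plucker_proj n (s : seq (nat * nat)) : 'M[K]_(10, n) :=
  \matrix_(k, j) wedge (G (nth (0, 0)%N s j).1)^T (G (nth (0, 0)%N s j).2)^T 0 k.

Lemma plucker_projE n s w (j : 'I_n) :
  (w *m plucker_proj n s) 0 j = p (nth (0, 0)%N s j).1 (nth (0, 0)%N s j).2 w.
Proof.
rewrite /p /lform [LHS]mxE [RHS]mxE; apply: eq_bigr => k _.
by rewrite [plucker_proj _ _ _ _]mxE [_^T k 0]mxE.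
Qed.

Section FullChart.
(** A rational projection of the Grassmannian to P^5 whose general fibre is open in the line spanned
    by [P6] (where p_10 = 0) and [E6] (in V1 /\ V4). The double covers keep t as a further
    coordinate. *)
Let proj6 := plucker_proj 6 [:: (1, 4); (0, 4); (2, 4); (3, 4); (1, 2); (1, 3)]%N.
Let z_ (z : 'rV[K]_6) k := z 0 (inord k).
Let U6 z := U (z_ z 0) (z_ z 1) (z_ z 2) (z_ z 3).
Let P6 z := wedge (U6 z) (V (z_ z 0) (z_ z 4) (z_ z 5) 0).
Let E6 z := wedge (U6 z) (F 0).

Lemma full_hvec : hvec 2 P6 /\ hvec 1 E6.
Proof.
have hU : hvec 1 U6 by apply: hvecU; apply: hvec_id.
split; last by have := hvec_wedge hU (hvec_const _ (F 0)); rewrite addn0.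
by apply: (hvec_wedge hU); apply: hvecV; try apply: hform_coord; apply: hform0.
Qed.

Lemma full_P_proj z : P6 z *m proj6 = z_ z 0 *: z.
Proof.
have [[h1 h2 h3] [h4 h5 h6]] := pUV (z_ z 0) (z_ z 1) (z_ z 2) (z_ z 3)
  (z_ z 0) (z_ z 4) (z_ z 5) 0.
apply/rowP => j; rewrite plucker_projE [RHS]mxE -{3}(inord_val j) -/(z_ z j) /P6 /U6.
case: j => [[|[|[|[|[|[|j]]]]]] hj] //=; rewrite ?h1 ?h2 ?h3 ?h4 ?h5 ?h6 //;
  exact: mulrC.
Qed.

Lemma full_E_proj z : E6 z *m proj6 = 0.
Proof.
have [[h1 h2 h3] [h4 h5 h6]] := pUV (z_ z 0) (z_ z 1) (z_ z 2) (z_ z 3) 0 0 0 1.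
apply/rowP => j; rewrite plucker_projE [RHS]mxE /E6 /U6 -V0.
case: j => [[|[|[|[|[|[|j]]]]]] hj] //=; rewrite ?h1 ?h2 ?h3 ?h4 ?h5 ?h6 //;
  exact: mulr0.
Qed.

Lemma full_decomposable z a c : z_ z 0 != 0 -> a != 0 ->
  decomposable (a *: P6 z + c *: E6 z).
Proof.
move=> z0 a0; split.
  apply: contra_neq z0 => /(congr1 (fun w => (w *m proj6) 0 (inord 0))).
  rewrite mulmxDl -!scalemxAl full_P_proj full_E_proj scaler0 addr0 mul0mx !mxE -/(z_ z 0).
  by move/eqP; rewrite !mulf_eq0 (negbTE a0) orbb => /eqP.
exists (U6 z), (a *: V (z_ z 0) (z_ z 4) (z_ z 5) 0 + c *: F 0).
by rewrite wedgeDr !wedgeZr.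
Qed.

Lemma full_section w : decomposable w -> exists a,
  z_ (w *m proj6) 0 *: w = P6 (w *m proj6) + a *: E6 (w *m proj6).
Proof.
move=> /decomposable_chart H; exists (p 1 0 w).
have zE k : (k < 6)%N -> z_ (w *m proj6) k =
    p (nth (0, 0) [:: (1, 4); (0, 4); (2, 4); (3, 4); (1, 2); (1, 3)] k)%N.1
      (nth (0, 0) [:: (1, 4); (0, 4); (2, 4); (3, 4); (1, 2); (1, 3)] k)%N.2 w.
  by move=> k6; rewrite /z_ plucker_projE inordK.
by rewrite /P6 /E6 /U6 !zE //= H V_last wedgeDr wedgeZr.
Qed.

Lemma full_base : P6 (delta_mx 0 (inord 0)) = wedge (F 1) (F 4) /\
  E6 (delta_mx 0 (inord 0)) = wedge (F 1) (F 0).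
Proof.
have zE k : (k < 6)%N -> z_ (delta_mx 0 (inord 0)) k = (k == 0)%:R.
  by move=> k6; rewrite /z_ mxE eqxx -val_eqE /= !inordK.
by rewrite /P6 /E6 /U6 !zE //= /U /V !scale0r !addr0 !scale1r.
Qed.

Variable S : 'M[K]_10.
Hypothesis S_flag : forall a b c d, qform S (wedge (U a b c d) (F 0)) = 0.
Hypothesis S_dir : bform S (wedge (F 1) (F 0)) (wedge (F 1) (F 4)) +
  bform S (wedge (F 1) (F 4)) (wedge (F 1) (F 0)) != 0.

Lemma ordinary_chart n (Z : pset K n) h h' :
  pirreducible Z -> cone Z ->
  isomorphism_on Z (fun w => decomposable w /\ qform S w = 0) h h' ->
  rational_variety Z 5.
Proof.
move=> irrZ cZ isoZ; have [hP hE] := full_hvec.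
apply: (quadric_section_chart irrZ cZ decomposable_cone isoZ hP hE
  (hform_coord _ (inord 0)) isT _ full_P_proj full_E_proj full_decomposable full_section).
  by move=> z; apply: S_flag.
have [P1 E1] := full_base; exists (delta_mx 0 (inord 0)).
by rewrite P1 E1 mxE !eqxx oner_eq0.
Qed.

Let z6 (z : 'rV[K]_(6 + 1)) : 'rV[K]_6 := lsubmx z.

Lemma hvec_lsubmx n m : hvec 1 (fun z : 'rV[K]_(n + m) => lsubmx z).
Proof.
by move=> i; apply: hform_ext (hform_coord _ (lshift m i)) => z; rewrite mxE.
Qed.

Lemma hvec_rsubmx n m : hvec 1 (fun z : 'rV[K]_(n + m) => rsubmx z).
Proof.
by move=> i; apply: hform_ext (hform_coord _ (rshift n i)) => z; rewrite mxE.
Qed.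

Lemma scale_hsubmx n m c (z : 'rV[K]_(n + m)) :
  row_mx (c *: lsubmx z) (c *: rsubmx z) = c *: z.
Proof. by rewrite -{3}(hsubmxK z) scale_row_mx. Qed.

Lemma qform_block n (A : 'M[K]_n) (w : 'rV[K]_n) (t : 'rV[K]_1) :
  qform (block_mx (- A) 0 0 1%:M) (row_mx w t) = - qform A w + t 0 0 ^+ 2.
Proof.
rewrite /qform mul_row_block !mulmx0 addr0 add0r mulmx1 tr_row_mx mul_row_col.
by rewrite mulmxN mulNmx mxE [X in X + _]mxE [X in _ + X]mxE big_ord1 [t^T _ _]mxE expr2.
Qed.

Lemma bform_block n (A : 'M[K]_n) (w w' : 'rV[K]_n) (t t' : 'rV[K]_1) :
  bform (block_mx (- A) 0 0 1%:M) (row_mx w t) (row_mx w' t') =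
  - bform A w w' + t 0 0 * t' 0 0.
Proof.
rewrite /bform mul_row_block !mulmx0 addr0 add0r mulmx1 tr_row_mx mul_row_col.
by rewrite mulmxN mulNmx mxE [X in X + _]mxE [X in _ + X]mxE big_ord1 [t'^T _ _]mxE.
Qed.

Lemma decomposable_l_cone :
  cone (fun y : 'rV[K]_(10 + 1) => decomposable (lsubmx y)).
Proof.
have [D0 cD] := decomposable_cone; split=> [y /D0|y c c0 /(cD _ _ c0)].
  by apply: contra_neq => ->; rewrite linear0.
by rewrite linearZ.
Qed.

Lemma special6_chart n (Z : pset K n) h h' :
  pirreducible Z -> cone Z ->
  isomorphism_on Z (fun y : 'rV[K]_(10 + 1) => decomposable (lsubmx y) /\
     qform (block_mx (- S) 0 0 1%:M) y = 0) h h' ->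
  rational_variety Z 6.
Proof.
move=> irrZ cZ isoZ; have [hP hE] := full_hvec.
pose P z := row_mx (P6 (z6 z)) (z_ (z6 z) 0 *: rsubmx z) : 'rV[K]_(10 + 1).
pose E z := row_mx (E6 (z6 z)) 0 : 'rV[K]_(10 + 1).
have hz : hvec 1 z6 by apply: hvec_lsubmx.
have hz0 : hform 1 (fun z => z_ (z6 z) 0) by apply: hz.
have hP' : hvec 2 P.
  apply: hvec_row_mx; first exact: (hvec_comp hP hz).
  exact: (hvecZ hz0 (@hvec_rsubmx 6 1)).
have hE' : hvec 1 E.
  apply: hvec_row_mx; first exact: (hvec_comp hE hz).
  by move=> i; apply: (@hform_ext _ _ _ (fun=> 0)) => [z|]; [rewrite mxE|exact: hform0].
pose Phi := block_mx proj6 0 0 1%:M : 'M[K]_(10 + 1, 6 + 1).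
have PhiE (w : 'rV[K]_10) (t : 'rV[K]_1) : row_mx w t *m Phi = row_mx (w *m proj6) t.
  by rewrite /Phi mul_row_block !mulmx0 addr0 add0r mulmx1.
apply: (@quadric_section_chart _ _ _ 6 _ _ _ _ _ _ _ _ Phi P E
  (fun z => z_ (z6 z) 0) irrZ cZ decomposable_l_cone isoZ hP' hE' hz0 isT).
- by move=> z; rewrite /E qform_block S_flag mxE expr0n oppr0 addr0.
- move=> z; rewrite /P PhiE full_P_proj.
  exact: (@scale_hsubmx 6 1 _ z).
- by move=> z; rewrite /E PhiE full_E_proj row_mx0.
- move=> z a c z0 a0; rewrite /P /E !scale_row_mx add_row_mx row_mxKl.
  exact: full_decomposable.
- move=> y /full_section[a aE].
  have yE : y *m Phi = row_mx (lsubmx y *m proj6) (rsubmx y).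
    by rewrite -{1}(hsubmxK y) PhiE.
  exists a; rewrite yE /P /E /z6 row_mxKl row_mxKr scale_row_mx add_row_mx -aE.
  by rewrite scaler0 addr0 -scale_row_mx hsubmxK.
have [P1 E1] := full_base; exists (row_mx (delta_mx 0 (inord 0)) 0 : 'rV[K]_(6 + 1)).
split; first by rewrite /z6 row_mxKl /z_ mxE !eqxx oner_eq0.
rewrite /P /E /z6 row_mxKl row_mxKr scaler0 !bform_block P1 E1 [(0 : 'M_1) _ _]mxE.
by rewrite !mulr0 !addr0 -opprD oppr_eq0.
Qed.

End FullChart.

Section HyperplaneChart.
Let proj5 := plucker_proj 5 [:: (1, 4); (0, 4); (2, 4); (3, 4); (1, 3)]%N.
Let z_ (z : 'rV[K]_5) k := z 0 (inord k).
Let U5 z := U (z_ z 0) (z_ z 1) (z_ z 2) (z_ z 3).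
Variables (S : 'M[K]_10) (om tau : 'cV[K]_10).

(** In the hyperplane section p_12 is determined by p_14 om(U /\ F4) + p_12 om(U /\ F2) + p_13 om(U
    /\ F3) = 0, the F0 term being absent by [om_flag]. Thus p_12 is dropped from the projection, and
    [V5] is the solution with the denominator [beta] cleared. *)
Let beta z := lform om (wedge (U5 z) (F 2)).
Let V5 z := V (beta z * z_ z 0)
  (- (z_ z 0 * lform om (wedge (U5 z) (F 4)) + z_ z 4 * lform om (wedge (U5 z) (F 3))))
  (beta z * z_ z 4) 0.
Let W5 z := wedge (U5 z) (V5 z).
Let E5 z := wedge (U5 z) (F 0).

Hypothesis om_flag : forall a b c d, lform om (wedge (U a b c d) (F 0)) = 0.
Hypothesis S_flag : forall a b c d,
  qform S (wedge (U a b c d) (F 0)) = lform tau (wedge (U a b c d) (F 0)) ^+ 2.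
Hypothesis om14 : lform om (wedge (F 1) (F 4)) = 0.
Hypothesis om12 : lform om (wedge (F 1) (F 2)) != 0.
Hypothesis tau14 : lform tau (wedge (F 1) (F 4)) = 0.
Hypothesis dir : lform tau (wedge (F 1) (F 0)) != 0 \/
  bform S (wedge (F 1) (F 0)) (wedge (F 1) (F 4)) +
  bform S (wedge (F 1) (F 4)) (wedge (F 1) (F 0)) != 0.

Lemma hform_lform n d (l : 'cV[K]_10) (X : 'rV[K]_n -> 'rV[K]_10) :
  hvec d X -> hform d (fun z => lform l (X z)).
Proof. by move=> hX; apply: (hvec_mulmx l hX). Qed.

Lemma hyperplane_hvec : [/\ hvec 3 W5, hvec 1 E5 & hform 1 beta].
Proof.
have hU : hvec 1 U5 by apply: hvecU; apply: hvec_id.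
have hUF k : hvec 1 (fun z => wedge (U5 z) (F k)).
  by have := hvec_wedge hU (hvec_const _ (F k)); rewrite addn0.
have hb : hform 1 beta by apply: hform_lform; apply: hUF.
have hz k : hform 1 (z_^~ k) by apply: hform_coord.
split=> //; last exact: hUF.
apply: (@hvec_wedge _ _ 1 2) => //; apply: hvecV.
- exact: (hformM hb (hz 0)).
- apply: hformN; apply: hformD; first exact: (hformM (hz 0) (hform_lform om (hUF 4))).
  exact: (hformM (hz 4) (hform_lform om (hUF 3))).
- exact: (hformM hb (hz 4)).
- exact: hform0.
Qed.

Lemma hyperplane_W_proj z : W5 z *m proj5 = (beta z * z_ z 0) *: z.
Proof.
have [[h1 h2 h3] [h4 h5 h6]] := pUV (z_ z 0) (z_ z 1) (z_ z 2) (z_ z 3)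
  (beta z * z_ z 0)
  (- (z_ z 0 * lform om (wedge (U5 z) (F 4)) + z_ z 4 * lform om (wedge (U5 z) (F 3))))
  (beta z * z_ z 4) 0.
apply/rowP => j; rewrite plucker_projE [RHS]mxE -{3}(inord_val j) -/(z_ z j) /W5 /U5 /V5.
case: j => [[|[|[|[|[|j]]]]] hj] //=; rewrite ?h1 ?h2 ?h3 ?h4 ?h6 //.
all: by rewrite mulrC // -!mulrA [z_ z 4 * _]mulrC.
Qed.

Lemma hyperplane_E_proj z : E5 z *m proj5 = 0.
Proof.
have [[h1 h2 h3] [h4 h5 h6]] := pUV (z_ z 0) (z_ z 1) (z_ z 2) (z_ z 3) 0 0 0 1.
apply/rowP => j; rewrite plucker_projE [RHS]mxE /E5 /U5 -V0.
case: j => [[|[|[|[|[|j]]]]] hj] //=; rewrite ?h1 ?h2 ?h3 ?h4 ?h6 //;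
  exact: mulr0.
Qed.

Lemma hyperplane_W_om z : lform om (W5 z) = 0.
Proof.
rewrite /W5 /V5 /V !wedgeDr !wedgeZr !lformD !lformZ -/(beta z) om_flag.
by move: (lform _ _) (lform _ _) (beta z) => x y b; ring.
Qed.

Lemma hyperplane_decomposable z a c : beta z * z_ z 0 != 0 -> a != 0 ->
  decomposable (a *: W5 z + c *: E5 z) /\ lform om (a *: W5 z + c *: E5 z) = 0.
Proof.
move=> bz0 a0; split; last first.
  by rewrite lformD !lformZ hyperplane_W_om om_flag !mulr0 addr0.
split.
  apply: contra_neq bz0 => /(congr1 (fun w => (w *m proj5) 0 (inord 0))).
  rewrite mulmxDl -!scalemxAl hyperplane_W_proj hyperplane_E_proj scaler0 addr0 mul0mx.
  rewrite !mxE -/(z_ z 0) => /eqP; rewrite mulf_eq0 (negbTE a0) /= mulf_eq0.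
  by case/orP=> /eqP // ->; rewrite mulr0.
exists (U5 z), (a *: V5 z + c *: F 0).
by rewrite wedgeDr !wedgeZr.
Qed.

Lemma hyperplane_section w : decomposable w -> lform om w = 0 -> exists a,
  (beta (w *m proj5) * z_ (w *m proj5) 0) *: w = W5 (w *m proj5) + a *: E5 (w *m proj5).
Proof.
move=> /decomposable_chart H omw.
have zE k : (k < 5)%N -> z_ (w *m proj5) k =
    p (nth (0, 0) [:: (1, 4); (0, 4); (2, 4); (3, 4); (1, 3)] k)%N.1
      (nth (0, 0) [:: (1, 4); (0, 4); (2, 4); (3, 4); (1, 3)] k)%N.2 w.
  by move=> k5; rewrite /z_ plucker_projE inordK.
set z := w *m proj5; exists (beta z * p 1 0 w).
have UE : U5 z = U (p 1 4 w) (p 0 4 w) (p 2 4 w) (p 3 4 w) by rewrite /U5 !zE.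
rewrite -UE in H.
have lin : p 1 4 w * lform om (wedge (U5 z) (F 4)) + p 1 2 w * beta z +
    p 1 3 w * lform om (wedge (U5 z) (F 3)) = 0.
  have := congr1 (lform om) H; rewrite lformZ omw mulr0 /V.
  by rewrite !wedgeDr !wedgeZr !lformD !lformZ om_flag mulr0 addr0 => ->.
have VE : V5 z = beta z *: V (p 1 4 w) (p 1 2 w) (p 1 3 w) 0.
  rewrite /V5 /V !zE //= !scale0r !addr0 !scalerDr !scalerA; congr (_ + _ *: _ + _).
  apply/eqP; rewrite eq_sym -subr_eq0 opprK -lin; apply/eqP; ring.
rewrite -scalerA zE // H V_last wedgeDr wedgeZr scalerDr scalerA.
by rewrite /W5 VE wedgeZr.
Qed.

Let z5 (z : 'rV[K]_(5 + 1)) : 'rV[K]_5 := lsubmx z.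

Lemma special5_chart n (Z : pset K n) h h' :
  pirreducible Z -> cone Z ->
  isomorphism_on Z (fun y : 'rV[K]_(10 + 1) =>
     (decomposable (lsubmx y) /\ lform om (lsubmx y) = 0) /\
     qform (block_mx (- S) 0 0 1%:M) y = 0) h h' ->
  rational_variety Z 5.
Proof.
move=> irrZ cZ isoZ; have [hW hE hb] := hyperplane_hvec.
pose kappa z := beta (z5 z) * z_ (z5 z) 0.
pose P z := row_mx (W5 (z5 z)) (kappa z *: rsubmx z + W5 (z5 z) *m tau) : 'rV[K]_(10 + 1).
pose E z := row_mx (E5 (z5 z)) (E5 (z5 z) *m tau) : 'rV[K]_(10 + 1).
have hz : hvec 1 z5 by apply: hvec_lsubmx.
have hz0 : hform 1 (fun z => z_ (z5 z) 0) by apply: hz.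
have hk : hform 2 kappa by apply: (hformM (hform_compf hb hz) hz0).
have hP' : hvec 3 P.
  apply: hvec_row_mx; first exact: (hvec_comp hW hz).
  apply: hvecD; first exact: (hvecZ hk (@hvec_rsubmx 5 1)).
  exact: (hvec_mulmx tau (hvec_comp hW hz)).
have hE' : hvec 1 E.
  by apply: hvec_row_mx; [|apply: hvec_mulmx]; exact: (hvec_comp hE hz).
have cC : cone (fun y : 'rV[K]_(10 + 1) => decomposable (lsubmx y) /\ lform om (lsubmx y) = 0).
  have [D0 cD] := decomposable_l_cone; split=> [y [/D0]//|y c c0 [/(cD _ _ c0) Dy omy]].
  by split=> //; rewrite linearZ lformZ omy mulr0.
(* The section of the cover over V1 /\ V4 is t = tau(w), as the form is the square of [tau] there;
   taking t - tau(w) as coordinate puts it in the centre of the projection. *)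
pose Phi := block_mx proj5 (- tau) 0 1%:M : 'M[K]_(10 + 1, 5 + 1).
have PhiE (w : 'rV[K]_10) (t : 'rV[K]_1) :
    row_mx w t *m Phi = row_mx (w *m proj5) (t - w *m tau).
  by rewrite /Phi mul_row_block mulmx0 addr0 mulmx1 mulmxN addrC.
apply: (@quadric_section_chart _ _ _ 5 _ _ _ _ _ _ _ _ Phi P E kappa irrZ cZ cC isoZ
  hP' hE' hk isT).
- by move=> z; rewrite /E qform_block S_flag addNr.
- move=> z; rewrite /P PhiE hyperplane_W_proj addrK.
  exact: (@scale_hsubmx 5 1 _ z).
- by move=> z; rewrite /E PhiE hyperplane_E_proj subrr row_mx0.
- move=> z a c z0 a0; rewrite /P /E !scale_row_mx add_row_mx row_mxKl.
  exact: hyperplane_decomposable.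
- move=> y [Dy omy]; have [a aE] := hyperplane_section Dy omy.
  have yE : y *m Phi = row_mx (lsubmx y *m proj5) (rsubmx y - lsubmx y *m tau).
    by rewrite -{1}(hsubmxK y) PhiE.
  exists a; rewrite /P /E /kappa /z5 yE row_mxKl row_mxKr scale_row_mx add_row_mx.
  rewrite -(@scale_hsubmx 10 1 _ y) aE; congr row_mx.
  have e : W5 (lsubmx y *m proj5) *m tau + a *: (E5 (lsubmx y *m proj5) *m tau) =
      (beta (lsubmx y *m proj5) * z_ (lsubmx y *m proj5) 0) *: (lsubmx y *m tau).
    by rewrite scalemxAl -mulmxDl -aE -scalemxAl.
  by rewrite scalerBr -addrA e subrK.
(* Over the plane of F1 and F4 the coefficient is affine in t with slope a nonzero multiple of
   tau(F1 /\ F0); [dir] says that the slope or the constant term is nonzero. *)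
pose z0 t : 'rV[K]_(5 + 1) := row_mx (delta_mx 0 (inord 0)) t%:M.
have zE t k : (k < 5)%N -> z_ (z5 (z0 t)) k = (k == 0)%:R.
  by move=> k5; rewrite /z_ /z5 row_mxKl mxE eqxx -val_eqE /= !inordK.
have UE t : U5 (z5 (z0 t)) = F 1 by rewrite /U5 !zE //= /U !scale0r !addr0 scale1r.
pose b := lform om (wedge (F 1) (F 2)).
have bE t : beta (z5 (z0 t)) = b by rewrite /beta UE.
have WE t : W5 (z5 (z0 t)) = b *: wedge (F 1) (F 4).
  rewrite /W5 /V5 UE bE !zE //= om14 !mulr0 mul0r add0r oppr0 mulr1 /V !scale0r !addr0.
  by rewrite wedgeZr.
have EE t : E5 (z5 (z0 t)) = wedge (F 1) (F 0) by rewrite /E5 UE.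
have kE t : kappa (z0 t) = b by rewrite /kappa bE zE // mulr1.
have LE t : bform (block_mx (- S) 0 0 1%:M) (E (z0 t)) (P (z0 t)) +
    bform (block_mx (- S) 0 0 1%:M) (P (z0 t)) (E (z0 t)) =
    b * (2 * t * lform tau (wedge (F 1) (F 0)) -
      (bform S (wedge (F 1) (F 0)) (wedge (F 1) (F 4)) +
       bform S (wedge (F 1) (F 4)) (wedge (F 1) (F 0)))).
  rewrite /P /E !bform_block WE EE kE bformZl bformZr row_mxKr.
  have -> : (b *: t%:M + (b *: wedge (F 1) (F 4)) *m tau) 0 0 = b * t.
    by rewrite -scalemxAl lformE tau14 mxE !mxE mulr1n mul0rn mulr0 addr0.
  rewrite -[(_ *m tau) 0 0]/(lform _ _).
  by move: (bform _ _ _) (bform _ _ _) (lform _ _) => x y l; ring.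
have [t Lt] : exists t, 2 * t * lform tau (wedge (F 1) (F 0)) -
      (bform S (wedge (F 1) (F 0)) (wedge (F 1) (F 4)) +
       bform S (wedge (F 1) (F 4)) (wedge (F 1) (F 0))) != 0.
  have [B0|B0] := eqVneq (bform S (wedge (F 1) (F 0)) (wedge (F 1) (F 4)) +
       bform S (wedge (F 1) (F 4)) (wedge (F 1) (F 0))) 0; last first.
    by exists 0; rewrite mulr0 mul0r sub0r oppr_eq0.
  exists 1; rewrite B0 subr0 mulr1 mulf_neq0 ?pnatr_eq0 //.
  by case: dir => //; rewrite B0 eqxx.
by exists (z0 t); rewrite kE LE mulf_neq0.
Qed.

End HyperplaneChart.
End GrassmannianCharts.

Section Points.
Variable K : numFieldType.

Lemma points_cone (X : projScheme K) : homogeneous (eqns X) -> cone (points X).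
Proof.
move=> hX; split=> [x [] //|x c c0 [x0 xX]]; split=> [|q qX].
  by rewrite scaler_eq0 negb_or c0.
have [d hq] := hX q qX.
by rewrite (hform_scale _ _ (hform_peval hq)) xX // mulr0.
Qed.

Lemma section_points (W : 'M[K]_10) w :
  points (gr_linear_section W) w <-> decomposable w /\ (w <= W)%MS.
Proof.
split=> [[w0 H]|[Dw wW]].
  split; last by apply/linear_eqnsP => q qW; apply: H; rewrite mem_cat qW orbT.
  by apply/gr25P; split=> // q qG; apply: H; rewrite mem_cat qG.
have [w0 HG] := proj2 (gr25P w) Dw; split=> // q; rewrite mem_cat => /orP[/HG //|].
exact: (proj2 (linear_eqnsP W w)).
Qed.

Lemma quadric_section_points (W : 'M[K]_10) q w :
  points (gr_quadric_section W q) w <->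
  (decomposable w /\ (w <= W)%MS) /\ peval q w = 0.
Proof.
split=> [[w0 H]|[/section_points[w0 HG] qw]].
  split; last by apply: H; rewrite !mem_cat inE eqxx !orbT.
  by apply/section_points; split=> // r; rewrite mem_cat => /orP[rG|rW];
    apply: H; rewrite !mem_cat ?rG ?rW ?orbT.
split=> // r; rewrite /= catA mem_cat => /orP[/HG //|].
by rewrite inE => /eqP ->.
Qed.

Lemma rank10_full (W : 'M[K]_10) (w : 'rV[K]_10) : \rank W = 10 -> (w <= W)%MS.
Proof. by move=> rW; apply: submx_full; rewrite /row_full rW. Qed.

Lemma rank9_functional (W : 'M[K]_10) : \rank W = 9 ->
  exists om : 'cV[K]_10, forall w : 'rV_10, (w <= W)%MS <-> lform om w = 0.
Proof.
move=> rW; have r1 : \rank (cokermx W) = 1%N by rewrite mxrank_coker rW.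
pose A := col_base (cokermx W).
have AP w : (w <= W)%MS <-> w *m A = 0.
  rewrite submxE -{1}(mulmx_base (cokermx W)) mulmxA mulmx_free_eq0 ?row_base_free //.
  by split=> [/eqP|->].
move: A AP; rewrite r1 => A AP; exists A => w; rewrite AP.
by rewrite lformE; split=> [/matrixP/(_ 0 0)|->]; rewrite ?mxE ?mulr1n // raddf0.
Qed.

Lemma dual_nat (f : 'I_5 -> 'rV[K]_5) (g : 'I_5 -> 'cV[K]_5) : dual_bases f g ->
  let F k := f (inord k) in let G k := g (inord k) in
  (forall i j, (i < 5)%N -> (j < 5)%N -> lform (G i) (F j) = (i == j)%:R) /\
  forall a, a = lform (G 0) a *: F 0 + lform (G 1) a *: F 1 +
    lform (G 2) a *: F 2 + lform (G 3) a *: F 3 + lform (G 4) a *: F 4.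
Proof.
move=> [fg ex]; split=> [i j i5 j5|a]; first by rewrite fg -val_eqE /= !inordK.
by rewrite {1}[a]ex sum5E.
Qed.

Lemma isomorphism_on_ext n m (Z : pset K n) (D D' : pset K m) h h' :
  (forall y, D y <-> D' y) -> isomorphism_on Z D h h' -> isomorphism_on Z D' h h'.
Proof. by move=> DD'; rewrite (_ : D = D') //; apply/funext => y; apply/propext. Qed.

Lemma isomorphism_on_id n (Z : pset K n) : cone Z -> isomorphism_on Z Z id id.
Proof.
move=> [Z0 cZ]; have r : regular_on Z id.
  by apply: (@regular_on_hvec _ _ _ 1) => //; apply: hvec_id.
by split=> // x Zx; split=> //; exists 1; rewrite ?oner_eq0 ?scale1r.
Qed.

Lemma cover_points (W : 'M[K]_10) (q : {mpoly K[10]}) (S : 'M[K]_10) y :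
  (forall x, peval q x = qform S x) ->
  @standard_double_cover K (gr_linear_section W) q y <->
  (decomposable (lsubmx y) /\ (lsubmx y <= W)%MS) /\
  qform (block_mx (- S) 0 0 1%:M) y = 0.
Proof.
move=> qS; pose y' : 'rV[K]_(10 + 1) := y.
have qE : qform (block_mx (- S) 0 0 1%:M) y' = - qform S (lsubmx y') + rsubmx y' 0 0 ^+ 2.
  by rewrite -{1}(hsubmxK y') qform_block.
rewrite -[qform _ y]/(qform _ y') qE; split=> [[Py ty]|[Dy qy]]; split.
- exact: (proj1 (section_points _) Py).
- by rewrite ty [peval _ _]qS addNr.
- exact: (proj2 (section_points _) Dy).
by apply/eqP; rewrite [peval _ _]qS -subr_eq0 addrC; apply/eqP.
Qed.

End Points.

(** * The three types of varieties *)

Section Rationality.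
Variable R : realType.
Local Notation K := R[i].

(** This serves the ordinary fivefolds and the special sixfolds, whose branch loci are ordinary
    fivefolds; in both cases [W] is the whole exterior square. *)
Lemma full_adapted_basis n (W : 'M[K]_10) q S :
  ordinary_GM_data n W q -> n = 5 -> (forall x, peval q x = qform S x) ->
  exists F G,
    [/\ forall i j, (i < 5)%N -> (j < 5)%N -> lform (G i) (F j) = (i == j)%:R :> K,
     forall a, a = lform (G 0) a *: F 0 + lform (G 1) a *: F 1 +
       lform (G 2) a *: F 2 + lform (G 3) a *: F 3 + lform (G 4) a *: F 4,
     forall a b c d, qform S (wedge (a *: F 1 + b *: F 0 + c *: F 2 + d *: F 3) (F 0)) = 0 &
     bform S (wedge (F 1) (F 0)) (wedge (F 1) (F 4)) +
       bform S (wedge (F 1) (F 4)) (wedge (F 1) (F 0)) != 0].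
Proof.
move=> GM n5 qS; have [rW _ _] := GM.
have WT (w : 'rV[K]_10) : (w <= W)%MS by apply: rank10_full; rewrite rW n5.
have [v [xi [theta [v0 xi0 vxi flag]]]] :=
  @exists_isotropic_flag R S 0 1 0 (or_introl (oner_neq0 _)).
have qv w : w *m xi = 0 -> qform S (wedge v w) = 0.
  by move=> /flag[-> _]; rewrite mul0r.
have [u u' uu quu|f [g [fg f0 f3 Bf]]] := adapted_basis_full v0 xi0 vxi qv.
  by have [y [y' [_ By]]] := GM_tangent GM qS uu (WT _) quu; exists y, y'.
have [h1 h2] := dual_nat fg.
exists (fun k => f (inord k)), (fun k => g (inord k)); split=> // a b c d.
rewrite f0 wedgeN -scaleN1r qformZ qv ?mulr0 // !mulmxDl -!scalemxAl vxi.
by rewrite !f3 // !scaler0 !addr0.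
Qed.

Lemma ordinary_rational X : ordinary_GM 5 X -> rational_variety (@points K X) 5.
Proof.
move=> [W [q [GM ->]]]; have [rW hq [hX irrX _ _]] := GM.
have [S [qS _]] := homog2_qform hq.
have [F [G [h1 h2 SF dir]]] := full_adapted_basis GM erefl qS.
have cX := points_cone hX.
apply: (ordinary_chart h1 h2 SF dir irrX cX (isomorphism_on_ext _ (isomorphism_on_id cX))).
move=> w; rewrite quadric_section_points qS; split=> [[[]] //|[Dw qw]].
by split=> //; split=> //; apply: rank10_full.
Qed.

Lemma special6_rational X : special_GM 6 X -> rational_variety (@points K X) 6.
Proof.
move=> [[hX irrX _ _] [W [q [pi [rW _ GM [h [h' [iso _]]]]]]]].
have [_ hq _] := GM; have [S [qS _]] := homog2_qform hq.
have [F [G [h1 h2 SF dir]]] := full_adapted_basis GM erefl qS.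
apply: (special6_chart h1 h2 SF dir irrX (points_cone hX) (isomorphism_on_ext _ iso)).
move=> y; rewrite (cover_points _ qS); split=> [[[]] //|[Dw qw]].
by split=> //; split=> //; apply: rank10_full.
Qed.

Lemma special5_rational X : special_GM 5 X -> rational_variety (@points K X) 5.
Proof.
move=> [[hX irrX _ _] [W [q [pi [rW _ GM [h [h' [iso _]]]]]]]].
have [_ hq _] := GM; have [S [qS _]] := homog2_qform hq.
have [om omP] := rank9_functional rW.
have [v [xi [theta flag]]] :=
  @exists_isotropic_flag R S om 0 1 (or_intror (oner_neq0 _)).
have [||f [g [fg f0 f3 [om14 om12] dir]]] := adapted_basis_hyperplane flag.
- move=> u u' uu /omP uW quu; have [y [y' [/omP tW Bt]]] := GM_tangent GM qS uu uW quu.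
  by exists y, y'.
- move=> u u' uu /omP uW quu.
  have [y [y' tW]] := GM_tangent_not_sub GM qS uu uW quu erefl.
  by exists y, y'; apply: contra tW => /eqP/omP.
have [v0 xi0 vxi H] := flag; have [h1 h2] := dual_nat fg.
have om_v w : w *m xi = 0 -> lform om (wedge v w) = 0.
  by move=> /H[_]; rewrite mul0r addr0.
have thv : lform theta v = 0.
  have [e _] := H v vxi; move: e; rewrite wedgeaa mul1r /qform !mul0mx mxE.
  by move/esym/eqP; rewrite expf_eq0 => /eqP.
(* A linear form on the exterior square restricting, up to sign, to [theta] on V1 /\ V4, since
   [theta] vanishes at v. It vanishes on f1 /\ f4 because the functional dual to f0 kills both
   factors. *)
pose tau : 'cV[K]_10 := (wedge (g (inord 0))^T theta^T)^T.
have tauE a b : lform tau (wedge a b) =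
    lform (g (inord 0)) a * lform theta b - lform theta a * lform (g (inord 0)) b.
  exact: wedge_pairing_lform.
have g0 k : (k < 5)%N -> lform (g (inord 0)) (f (inord k)) = (0 == k)%:R.
  by move=> k5; rewrite h1.
have Ker a b c d : (a *: f (inord 1) + b *: f (inord 0) + c *: f (inord 2) +
    d *: f (inord 3)) *m xi = 0.
  by rewrite !mulmxDl -!scalemxAl !f3 // !scaler0 !addr0.
have omF a b c d : lform om (wedge (a *: f (inord 1) + b *: f (inord 0) +
    c *: f (inord 2) + d *: f (inord 3)) (f (inord 0))) = 0.
  by rewrite f0 wedgeN -scaleN1r lformZ om_v ?mulr0 // -f0.
have SF a b c d : qform S (wedge (a *: f (inord 1) + b *: f (inord 0) +
    c *: f (inord 2) + d *: f (inord 3)) (f (inord 0))) =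
  lform tau (wedge (a *: f (inord 1) + b *: f (inord 0) + c *: f (inord 2) +
    d *: f (inord 3)) (f (inord 0))) ^+ 2.
  move: (Ker a b c d); set w := (_ + _) => wxi; have [e _] := H w wxi.
  rewrite tauE g0 // mulr1 f0 thv mulr0 sub0r sqrrN.
  by rewrite wedgeN -scaleN1r qformZ sqrrN expr1n !mul1r e mul1r.
have tau14 : lform tau (wedge (f (inord 1)) (f (inord 4))) = 0.
  by rewrite tauE !g0 // mul0r mulr0 subr0.
have dir' : lform tau (wedge (f (inord 1)) (f (inord 0))) != 0 \/
    bform S (wedge (f (inord 1)) (f (inord 0))) (wedge (f (inord 1)) (f (inord 4))) +
    bform S (wedge (f (inord 1)) (f (inord 4))) (wedge (f (inord 1)) (f (inord 0))) != 0.
  case: dir => dir; [left|by right].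
  by rewrite tauE !g0 // mul0r mulr1 sub0r oppr_eq0.
apply: (special5_chart (F := fun k => f (inord k)) (G := fun k => g (inord k))
  h1 h2 omF SF om14 om12 tau14 dir' irrX (points_cone hX) (isomorphism_on_ext _ iso)).
by move=> y; rewrite (cover_points _ qS) omP.
Qed.

End Rationality.

Local Close Scope ring_scope.
Unset Implicit Arguments.

Theorem proposition4p3 (R : realType) (n : nat) (X : projScheme R[i])
    (hn : n = 5 \/ n = 6) (hX : GushelMukai n X) :
  rational_variety (points X) n.
Proof.
case: hX => [[-> ordX]|specX]; first exact: ordinary_rational.
by case: hn specX => ->; [exact: special5_rational | exact: special6_rational].
Qed.
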